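(* There is a realisation of the real form $\mathfrak{u}(2|1)$ of the Lie superalgebra $\mathfrak{gl}(2|1)$ as a $\ast$-subalgebra of $H_c(G,E)\otimes\mathcal C$. It is generated by the odd elements $$F_+=\sum_{j=1}^n\bar z_j\otimes f_j^\dagger,\quad \bar F_+=\sum_{j=1}^n z_j\otimes f_j,\quad F_-=2\sum_{j=1}^n\zeta_j\otimes f_j^\dagger,\quad \bar F_-=2\sum_{j=1}^n\bar\zeta_j\otimes f_j .$$ The even subalgebra consists of the elements $E_\pm\otimes1$, $H\otimes 1$ and $$Z_1=Z_0-\Omega_c,\qquad Z_2=\frac12\sum_{j=1}^n[f_j^\dagger,f_j]=\sum_{j=1}^n f_j^\dagger f_j-\frac n2 .$$ The combination $Z_1-Z_2$ is central, and, denoting $Z:=2Z_2-Z_1$, the following relations hold for the $\mathfrak{sl}(2|1)$-subalgebra: $$[H,E_\pm]=\pm2E_\pm,\quad [E_+,E_-]=H,\quad [Z,H]=0,\quad [Z,E_\pm]=0;$$ $$\{F_\pm,F_\pm\}=0,\quad \{\bar F_\pm,\bar F_\pm\}=0,\quad \{F_\pm,\bar F_\pm\}=\pm2E_\pm;$$ $$\{F_+,F_-\}=0,\quad\{\bar F_+,\bar F_-\}=0,\quad \{F_\pm,\bar F_\mp\}=H\mp Z.$$ For the interaction between the even and odd elements, $$[E_\pm,F_\mp]=-F_\pm,\quad [E_\pm,\bar F_\mp]=-\bar F_\pm,\quad [E_\pm,F_\pm]=0,\quad [E_\pm,\bar F_\pm]=0;$$ $$[H,F_\pm]=\pm F_\pm,\quad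 [H,\bar F_\pm]=\pm\bar F_\pm,\quad [Z,F_\pm]=F_\pm,\quad [Z,\bar F_\pm]=-\bar F_\pm .$$ Moreover, the $\ast$-relations $F_\pm^*=\bar F_\mp$, $E_\pm^*=-E_\mp$, $H^*=H$, $Z_1^*=Z_1$, $Z_2^*=Z_2$ hold.
   Context: $E$ is a real vector space of dimension $2n$ with a positive definite symmetric bilinear form $B$ ($\|\alpha\|^2=B(\alpha,\alpha)$); $\langle\cdot,\cdot\rangle$ is the pairing $E^*\times E\to\mathbb{R}$, extended $\mathbb{C}$-bilinearly. $G$ is a finite reflection group acting on $E$ by orthogonal transformations, $\mathcal S$ its set of reflections. For $s\in\mathcal S$, $\alpha_s\in E$, $a_s\in E^*$ are fixed $(-1)$-eigenvectors of $s$ and $\alpha_s^\vee=2a_s/\langle a_s,\alpha_s\rangle$. $c$ is a map from $\mathcal S$ to $\mathbb C$ (or more generally to a family of variables) that is constant on $G$-conjugacy classes. $H_c(G,E)$ is the rational Cherednik algebra, the quotient of $T(E_{\mathbb C}\oplus E_{\mathbb C}^* )\rtimes G$ (where $gX=(g\cdot X)g$) by $[\xi,\eta]=0$ ($\xi,\eta\in E$), $[x,y]=0$ ($x,y\in E^*$), $[\xi,x]=\langle x,\xi\rangle-\sum_{s\in\mathcal S}\langle x,\alpha_s\rangle\langle\alpha_s^\vee,\xi\rangle c(s)s$ ($\xi\in E$, $x\in E^*$). A complex structure $J\in\mathrm{SO}(E,B)$, $J^T=-J$, is fixed, with orthonormal basis $\xi_1,\dots,\xi_n,\eta_1,\dots,\eta_n$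 of $E$ such that $J\xi_j=-\eta_j$, $J\eta_j=\xi_j$, and dual basis $x_1,\dots,x_n,y_1,\dots,y_n$ of $E^*$. Set $z_j=x_j+iy_j$, $\bar z_j=x_j-iy_j$, $\zeta_j=\frac12(\xi_j-i\eta_j)$, $\bar\zeta_j=\frac12(\xi_j+i\eta_j)$, and $E_+=\frac12\sum_j z_j\bar z_j$, $E_-=-2\sum_j\zeta_j\bar\zeta_j$, $H=\sum_j(z_j\zeta_j+\bar z_j\bar\zeta_j)+n-\sum_{s\in\mathcal S}c(s)s$, $Z_0=\sum_j(\bar z_j\bar\zeta_j-z_j\zeta_j)$. $\mathcal C$ is the complex Clifford algebra of $E_{\mathbb C}$ with generators $e_1,\dots,e_{2n}$ ($e_j,e_{n+j}$ corresponding to $\xi_j,\eta_j$), $\{e_j,e_k\}=2\delta_{jk}$; $f_j=\frac12(e_j-ie_{n+j})$, $f_j^\dagger=\frac12(e_j+ie_{n+j})$, so $\{f_j^\dagger,f_k\}=\delta_{jk}$, $\{f_j,f_k\}=0=\{f_j^\dagger,f_k^\dagger\}$. $H_c(G,E)\otimes\mathcal C$ is the ordinary tensor product algebra (elements of the two factors commute, and tensor symbols are often omitted), $\mathbb{Z}_2$-graded through the usual grading of $\mathcal C$. For $s\in\mathcal S$: $\alpha_s^\dagger=\sum_j\langle\bar z_j,\alpha_s\rangle f_j^\dagger$, $(\alpha_s^\dagger)^\vee=\frac{2}{\|\alpha_s\|^2}\sum_k\langle z_k,\alpha_s\rangle f_k$, $\tau_s=1-\alpha_s^\dagger(\alpha_s^\dagger)^\vee\in\mathcal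 C$, and $\Omega_c=\sum_{s\in\mathcal S}c(s)\,s\otimes\tau_s$. The $\ast$-operation is the conjugate-linear anti-involution on $H_c(G,E)\otimes\mathcal C$ with $(a\otimes b)^*=a^*\otimes b^*$, $\xi_j^*=x_j$, $x_j^*=\xi_j$, $\eta_j^*=y_j$, $y_j^*=\eta_j$, $s^*=s$ for $s\in\mathcal S$, and $f_j^*=f_j^\dagger$, $(f_j^\dagger)^*=f_j$.
   Formalization: The odd elements generate only sl(2|1), so the central Z1-Z2 is added as a generator of the whole; *-claims are for any * as specified (none exists for non-real complex c); the real form is the one forced by E_+^*=-E_-, with even part u(1,1)+u(1); injectivity is for n>0. *)

(* Defs.v *)
From HB Require Import structures.
From mathcomp Require Import all_boot all_order all_fingroup all_algebra.
From mathcomp Require Import generic_quotient.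
From mathcomp Require Import boolp reals.
From mathcomp.real_closed Require Import complex.
From mathcomp Require Import ring.

Set Implicit Arguments.
Unset Strict Implicit.
Unset Printing Implicit Defensive.

Import Order.TTheory GRing.Theory Num.Theory.
Local Open Scope ring_scope.
Local Open Scope quotient_scope.

(******************************************************************************)
(* Associative unital algebras given by generators and relations.             *)
(*   [pres rel] is the k-algebra generated by X subject to the relations      *)
(*   [rel], a set of pairs of noncommutative polynomial expressions.  It may  *)
(*   a priori be the zero ring, so it is a pzRingType and an lmodType, with   *)
(*   the two compatibility laws [pres_scalerAl] and [pres_scalerAr].          *)
(******************************************************************************)

Inductive term (k X : Type) : Type :=
  | Gen of X
  | Zero
  | One
  | Add of term k X & term k X
  | Mul of term k X & term k X
  | Scale of k & term k X.

Arguments Gen {k X}.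
Arguments Zero {k X}.
Arguments One {k X}.

Declare Scope word_scope.
Delimit Scope word_scope with W.
Bind Scope word_scope with term.
Notation "0" := Zero : word_scope.
Notation "1" := One : word_scope.
Notation "s + t" := (Add s t) : word_scope.
Notation "s * t" := (Mul s t) : word_scope.
Notation "a *: t" := (Scale a t) : word_scope.

HB.instance Definition _ (k X : Type) := gen_eqMixin (term k X).
HB.instance Definition _ (k X : Type) := gen_choiceMixin (term k X).

Section Presentation.
Variables (k : comNzRingType) (X : Type).
Variable rel : term k X -> term k X -> Prop.

Inductive cong : term k X -> term k X -> Prop :=
  | cong_rel s t : rel s t -> cong s t
  | cong_refl t : cong t t
  | cong_sym s t : cong s t -> cong t s
  | cong_trans s t u : cong s t -> cong t u -> cong s u
  | cong_add s s' t t' : cong s s' -> cong t t' -> cong (s + t)%W (s' + t')%W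
  | cong_mul s s' t t' : cong s s' -> cong t t' -> cong (s * t)%W (s' * t')%W
  | cong_scale a t t' : cong t t' -> cong (a *: t)%W (a *: t')%W
  | cong_addA s t u : cong (s + (t + u))%W (s + t + u)%W
  | cong_addC s t : cong (s + t)%W (t + s)%W
  | cong_add0 t : cong (0 + t)%W t
  | cong_addN t : cong (-1 *: t + t)%W 0%W
  | cong_mulA s t u : cong (s * (t * u))%W (s * t * u)%W
  | cong_mul1 t : cong (1 * t)%W t
  | cong_mulr1 t : cong (t * 1)%W t
  | cong_mulDl s t u : cong ((s + t) * u)%W (s * u + t * u)%W
  | cong_mulDr s t u : cong (s * (t + u))%W (s * t + s * u)%W
  | cong_scaleA a b t : cong (a *: (b *: t))%W ((a * b)%R *: t)%W
  | cong_scale1 t : cong (1%R *: t)%W t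
  | cong_scaleDr a s t : cong (a *: (s + t))%W (a *: s + a *: t)%W
  | cong_scaleDl a b t : cong ((a + b)%R *: t)%W (a *: t + b *: t)%W
  | cong_scaleAl a s t : cong (a *: (s * t))%W ((a *: s) * t)%W
  | cong_scaleAr a s t : cong (a *: (s * t))%W (s * (a *: t))%W.

Definition congb (s t : term k X) : bool := `[< cong s t >].

Fact congb_refl : reflexive congb.
Proof. by move=> t; apply/asboolP; apply: cong_refl. Qed.

Fact congb_sym : symmetric congb.
Proof.
by move=> s t; apply/asboolP/asboolP => h; apply: cong_sym.
Qed.

Fact congb_trans : transitive congb.
Proof.
by move=> t s u /asboolP h1 /asboolP h2; apply/asboolP; apply: cong_trans h1 h2.
Qed.

Canonical congb_equiv := EquivRel congb congb_refl congb_sym congb_trans.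

Definition pres : Type := {eq_quot congb}.

HB.instance Definition _ := Choice.on pres.
HB.instance Definition _ : EqQuotient _ congb pres := EqQuotient.on pres.

Definition pclass (t : term k X) : pres := \pi_pres t.

Lemma pclassP s t : cong s t -> pclass s = pclass t.
Proof. by move=> h; apply/eqmodP/asboolP. Qed.

Lemma pclass_cong s t : pclass s = pclass t -> cong s t.
Proof. by move=> /eqmodP/asboolP. Qed.

Lemma pclass_ind (P : pres -> Prop) : (forall t, P (pclass t)) -> forall u, P u.
Proof. by move=> h u; rewrite -[u]reprK; apply: h. Qed.

Lemma cong_repr t : cong (repr (pclass t)) t.
Proof. by apply: pclass_cong; rewrite /pclass reprK. Qed.

Definition pres_add (u v : pres) : pres := pclass (repr u + repr v)%W.
Definition pres_opp (u : pres) : pres := pclass (-1 *: repr u)%W.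
Definition pres_mul (u v : pres) : pres := pclass (repr u * repr v)%W.
Definition pres_scale (a : k) (u : pres) : pres := pclass (a *: repr u)%W.

Lemma pclassD s t : pres_add (pclass s) (pclass t) = pclass (s + t)%W.
Proof. by apply: pclassP; apply: cong_add; apply: cong_repr. Qed.
Lemma pclassN t : pres_opp (pclass t) = pclass (-1 *: t)%W.
Proof. by apply: pclassP; apply: cong_scale; apply: cong_repr. Qed.
Lemma pclassM s t : pres_mul (pclass s) (pclass t) = pclass (s * t)%W.
Proof. by apply: pclassP; apply: cong_mul; apply: cong_repr. Qed.
Lemma pclassZ a t : pres_scale a (pclass t) = pclass (a *: t)%W.
Proof. by apply: pclassP; apply: cong_scale; apply: cong_repr. Qed.

Fact pres_addA : associative pres_add.
Proof.
elim/pclass_ind=> s; elim/pclass_ind=> t; elim/pclass_ind=> u.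
by rewrite !pclassD; apply: pclassP; apply: cong_addA.
Qed.
Fact pres_addC : commutative pres_add.
Proof.
elim/pclass_ind=> s; elim/pclass_ind=> t.
by rewrite !pclassD; apply: pclassP; apply: cong_addC.
Qed.
Fact pres_add0 : left_id (pclass 0%W) pres_add.
Proof.
by elim/pclass_ind=> s; rewrite pclassD; apply: pclassP; apply: cong_add0.
Qed.
Fact pres_addN : left_inverse (pclass 0%W) pres_opp pres_add.
Proof.
elim/pclass_ind=> s; rewrite pclassN pclassD; apply: pclassP.
exact: cong_addN.
Qed.

HB.instance Definition _ :=
  GRing.isZmodule.Build pres pres_addA pres_addC pres_add0 pres_addN.

Fact pres_mulA : associative pres_mul.
Proof.
elim/pclass_ind=> s; elim/pclass_ind=> t; elim/pclass_ind=> u.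
by rewrite !pclassM; apply: pclassP; apply: cong_mulA.
Qed.
Fact pres_mul1 : left_id (pclass 1%W) pres_mul.
Proof.
by elim/pclass_ind=> s; rewrite pclassM; apply: pclassP; apply: cong_mul1.
Qed.
Fact pres_mulr1 : right_id (pclass 1%W) pres_mul.
Proof.
by elim/pclass_ind=> s; rewrite pclassM; apply: pclassP; apply: cong_mulr1.
Qed.
Fact pres_mulDl : left_distributive pres_mul pres_add.
Proof.
elim/pclass_ind=> s; elim/pclass_ind=> t; elim/pclass_ind=> u.
rewrite !(pclassD, pclassM); apply: pclassP.
exact: cong_mulDl.
Qed.
Fact pres_mulDr : right_distributive pres_mul pres_add.
Proof.
elim/pclass_ind=> s; elim/pclass_ind=> t; elim/pclass_ind=> u.
rewrite !(pclassD, pclassM); apply: pclassP.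
exact: cong_mulDr.
Qed.

HB.instance Definition _ := GRing.Zmodule_isPzRing.Build pres
  pres_mulA pres_mul1 pres_mulr1 pres_mulDl pres_mulDr.

Fact pres_scaleA a b u : pres_scale a (pres_scale b u) = pres_scale (a * b) u.
Proof.
by elim/pclass_ind: u => t; rewrite !pclassZ; apply: pclassP; apply: cong_scaleA.
Qed.
Fact pres_scale1 : left_id 1 pres_scale.
Proof.
by elim/pclass_ind=> t; rewrite pclassZ; apply: pclassP; apply: cong_scale1.
Qed.
Fact pres_scaleDr : right_distributive pres_scale pres_add.
Proof.
move=> a; elim/pclass_ind=> s; elim/pclass_ind=> t.
rewrite !(pclassD, pclassZ); apply: pclassP.
exact: cong_scaleDr.
Qed.
Fact pres_scaleDl u : {morph pres_scale^~ u : a b / a + b >-> pres_add a b}.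
Proof.
move=> a b; elim/pclass_ind: u => t.
rewrite !(pclassZ, pclassD); apply: pclassP.
exact: cong_scaleDl.
Qed.

HB.instance Definition _ := GRing.Zmodule_isLmodule.Build k pres
  pres_scaleA pres_scale1 pres_scaleDr pres_scaleDl.

Definition pgen (x : X) : pres := pclass (Gen x).

Lemma pclass0E : pclass 0%W = 0. Proof. by []. Qed.
Lemma pclass1E : pclass 1%W = 1. Proof. by []. Qed.
Lemma pclassDE s t : pclass (s + t)%W = pclass s + pclass t.
Proof. by rewrite -pclassD. Qed.
Lemma pclassME s t : pclass (s * t)%W = pclass s * pclass t.
Proof. by rewrite -pclassM. Qed.
Lemma pclassZE a t : pclass (a *: t)%W = a *: pclass t.
Proof. by rewrite -pclassZ. Qed.
Definition pclassE := (pclass0E, pclass1E, pclassDE, pclassME, pclassZE).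

Lemma pres_scalerAl a (u v : pres) : a *: (u * v) = (a *: u) * v.
Proof.
elim/pclass_ind: u => s; elim/pclass_ind: v => t; rewrite -pclassME -!pclassZE -pclassME.
by apply: pclassP; apply: cong_scaleAl.
Qed.

Lemma pres_scalerAr a (u v : pres) : a *: (u * v) = u * (a *: v).
Proof.
elim/pclass_ind: u => s; elim/pclass_ind: v => t; rewrite -pclassME -!pclassZE -pclassME.
by apply: pclassP; apply: cong_scaleAr.
Qed.

Lemma prelP s t : rel s t -> pclass s = pclass t.
Proof. by move=> h; apply: pclassP; apply: cong_rel. Qed.

End Presentation.

(* The tensor product of two algebras: it is spanned by the symbols a ⊗ b,    *)
(* which are bilinear and multiply by (a ⊗ b)(a' ⊗ b') = aa' ⊗ bb'.           *)
Section TensorProduct.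
Variables (k : comNzRingType) (X Y : Type).
Variables (relX : term k X -> term k X -> Prop).
Variables (relY : term k Y -> term k Y -> Prop).
Local Notation A := (pres relX).
Local Notation B := (pres relY).

Inductive tens_rel : term k (A * B) -> term k (A * B) -> Prop :=
  | tens_linl c a a' b :
      tens_rel (Gen (c *: a + a', b)) (c *: Gen (a, b) + Gen (a', b))%W
  | tens_linr c a b b' :
      tens_rel (Gen (a, c *: b + b')) (c *: Gen (a, b) + Gen (a, b'))%W
  | tens_mul a a' b b' :
      tens_rel (Gen (a, b) * Gen (a', b'))%W (Gen (a * a', b * b'))
  | tens_one : tens_rel (Gen (1, 1)) 1%W.

Definition tens : Type := pres tens_rel.
Definition tensor (a : A) (b : B) : tens := pgen tens_rel (a, b).

End TensorProduct.

Notation "a ⊗ b" := (tensor a b) (at level 39, left associativity).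

(* [sbracket p q u v] is the superbracket of homogeneous elements u, v of     *)
(* parity p, q; [lie_gen gens p] is the parity p part of the complex Lie      *)
(* superalgebra generated by the homogeneous elements u with [gens q u].      *)
Definition comm (A : pzRingType) (u v : A) : A := u * v - v * u.
Definition acomm (A : pzRingType) (u v : A) : A := u * v + v * u.
Definition sbracket (A : pzRingType) (p q : bool) (u v : A) : A :=
  u * v - (-1) ^+ (p && q) * (v * u).

Section GeneratedLieSuperalgebra.
Variables (k : comNzRingType) (X : Type) (rel : term k X -> term k X -> Prop).
Variable gens : bool -> pres rel -> Prop.

Inductive lie_gen : bool -> pres rel -> Prop :=
  | lie_gen_in p u : gens p u -> lie_gen p u
  | lie_gen0 p : lie_gen p 0
  | lie_genD p a u v : lie_gen p u -> lie_gen p v -> lie_gen p (a *: u + v)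
  | lie_gen_br p q u v :
      lie_gen p u -> lie_gen q v -> lie_gen (p (+) q) (sbracket p q u v).

End GeneratedLieSuperalgebra.

(* gl(2|1) as complex 3 x 3 matrices; the last index is odd.                  *)
Section GL21.
Variable R : realType.
Local Notation gl21 := 'M[R[i]]_3.

Definition gl21_par (i : 'I_3) : bool := i == 2%N :> nat.

Definition gl21_homog (p : bool) (X : gl21) : Prop :=
  forall i j, gl21_par i (+) gl21_par j != p -> X i j = 0.

Definition gl21_str (X : gl21) : R[i] := \sum_i (-1) ^+ gl21_par i * X i i.

(* The *-operation X |-> D X^dagger D, with D = diag(1, -1, 1), of the real   *)
(* form u(2|1): the even X with X^* = - X and the odd X with X^* = 'i X.      *)
(* As e_12^* = - e_21, the even part of u(2|1) is here u(1,1) + u(1), and not *)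
(* u(2) + u(1): this is the real form forced by E_+^* = - E_- and H^* = H.    *)
Definition u21_star (X : gl21) : gl21 :=
  let d (i : 'I_3) : R[i] := (-1) ^+ (i == 1%N :> nat) in
  \matrix_(i, j) (d i * (X j i)^* * d j).

End GL21.

Section Setting.
Variables (R : realType) (E : vectType R).

Definition dual := 'Hom(E, R^o).
Definition pair (x : dual) (v : E) : R := x v.

Variables (gT : finGroupType) (rho : gT -> 'End(E)).

(* An orthogonal transformation is a reflection when it fixes exactly a       *)
(* hyperplane.                                                                *)
Definition reflections : {set gT} :=
  [set s | (\dim (fixedSpace (rho s))).+1 == \dim {:E}].

Definition dual_act (g : gT) (x : dual) : dual := (x \o rho g^-1%g)%VF.

End Setting.

(* [K] is a commutative C-algebra in which the parameters c(s) live: K = C^o  *)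
(* for complex parameters, or a polynomial algebra when they are variables.   *)
Record setting (R : realType) (n : nat) (E : vectType R) (gT : finGroupType)
    (K : comAlgType R[i]) := Setting {
  dimE : \dim {:E} = n.*2;
  form : E -> E -> R;
  form_lin : forall a u v w, form (a *: u + v) w = a * form u w + form v w;
  form_sym : forall u v, form u v = form v u;
  form_pos : forall u, u != 0 -> 0 < form u u;

  rho : gT -> 'End(E);
  rho1 : rho 1%g = \1%VF;
  rhoM : forall g h, rho (g * h)%g = (rho g \o rho h)%VF;
  rho_inj : injective rho;
  rho_orth : forall g u v, form (rho g u) (rho g v) = form u v;
  rho_gen : <<reflections rho>>%g = [set: gT];

  alpha : gT -> E;
  alpha_eigen : forall s, s \in reflections rho ->
    alpha s != 0 /\ rho s (alpha s) = - alpha s;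
  coalpha : gT -> dual E;
  coalpha_eigen : forall s, s \in reflections rho ->
    coalpha s != 0 /\ dual_act rho s (coalpha s) = - coalpha s;

  c : gT -> K;
  cJ : forall s g, s \in reflections rho -> c (s ^ g)%g = c s;

  J : 'End(E);
  J_orth : forall u v, form (J u) (J v) = form u v;
  J_det : \det (passmx.mxof (vbasis {:E}) (vbasis {:E}) J) = 1;
  J_skew : forall u v, form (J u) v = - form u (J v);

  xi : 'I_n -> E;
  eta : 'I_n -> E;
  xi_eta_basis : basis_of {:E} (codom xi ++ codom eta);
  form_xi : forall j k, form (xi j) (xi k) = (j == k)%:R;
  form_eta : forall j k, form (eta j) (eta k) = (j == k)%:R;
  form_xi_eta : forall j k, form (xi j) (eta k) = 0;
  J_xi : forall j, J (xi j) = - eta j;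
  J_eta : forall j, J (eta j) = xi j;

  xx : 'I_n -> dual E;
  yy : 'I_n -> dual E;
  xx_xi : forall j k, pair (xx j) (xi k) = (j == k)%:R;
  xx_eta : forall j k, pair (xx j) (eta k) = 0;
  yy_xi : forall j k, pair (yy j) (xi k) = 0;
  yy_eta : forall j k, pair (yy j) (eta k) = (j == k)%:R
}.

(* H_c(G, E) is generated by K, E, E^* and G. The R-linearity relations on   *)
(* the generators in E and E^* make the C-algebra they generate the tensor    *)
(* algebra of the complexification of E + E^*, and the relations ch_G_one to  *)
(* ch_GX its semidirect product with G.                                       *)

Section Cherednik.
Variables (R : realType) (n : nat) (E : vectType R) (gT : finGroupType).
Variables (K : comAlgType R[i]) (D : setting n E gT K).
Local Notation C := R[i].
Local Notation S := (reflections (rho D)).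

Definition alphav (s : gT) : dual E :=
  (2 / pair (coalpha D s) (alpha D s)) *: coalpha D s.

Inductive hgen := HK of K | HE of E | HX of dual E | HG of gT.

Let tK k : term C hgen := Gen (HK k).
Let tE v : term C hgen := Gen (HE v).
Let tX x : term C hgen := Gen (HX x).
Let tG g : term C hgen := Gen (HG g).
Let tcomm (s t : term C hgen) := (s * t + -1 *: (t * s))%W.

Definition cherednik_coef (x : dual E) (v : E) (s : gT) : C :=
  (pair x (alpha D s) * pair (alphav s) v)%:C%C.

Inductive cherednik_rel : term C hgen -> term C hgen -> Prop :=
  | ch_K_lin a k l : cherednik_rel (tK (a *: k + l)) (a *: tK k + tK l)%W
  | ch_K_mul k l : cherednik_rel (tK (k * l)) (tK k * tK l)%W
  | ch_K_one : cherednik_rel (tK 1) 1%W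
  | ch_K_central k h : cherednik_rel (tK k * Gen h)%W (Gen h * tK k)%W
  | ch_E_lin (a : R) v w :
      cherednik_rel (tE (a *: v + w)) (a%:C%C *: tE v + tE w)%W
  | ch_X_lin (a : R) x y :
      cherednik_rel (tX (a *: x + y)) (a%:C%C *: tX x + tX y)%W
  | ch_G_one : cherednik_rel (tG 1%g) 1%W
  | ch_G_mul g h : cherednik_rel (tG (g * h)%g) (tG g * tG h)%W
  | ch_GE g v : cherednik_rel (tG g * tE v)%W (tE (rho D g v) * tG g)%W
  | ch_GX g x : cherednik_rel (tG g * tX x)%W (tX (dual_act (rho D) g x) * tG g)%W
  | ch_EE v w : cherednik_rel (tcomm (tE v) (tE w)) 0%W
  | ch_XX x y : cherednik_rel (tcomm (tX x) (tX y)) 0%W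
  | ch_EX v x : cherednik_rel (tcomm (tE v) (tX x))
      ((pair x v)%:C%C *: 1 +
       -1 *: \big[@Add C hgen/@Zero C hgen]_(s in S)
               (cherednik_coef x v s *: (tK (c D s) * tG s)))%W.

Definition Hc : Type := pres cherednik_rel.

Definition iK (k : K) : Hc := pgen cherednik_rel (HK k).
Definition iE (v : E) : Hc := pgen cherednik_rel (HE v).
Definition iX (x : dual E) : Hc := pgen cherednik_rel (HX x).
Definition iG (g : gT) : Hc := pgen cherednik_rel (HG g).

Definition zv (j : 'I_n) : Hc := iX (xx D j) + 'i *: iX (yy D j).
Definition zbar (j : 'I_n) : Hc := iX (xx D j) - 'i *: iX (yy D j).
Definition zeta (j : 'I_n) : Hc :=
  2^-1 *: (iE (xi D j) - 'i *: iE (eta D j)).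
Definition zetabar (j : 'I_n) : Hc :=
  2^-1 *: (iE (xi D j) + 'i *: iE (eta D j)).

Definition hEp : Hc := 2^-1 *: \sum_j zv j * zbar j.
Definition hEm : Hc := - 2 *: \sum_j zeta j * zetabar j.
Definition hH : Hc :=
  \sum_j (zv j * zeta j + zbar j * zetabar j) + n%:R
  - \sum_(s in S) iK (c D s) * iG s.
Definition hZ0 : Hc := \sum_j (zbar j * zetabar j - zv j * zeta j).

End Cherednik.

Section Clifford.
Variables (R : realType) (n : nat).
Local Notation C := R[i].

(* The generator of index j < n is attached to xi_j and that of index n + j   *)
(* to eta_j.                                                                  *)
Inductive cliff_rel : term C 'I_(n + n) -> term C 'I_(n + n) -> Prop :=
  | cliff_anti j k : cliff_rel (Gen j * Gen k + Gen k * Gen j)%W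
                               ((2 * (j == k)%:R)%R *: 1)%W.

Definition Cl : Type := pres cliff_rel.

Definition clE (j : 'I_(n + n)) : Cl := pgen cliff_rel j.
Definition clF (j : 'I_n) : Cl :=
  2^-1 *: (clE (lshift n j) - 'i *: clE (rshift n j)).
Definition clFd (j : 'I_n) : Cl :=
  2^-1 *: (clE (lshift n j) + 'i *: clE (rshift n j)).

Inductive cl_homog : bool -> Cl -> Prop :=
  | cl_homog0 p : cl_homog p 0
  | cl_homog1 : cl_homog false 1
  | cl_homogE p j u : cl_homog p u -> cl_homog (~~ p) (clE j * u)
  | cl_homogD p a u v : cl_homog p u -> cl_homog p v -> cl_homog p (a *: u + v).

End Clifford.

Section CherednikClifford.
Variables (R : realType) (n : nat) (E : vectType R) (gT : finGroupType).
Variables (K : comAlgType R[i]) (D : setting n E gT K).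
Local Notation C := R[i].
Local Notation S := (reflections (rho D)).
Local Notation Cl := (Cl R n).
Local Notation f := (@clF R n).
Local Notation fd := (@clFd R n).

Definition HC : Type := tens (cherednik_rel D) (@cliff_rel R n).

Inductive hc_homog (p : bool) : HC -> Prop :=
  | hc_homog0 : hc_homog p 0
  | hc_homog_tens (a : Hc D) (b : Cl) : cl_homog p b -> hc_homog p (a ⊗ b)
  | hc_homogD u v : hc_homog p u -> hc_homog p v -> hc_homog p (u + v).

Definition pair_z (j : 'I_n) (v : E) : C :=
  (pair (xx D j) v)%:C%C + 'i * (pair (yy D j) v)%:C%C.
Definition pair_zbar (j : 'I_n) (v : E) : C :=
  (pair (xx D j) v)%:C%C - 'i * (pair (yy D j) v)%:C%C.

Definition alphad (s : gT) : Cl := \sum_j pair_zbar j (alpha D s) *: fd j.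
Definition alphad_v (s : gT) : Cl :=
  (2 / form D (alpha D s) (alpha D s))%:C%C *:
    \sum_k pair_z k (alpha D s) *: f k.
Definition tau (s : gT) : Cl := 1 - alphad s * alphad_v s.

Definition Omega : HC := \sum_(s in S) (iK D (c D s) * iG D s) ⊗ tau s.

Definition Ep : HC := hEp D ⊗ (1 : Cl).
Definition Em : HC := hEm D ⊗ (1 : Cl).
Definition Hh : HC := hH D ⊗ (1 : Cl).
Definition Z1 : HC := hZ0 D ⊗ (1 : Cl) - Omega.
Definition Z2 : HC := (1 : Hc D) ⊗ (2^-1 *: \sum_j comm (fd j) (f j)).
Definition Zz : HC := 2 *: Z2 - Z1.
Definition Fp : HC := \sum_j zbar D j ⊗ fd j.
Definition Fbp : HC := \sum_j zv D j ⊗ f j.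
Definition Fm : HC := 2 *: \sum_j zeta D j ⊗ fd j.
Definition Fbm : HC := 2 *: \sum_j zetabar D j ⊗ f j.

(* Conjugate-linear anti-involution of H_c(G, E) ⊗ Cl. The values c(s) are    *)
(* fixed: such a * exists when they are variables or real numbers (see        *)
(* [star_exists] below), but not for arbitrary complex parameters.            *)
Record is_star (stH : Hc D -> Hc D) (stC : Cl -> Cl) (st : HC -> HC) : Prop := {
  star_lin : forall a u v, st (a *: u + v) = a^* *: st u + st v;
  starM : forall u v, st (u * v) = st v * st u;
  starK : involutive st;
  star_tens : forall a b, st (a ⊗ b) = stH a ⊗ stC b;
  star_xi : forall j, stH (iE D (xi D j)) = iX D (xx D j);
  star_x : forall j, stH (iX D (xx D j)) = iE D (xi D j);
  star_eta : forall j, stH (iE D (eta D j)) = iX D (yy D j);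
  star_y : forall j, stH (iX D (yy D j)) = iE D (eta D j);
  star_s : forall s, s \in S -> stH (iG D s) = iG D s;
  star_c : forall s, s \in S -> stH (iK D (c D s)) = iK D (c D s);
  star_f : forall j, stC (f j) = fd j;
  star_fd : forall j, stC (fd j) = f j
}.

End CherednikClifford.

Section AntiMorphism.
Variables (k : comNzRingType) (X Y : Type).
Variables (relX : term k X -> term k X -> Prop).
Variables (relY : term k Y -> term k Y -> Prop).
Variables (sg : {rmorphism k -> k}) (f : X -> pres relY).

Fixpoint anti_eval (t : term k X) : pres relY :=
  match t with
  | Gen x => f x
  | Zero => 0
  | One => 1
  | Add s t => anti_eval s + anti_eval t
  | Mul s t => anti_eval t * anti_eval s
  | Scale a t => sg a *: anti_eval t
  end.

Definition anti_map (u : pres relX) : pres relY := anti_eval (repr u).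

Hypothesis anti_rel : forall s t, relX s t -> anti_eval s = anti_eval t.

Lemma anti_cong s t : cong relX s t -> anti_eval s = anti_eval t.
Proof.
elim=> {s t} //=; try by move=> *; congruence.
- by move=> s t u; rewrite addrA.
- by move=> s t; rewrite addrC.
- by move=> t; rewrite add0r.
- by move=> t; rewrite rmorphN1 scaleN1r addNr.
- by move=> s t u; rewrite mulrA.
- by move=> t; rewrite mulr1.
- by move=> t; rewrite mul1r.
- by move=> s t u; rewrite mulrDr.
- by move=> s t u; rewrite mulrDl.
- by move=> a b t; rewrite scalerA rmorphM.
- by move=> t; rewrite rmorph1 scale1r.
- by move=> a s t; rewrite scalerDr.
- by move=> a b t; rewrite rmorphD scalerDl.
- by move=> a s t; rewrite pres_scalerAr.
- by move=> a s t; rewrite pres_scalerAl.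
Qed.

Lemma anti_mapE t : anti_map (pclass relX t) = anti_eval t.
Proof. by apply: anti_cong; apply: cong_repr. Qed.

Lemma anti_map_gen x : anti_map (pgen relX x) = f x.
Proof. by rewrite /pgen anti_mapE. Qed.

Lemma anti_map_lin a u v : anti_map (a *: u + v) = sg a *: anti_map u + anti_map v.
Proof.
elim/pclass_ind: u => s; elim/pclass_ind: v => t.
by rewrite -pclassZE -pclassDE !anti_mapE.
Qed.

Lemma anti_mapM u v : anti_map (u * v) = anti_map v * anti_map u.
Proof.
elim/pclass_ind: u => s; elim/pclass_ind: v => t.
by rewrite -pclassME !anti_mapE.
Qed.

Lemma anti_map1 : anti_map 1 = 1.
Proof. by rewrite -(pclass1E relX) anti_mapE. Qed.

Lemma anti_map0 : anti_map 0 = 0.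
Proof. by rewrite -(pclass0E relX) anti_mapE. Qed.

End AntiMorphism.

Section AntiInvolution.
Variables (k : comNzRingType) (X : Type) (rel : term k X -> term k X -> Prop).
Variable sg : {rmorphism k -> k}.
Hypothesis sgK : involutive sg.
Variable F : pres rel -> pres rel.
Hypothesis F_lin : forall a u v, F (a *: u + v) = sg a *: F u + F v.
Hypothesis F_mul : forall u v, F (u * v) = F v * F u.
Hypothesis F_1 : F 1 = 1.
Hypothesis FK_gen : forall x, F (F (pgen rel x)) = pgen rel x.

Lemma anti_involutive : involutive F.
Proof.
have F0 : F 0 = 0.
  have := F_lin 1 0 0; rewrite rmorph1 !scale1r !addr0 => /eqP.
  by rewrite -subr_eq0 opprD addrA subrr sub0r oppr_eq0 => /eqP.
have FD u v : F (u + v) = F u + F v.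
  by have := F_lin 1 u v; rewrite rmorph1 !scale1r.
have FZ a u : F (a *: u) = sg a *: F u.
  by have := F_lin a u 0; rewrite F0 !addr0.
elim/pclass_ind; elim=> [x|||s hs t ht|s hs t ht|a t ht].
- exact: FK_gen.
- by rewrite pclass0E !F0.
- by rewrite pclass1E !F_1.
- by rewrite pclassDE !FD hs ht.
- by rewrite pclassME !F_mul hs ht.
- by rewrite pclassZE !FZ sgK ht.
Qed.

End AntiInvolution.

Section TensorTheory.
Variables (k : comNzRingType) (X Y : Type).
Variables (relX : term k X -> term k X -> Prop).
Variables (relY : term k Y -> term k Y -> Prop).
Implicit Types (a : pres relX) (b : pres relY).

Lemma tensor_linl x a a' b : (x *: a + a') ⊗ b = x *: (a ⊗ b) + a' ⊗ b.
Proof. by have := prelP (tens_linl x a a' b); rewrite !pclassE. Qed.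

Lemma tensor_linr x a b b' : a ⊗ (x *: b + b') = x *: (a ⊗ b) + a ⊗ b'.
Proof. by have := prelP (tens_linr x a b b'); rewrite !pclassE. Qed.

Lemma tensorM a a' b b' : (a ⊗ b) * (a' ⊗ b') = (a * a') ⊗ (b * b').
Proof. by have := prelP (tens_mul a a' b b'); rewrite !pclassE. Qed.

Lemma tensor1 : (1 : pres relX) ⊗ (1 : pres relY) = 1.
Proof. by have := prelP (tens_one relX relY); rewrite !pclassE. Qed.

End TensorTheory.

Section CherednikTheory.
Variables (R : realType) (n : nat) (E : vectType R) (gT : finGroupType).
Variables (K : comAlgType R[i]) (D : setting n E gT K).
Local Notation C := R[i].
Local Notation S := (reflections (rho D)).
Local Notation B := (form D).
Implicit Types (u v w : E) (x y : dual E).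

Lemma iK_lin a k l : iK D (a *: k + l) = a *: iK D k + iK D l.
Proof. by have := prelP (ch_K_lin D a k l); rewrite !pclassE. Qed.
Lemma iKM k l : iK D (k * l) = iK D k * iK D l.
Proof. by have := prelP (ch_K_mul D k l); rewrite !pclassE. Qed.
Lemma iK1 : iK D 1 = 1.
Proof. by have := prelP (ch_K_one D); rewrite !pclassE. Qed.
Lemma iK_central k (u : Hc D) : iK D k * u = u * iK D k.
Proof.
elim/pclass_ind: u; elim=> [h|||s hs t ht|s hs t ht|a t ht].
- by have := prelP (ch_K_central D k h); rewrite !pclassE.
- by rewrite pclass0E mulr0 mul0r.
- by rewrite pclass1E mulr1 mul1r.
- by rewrite pclassDE mulrDr mulrDl hs ht.
- by rewrite pclassME mulrA hs -mulrA ht mulrA.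
- by rewrite pclassZE -pres_scalerAr ht pres_scalerAl.
Qed.
Lemma iE_lin a v w : iE D (a *: v + w) = a%:C%C *: iE D v + iE D w.
Proof. by have := prelP (ch_E_lin D a v w); rewrite !pclassE. Qed.
Lemma iX_lin a x y : iX D (a *: x + y) = a%:C%C *: iX D x + iX D y.
Proof. by have := prelP (ch_X_lin D a x y); rewrite !pclassE. Qed.
Lemma iG1 : iG D 1%g = 1.
Proof. by have := prelP (ch_G_one D); rewrite !pclassE. Qed.
Lemma iGM g h : iG D (g * h)%g = iG D g * iG D h.
Proof. by have := prelP (ch_G_mul D g h); rewrite !pclassE. Qed.
Lemma iGE g v : iG D g * iE D v = iE D (rho D g v) * iG D g.
Proof. by have := prelP (ch_GE D g v); rewrite !pclassE. Qed.
Lemma iGX g x : iG D g * iX D x = iX D (dual_act (rho D) g x) * iG D g.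
Proof. by have := prelP (ch_GX D g x); rewrite !pclassE. Qed.
Lemma iEE v w : comm (iE D v) (iE D w) = 0.
Proof. by have := prelP (ch_EE D v w); rewrite !pclassE scaleN1r. Qed.
Lemma iXX x y : comm (iX D x) (iX D y) = 0.
Proof. by have := prelP (ch_XX D x y); rewrite !pclassE scaleN1r. Qed.
Lemma iEX v x : comm (iE D v) (iX D x) = (pair x v)%:C%C *: (1 : Hc D) -
  \sum_(s in S) cherednik_coef D x v s *: (iK D (c D s) * iG D s).
Proof.
have := prelP (ch_EX D v x); rewrite !pclassE !scaleN1r => h; apply: (etrans h) => {h}.
congr (_ - _).
rewrite (big_morph (pclass (cherednik_rel D)) (@pclassDE _ _ _)
  (pclass0E (cherednik_rel D))).
by apply: eq_bigr => s _; rewrite !pclassE.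
Qed.

Lemma formZDr a u v w : B w (a *: u + v) = a * B w u + B w v.
Proof. by rewrite form_sym form_lin !(form_sym _ w). Qed.
Lemma formDl u v w : B (u + v) w = B u w + B v w.
Proof. by rewrite -[u]scale1r form_lin mul1r scale1r. Qed.
Lemma form0l w : B 0 w = 0.
Proof. by have := form_lin D (-1) 0 0 w; rewrite scaler0 addr0 mulN1r addNr. Qed.
Lemma formZl a u w : B (a *: u) w = a * B u w.
Proof. by rewrite -[a *: u]addr0 form_lin form0l addr0. Qed.
Lemma formNl u w : B (- u) w = - B u w.
Proof. by rewrite -scaleN1r formZl mulN1r. Qed.
Lemma formNr u w : B u (- w) = - B u w.
Proof. by rewrite form_sym formNl form_sym. Qed.
Lemma form_suml (I : finType) (F : I -> E) w :
  B (\sum_i F i) w = \sum_i B (F i) w.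
Proof. by apply: (big_morph (B^~ w)) => [u v|]; rewrite ?formDl ?form0l. Qed.

Lemma form_nondeg u : (forall j, B u (xi D j) = 0) ->
  (forall j, B u (eta D j) = 0) -> u = 0.
Proof.
move=> hx hy; apply/eqP; apply/negPn/negP => u0; have := form_pos D u0.
rewrite {2}(coord_basis (xi_eta_basis D) (memvf u)) form_sym form_suml.
rewrite big1 ?ltxx// => i _; rewrite formZl form_sym.
have : (codom (xi D) ++ codom (eta D))`_i \in codom (xi D) ++ codom (eta D).
  by apply: mem_nth; rewrite size_cat !size_codom ltn_ord.
by rewrite mem_cat => /orP[] /codomP[j ->]; rewrite ?hx ?hy mulr0.
Qed.

Lemma basis_expand u :
  u = \sum_j (B u (xi D j) *: xi D j + B u (eta D j) *: eta D j).
Proof.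
apply/eqP; rewrite -subr_eq0; apply/eqP; apply: form_nondeg => j.
  rewrite formDl formNl form_suml (bigD1 j)//= big1 => [|i ij].
    rewrite addr0 formDl !formZl form_xi eqxx mulr1 form_sym [X in _ * X]form_sym.
    by rewrite form_xi_eta mulr0 addr0 form_sym subrr.
  by rewrite formDl !formZl form_xi (negPf ij) [B (eta D i) _]form_sym form_xi_eta
    !mulr0 addr0.
rewrite formDl formNl form_suml (bigD1 j)//= big1 => [|i ij].
  rewrite addr0 formDl !formZl form_eta eqxx mulr1.
  by rewrite form_xi_eta mulr0 add0r subrr.
by rewrite formDl !formZl form_eta (negPf ij) form_xi_eta !mulr0 addr0.
Qed.

Definition flat v : dual E :=
  \sum_j (B v (xi D j) *: xx D j + B v (eta D j) *: yy D j).
Definition sharp x : E :=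
  \sum_j (pair x (xi D j) *: xi D j + pair x (eta D j) *: eta D j).

Lemma pairE x v :
  pair x v = \sum_j (B v (xi D j) * pair x (xi D j) + B v (eta D j) * pair x (eta D j)).
Proof.
rewrite {1}(basis_expand v) /pair linear_sum; apply: eq_bigr => j _.
by rewrite linearD !linearZ.
Qed.

Lemma dual_eq x y : (forall j, pair x (xi D j) = pair y (xi D j)) ->
  (forall j, pair x (eta D j) = pair y (eta D j)) -> x = y.
Proof.
move=> h1 h2; apply/lfunP => v.
rewrite -[x v]/(pair x v) -[y v]/(pair y v) !pairE.
by apply: eq_bigr => j _; rewrite h1 h2.
Qed.

Lemma pair_suml (I : finType) (F : I -> dual E) v :
  pair (\sum_i F i) v = \sum_i pair (F i) v.
Proof. by rewrite /pair sum_lfunE. Qed.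

Lemma pair_flat v w : pair (flat v) w = B v w.
Proof.
rewrite pairE [RHS]form_sym [in RHS](basis_expand w) form_suml.
apply: eq_bigr => j _; rewrite formDl !formZl ![B _ v]form_sym.
congr (_ * _ + _ * _); rewrite pair_suml (bigD1 j)//= big1 => [|i ij].
- by rewrite addr0 /pair add_lfunE !scale_lfunE -!/(pair _ _) xx_xi yy_xi eqxx
    [_ *: 1]mulr1 scaler0 addr0.
- by rewrite /pair add_lfunE !scale_lfunE -!/(pair _ _) xx_xi yy_xi (negPf ij)
    !scaler0 addr0.
- by rewrite addr0 /pair add_lfunE !scale_lfunE -!/(pair _ _) xx_eta yy_eta eqxx
    [_ *: 1]mulr1 scaler0 add0r.
- by rewrite /pair add_lfunE !scale_lfunE -!/(pair _ _) xx_eta yy_eta (negPf ij)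
    !scaler0 addr0.
Qed.

Lemma form_sharp x v : B (sharp x) v = pair x v.
Proof.
rewrite pairE form_suml; apply: eq_bigr => j _.
by rewrite formDl !formZl ![B v _]form_sym mulrC [_ * B (eta D j) _]mulrC.
Qed.

Lemma formP u v : (forall w, B u w = B v w) -> u = v.
Proof.
move=> h; apply/eqP; rewrite -subr_eq0; apply/eqP; apply: form_nondeg => j;
by rewrite formDl formNl h subrr.
Qed.

Lemma dualP x y : pair x =1 pair y -> x = y.
Proof. by move=> h; apply/lfunP. Qed.

Lemma sharp_flat v : sharp (flat v) = v.
Proof. by apply: formP => w; rewrite form_sharp pair_flat. Qed.
Lemma flat_sharp x : flat (sharp x) = x.
Proof. by apply: dualP => w; rewrite pair_flat form_sharp. Qed.

Lemma pair_lin a x y v : pair (a *: x + y) v = a * pair x v + pair y v.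
Proof. by rewrite /pair add_lfunE scale_lfunE. Qed.
Lemma pairZl a x v : pair (a *: x) v = a * pair x v.
Proof. by rewrite /pair scale_lfunE. Qed.
Lemma pair_linr a x v w : pair x (a *: v + w) = a * pair x v + pair x w.
Proof. by rewrite /pair linearP. Qed.
Lemma flat_lin a v w : flat (a *: v + w) = a *: flat v + flat w.
Proof. by apply: dualP => u; rewrite pair_lin !pair_flat form_lin. Qed.
Lemma sharp_lin a x y : sharp (a *: x + y) = a *: sharp x + sharp y.
Proof. by apply: formP => w; rewrite form_lin !form_sharp pair_lin. Qed.

Lemma rhoK g v : rho D g^-1%g (rho D g v) = v.
Proof. by rewrite -comp_lfunE -rhoM mulVg rho1 id_lfunE. Qed.
Lemma rhoVK g v : rho D g (rho D g^-1%g v) = v.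
Proof. by rewrite -{1}[g]invgK rhoK. Qed.

Lemma pair_dual_act g x v : pair (dual_act (rho D) g x) v = pair x (rho D g^-1%g v).
Proof. by rewrite /pair /dual_act comp_lfunE. Qed.
Lemma flat_rho g v : flat (rho D g v) = dual_act (rho D) g (flat v).
Proof.
apply: dualP => w; rewrite pair_dual_act !pair_flat.
by rewrite -{1}[w](rhoVK g) rho_orth.
Qed.
Lemma sharp_act g x : sharp (dual_act (rho D) g x) = rho D g (sharp x).
Proof.
apply: formP => w; rewrite form_sharp pair_dual_act -form_sharp.
by rewrite -(rho_orth D g) rhoVK.
Qed.

Section Reflection.
Variable s : gT.
Hypothesis sS : s \in S.
Local Notation al := (alpha D s).

Lemma alpha_neq0 : al != 0. Proof. by case: (alpha_eigen sS). Qed.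
Lemma rho_alpha : rho D s al = - al. Proof. by case: (alpha_eigen sS). Qed.
Lemma form_alpha_neq0 : B al al != 0.
Proof. by rewrite gt_eqF// form_pos// alpha_neq0. Qed.

Lemma fixed_alpha v : v \in fixedSpace (rho D s) -> B al v = 0.
Proof.
move=> /fixedSpaceP hv.
have := rho_orth D s al v; rewrite rho_alpha hv formNl => /eqP.
by rewrite eq_sym -addr_eq0 -mulr2n mulrn_eq0/= => /eqP.
Qed.

Lemma reflection_split v : v - (B al v / B al al) *: al \in fixedSpace (rho D s).
Proof.
set F := fixedSpace _.
have aF : al \notin F.
  by apply/negP => /fixed_alpha/eqP; rewrite (negPf form_alpha_neq0).
have dF : (\dim F).+1 = \dim {:E} by move: sS; rewrite inE => /eqP.
have FD : (F + <[al]>)%VS = fullv.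
  apply/eqP; rewrite eqEdim subvf/= dimv_disjoint_sum.
    by rewrite dim_vline alpha_neq0 addn1 dF.
  apply/eqP; rewrite -subv0; apply/subvP => u; rewrite memv_cap => /andP[uF].
  move/vlineP => [a ua]; move: uF; rewrite ua memv0.
  have [->|a0] := eqVneq a 0; first by rewrite scale0r.
  by move=> h; case/negP: aF; rewrite -[al](scalerK a0) memvZ.
have : v \in (F + <[al]>)%VS by rewrite FD memvf.
move/memv_addP => [u uF [_ /vlineP[a ->] ->]].
have -> : B al (u + a *: al) = a * B al al.
  by rewrite addrC formZDr (fixed_alpha uF) addr0.
by rewrite mulfK ?form_alpha_neq0// addrK.
Qed.

Lemma rho_reflection v : rho D s v = v - (2 * B al v / B al al) *: al.
Proof.
have := reflection_split v; set t := _ / _ => /fixedSpaceP.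
rewrite linearB linearZ/= rho_alpha scalerN opprK => h.
have -> : rho D s v = v - t *: al - t *: al by rewrite -h addrK.
rewrite -addrA -opprD -scalerDl; congr (_ - _ *: _).
by rewrite /t -mulrA mulr_natl mulr2n.
Qed.

Lemma rho_reflectionK v : rho D s (rho D s v) = v.
Proof.
rewrite (rho_reflection v) linearB linearZ/= rho_alpha scalerN opprK.
by rewrite rho_reflection subrK.
Qed.

Lemma reflectionV : (s^-1)%g = s.
Proof.
apply: (@rho_inj _ _ _ _ _ D); apply/lfunP => v.
by rewrite -[in LHS](rho_reflectionK v) rhoK.
Qed.

(* alpha_s^vee = 2 B(alpha_s, .) / B(alpha_s, alpha_s)                        *)
Lemma pair_alphav v : pair (alphav D s) v = 2 * B al v / B al al.
Proof.
have [ca0 hca] := coalpha_eigen sS.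
have hfix u : u \in fixedSpace (rho D s) -> pair (coalpha D s) u = 0.
  move=> /fixedSpaceP hu; have := pair_dual_act s (coalpha D s) u.
  rewrite hca reflectionV hu /pair opp_lfunE => /eqP.
  by rewrite eq_sym -addr_eq0 -mulr2n mulrn_eq0/= => /eqP.
have hv u : pair (coalpha D s) u = B al u / B al al * pair (coalpha D s) al.
  rewrite -{1}[u](subrK ((B al u / B al al) *: al)) addrC pair_linr.
  by rewrite (hfix _ (reflection_split u)) addr0.
have ca1 : pair (coalpha D s) al != 0.
  apply: contra ca0 => /eqP h; apply/eqP/dualP => u.
  by rewrite hv h mulr0 /pair zero_lfunE.
rewrite /alphav; set p := pair _ al.
rewrite pairZl hv -/p [_ / _ * p]mulrC mulrA.
by rewrite divfK// mulrA.
Qed.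

End Reflection.

Section StarExists.
Variable sigma : K -> K.
Hypothesis sigma_lin : forall a k l, sigma (a *: k + l) = a^* *: sigma k + sigma l.
Hypothesis sigmaM : forall k l, sigma (k * l) = sigma k * sigma l.
Hypothesis sigma1 : sigma 1 = 1.
Hypothesis sigmaK : involutive sigma.
Hypothesis sigma_c : forall s, s \in S -> sigma (c D s) = c D s.

Let cj : {rmorphism C -> C} := Num.conj.

Let cj_real (a : R) : cj a%:C%C = a%:C%C.
Proof. by rewrite /cj /=; apply/CrealP/complex_realP; exists a. Qed.

Let fH (h : hgen E gT K) : Hc D :=
  match h with
  | HK k => iK D (sigma k)
  | HE v => iX D (flat v)
  | HX x => iE D (sharp x)
  | HG g => iG D g^-1%g
  end.

Let fH_rel s t : cherednik_rel D s t -> anti_eval cj fH s = anti_eval cj fH t.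
Proof.
have subP (u v : Hc D) : comm u v = 0 -> u * v = v * u.
  by rewrite /comm => /eqP; rewrite subr_eq0 => /eqP.
case=> {s t} /=.
- by move=> a k l; rewrite sigma_lin iK_lin.
- by move=> k l; rewrite sigmaM mulrC iKM.
- by rewrite sigma1 iK1.
- by move=> k h; rewrite iK_central.
- by move=> a v w; rewrite cj_real flat_lin iX_lin.
- by move=> a x y; rewrite cj_real sharp_lin iE_lin.
- by rewrite invg1 iG1.
- by move=> g h; rewrite invMg iGM.
- by move=> g v; rewrite iGX -flat_rho rhoK.
- by move=> g x; rewrite iGE -sharp_act /dual_act invgK -comp_lfunA -rhoM mulVg
    rho1 comp_lfun1r.
- by move=> v w; rewrite rmorphN1 scaleN1r; apply: iXX.
- by move=> x y; rewrite rmorphN1 scaleN1r; apply: iEE.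
- move=> v x; rewrite rmorphN1 !scaleN1r.
  have -> : iE D (sharp x) * iX D (flat v) - iX D (flat v) * iE D (sharp x) =
            comm (iE D (sharp x)) (iX D (flat v)) by [].
  rewrite iEX cj_real pair_flat form_sym form_sharp; congr (_ - _).
  rewrite (big_morph (anti_eval cj fH) (id1 := 0) (op1 := +%R)) //.
  apply: eq_bigr => s sS /=.
  rewrite /cherednik_coef cj_real !pair_alphav// pair_flat sigma_c// reflectionV//.
  rewrite iK_central [B _ (sharp x)]form_sym form_sharp [B v _]form_sym.
  by congr (_%:C%C *: _); ring.
Qed.

Definition star_H : Hc D -> Hc D := anti_map (relX := cherednik_rel D) cj fH.

Let star_H1 : star_H 1 = 1. Proof. by rewrite /star_H anti_map1. Qed.

Let star_HK : involutive star_H.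
Proof.
apply: (@anti_involutive _ _ _ cj); first exact: conjCK.
- by move=> a u v; apply: anti_map_lin; apply: fH_rel.
- by move=> u v; apply: anti_mapM; apply: fH_rel.
- exact: star_H1.
case=> h; rewrite /star_H (anti_map_gen fH_rel) /= (anti_map_gen fH_rel) /=.
- by rewrite sigmaK.
- by rewrite sharp_flat.
- by rewrite flat_sharp.
- by rewrite invgK.
Qed.

Let fC (j : 'I_(n + n)) : Cl R n := clE R j.

Let fC_rel s t : cliff_rel s t -> anti_eval cj fC s = anti_eval cj fC t.
Proof.
case=> j k /=.
have := prelP (@cliff_anti R n k j); rewrite !pclassE -!/(pgen _ _) eq_sym => ->.
by rewrite rmorphM rmorph_nat rmorph_nat.
Qed.

Definition star_C : Cl R n -> Cl R n := anti_map (relX := @cliff_rel R n) cj fC.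

Let star_C1 : star_C 1 = 1. Proof. by rewrite /star_C anti_map1. Qed.

Let star_CK : involutive star_C.
Proof.
apply: (@anti_involutive _ _ _ cj); first exact: conjCK.
- by move=> a u v; apply: anti_map_lin; apply: fC_rel.
- by move=> u v; apply: anti_mapM; apply: fC_rel.
- exact: star_C1.
by move=> j; rewrite /star_C !(anti_map_gen fC_rel).
Qed.

Let fT (ab : Hc D * Cl R n) : HC D := star_H ab.1 ⊗ star_C ab.2.

Let fT_rel s t : tens_rel s t -> anti_eval cj fT s = anti_eval cj fT t.
Proof.
case=> {s t} /=.
- move=> a u v b; rewrite /fT /= /star_H (anti_map_lin fH_rel).
  exact: tensor_linl.
- move=> a u b b'; rewrite /fT /= /star_C (anti_map_lin fC_rel).
  exact: tensor_linr.
- move=> a a' b b'; rewrite /fT /= tensorM /star_H /star_C.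
  by rewrite (anti_mapM fH_rel) (anti_mapM fC_rel).
- by rewrite /fT /= star_H1 star_C1 tensor1.
Qed.

Definition star_T : HC D -> HC D :=
  anti_map (relX := tens_rel (relX := cherednik_rel D) (relY := @cliff_rel R n)) cj fT.

Lemma star_exists : is_star star_H star_C star_T.
Proof.
have tT a b : star_T (a ⊗ b) = star_H a ⊗ star_C b.
  by rewrite /star_T (anti_map_gen fT_rel).
have cjV2 : cj 2^-1 = 2^-1 by rewrite fmorphV rmorph_nat.
have stf eps j : cj eps = - eps ->
    star_C (2^-1 *: (clE R (lshift n j) + eps *: clE R (rshift n j)))
    = 2^-1 *: (clE R (lshift n j) - eps *: clE R (rshift n j)).
  move=> he; set a := clE _ _; set b := clE _ _.
  have ha : star_C a = a by rewrite /star_C (anti_map_gen fC_rel).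
  have hb : star_C b = b by rewrite /star_C (anti_map_gen fC_rel).
  have -> : 2^-1 *: (a + eps *: b) = (2^-1 * eps) *: b + (2^-1 *: a + 0).
    by rewrite addr0 scalerDr scalerA addrC.
  have l c0 (p q : Cl R n) : star_C (c0 *: p + q) = cj c0 *: star_C p + star_C q.
    exact: (anti_map_lin fC_rel).
  have s0 : star_C 0 = 0 by exact: (anti_map0 fC_rel).
  rewrite !l s0 addr0 ha hb cjV2 rmorphM cjV2 he.
  by rewrite mulrN scaleNr -scalerA addrC -scalerBr.
split.
- by move=> a u v; apply: (anti_map_lin fT_rel).
- by move=> u v; apply: (anti_mapM fT_rel).
- apply: (@anti_involutive _ _ _ cj); first exact: conjCK.
  + by move=> a u v; apply: anti_map_lin; apply: fT_rel.
  + by move=> u v; apply: anti_mapM; apply: fT_rel.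
  + by rewrite /star_T anti_map1.
  by case=> a b; rewrite -[pgen _ _]/(a ⊗ b) !tT star_HK star_CK.
- exact: tT.
- move=> j; rewrite /star_H (anti_map_gen fH_rel) /fH; congr iX.
  apply: dual_eq => k; rewrite pair_flat.
    by rewrite form_xi xx_xi.
  by rewrite form_xi_eta xx_eta.
- move=> j; rewrite /star_H (anti_map_gen fH_rel) /fH; congr iE.
  rewrite -[RHS]sharp_flat; congr sharp; apply: dual_eq => k; rewrite pair_flat.
    by rewrite form_xi xx_xi.
  by rewrite form_xi_eta xx_eta.
- move=> j; rewrite /star_H (anti_map_gen fH_rel) /fH; congr iX.
  apply: dual_eq => k; rewrite pair_flat.
    by rewrite form_sym form_xi_eta yy_xi.
  by rewrite form_eta yy_eta.
- move=> j; rewrite /star_H (anti_map_gen fH_rel) /fH; congr iE.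
  rewrite -[RHS]sharp_flat; congr sharp; apply: dual_eq => k; rewrite pair_flat.
    by rewrite form_sym form_xi_eta yy_xi.
  by rewrite form_eta yy_eta.
- by move=> s sS; rewrite /star_H (anti_map_gen fH_rel) /fH reflectionV.
- by move=> s sS; rewrite /star_H (anti_map_gen fH_rel) /fH sigma_c.
- by move=> j; rewrite /clF -scaleNr stf ?rmorphN/= ?conjCi// scaleNr opprK.
- by move=> j; rewrite /clFd stf //= conjCi.
Qed.

End StarExists.
End CherednikTheory.

(* Main.v *)
Require Import Defs.
From HB Require Import structures.
From mathcomp Require Import all_boot all_order all_fingroup all_algebra.
From mathcomp Require Import boolp reals.
From mathcomp.real_closed Require Import complex.
From mathcomp Require Import ring.
Import Order.TTheory GRing.Theory Num.Theory.
Local Open Scope ring_scope.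

(** The realisation is governed by its four odd elements.  A Lie superalgebra
    map from gl(2|1) amounts to a family [W i j] of images of the matrix units,
    and by the Jacobi identity all its superbrackets follow from those that
    involve an odd unit ([W_bracket]).  In turn these follow from a short list,
    [odd_relations]: the anticommutators of [Fp], [Fm], [Fbp], [Fbm], and the
    weights of these elements for [H] and [Z2].  For instance
    [acomm Fp Fbm = H - Z] commutes with [Fp] because [Fp] squares to 0, so
    that [Z] and [H] have the same bracket with [Fp].  The matrix units are
    the elements of the theorem up to linear combinations and scalars
    ([unit21]).

    The list is verified in [odd_relations_cherednik].  The anticommutator of
    two sums of tensors [a j ⊗ b j] splits into a part with the Clifford
    anticommutators and a part with the commutators of the Cherednik algebra
    ([acomm_sum_reflections]).  In the latter the coefficient of a reflection
    [s] factorises over the two indices, and the Clifford sums become products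
    of the elements [alphad s] and [alphad_v s].  These square to 0 and have
    anticommutator 2, which produces [tau s], hence [Omega_c], in [Z].  The
    weights for [H] hold because [hH] is the Euler element corrected by the
    reflections ([comm_hH_iX], [comm_hH_iE]).

    The kernel of the realisation is an ideal of gl(2|1), which is the sum of
    its centre and of a simple algebra; so injectivity reduces to [Fp != 0] and
    [Z1 - Z2 != 0] ([mx_eval_inj]).  Both are read off a representation:
    the Cherednik algebra acts on polynomials by Dunkl operators, the Clifford
    algebra on spinors indexed by the subsets of the set of coordinates.  On a
    polynomial times the vacuum, [Z1 - Z2] acts through the element [vacuum_Z],
    whose commutator with [zbar j0] takes the value 1 at a suitable point
    ([ev_comm_vacuum_Z]), whatever the parameters are.

    The star exchanges the odd generators, and the other star relations follow
    by applying it to their anticommutators. *)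

Set Implicit Arguments.
Unset Strict Implicit.
Unset Printing Implicit Defensive.

(** * Brackets in an associative algebra *)

Section Brackets.
Variable A : pzRingType.
Implicit Types a b c : A.

Lemma comm_antisym a b : comm a b = - comm b a.
Proof. by rewrite /comm opprB. Qed.
Lemma acomm_sym a b : acomm a b = acomm b a.
Proof. by rewrite /acomm addrC. Qed.
Lemma commDl a b c : comm (a + b) c = comm a c + comm b c.
Proof. by rewrite /comm mulrDl mulrDr opprD addrACA. Qed.
Lemma commNl a b : comm (- a) b = - comm a b.
Proof. by rewrite /comm mulNr mulrN opprD. Qed.
Lemma commBl a b c : comm (a - b) c = comm a c - comm b c.
Proof. by rewrite commDl commNl. Qed.
Lemma commDr a b c : comm c (a + b) = comm c a + comm c b.
Proof. by rewrite !(comm_antisym c) commDl opprD. Qed.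
Lemma commNr a b : comm b (- a) = - comm b a.
Proof. by rewrite !(comm_antisym b) commNl. Qed.
Lemma commBr a b c : comm c (a - b) = comm c a - comm c b.
Proof. by rewrite commDr commNr. Qed.
Lemma commxx a : comm a a = 0.
Proof. by rewrite /comm subrr. Qed.
Lemma comm0r a : comm a 0 = 0.
Proof. by rewrite /comm mulr0 mul0r subrr. Qed.
Lemma comm0l a : comm 0 a = 0.
Proof. by rewrite comm_antisym comm0r oppr0. Qed.
Lemma comm_suml (I : finType) (P : pred I) (F : I -> A) b :
  comm (\sum_(i | P i) F i) b = \sum_(i | P i) comm (F i) b.
Proof. by rewrite /comm mulr_suml mulr_sumr -sumrB. Qed.
Lemma comm_sumr (I : finType) (P : pred I) (F : I -> A) b :
  comm b (\sum_(i | P i) F i) = \sum_(i | P i) comm b (F i).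
Proof. by rewrite /comm mulr_suml mulr_sumr -sumrB. Qed.

Lemma acommDl a b c : acomm (a + b) c = acomm a c + acomm b c.
Proof. by rewrite /acomm mulrDl mulrDr addrACA. Qed.
Lemma acommNl a b : acomm (- a) b = - acomm a b.
Proof. by rewrite /acomm mulNr mulrN opprD. Qed.
Lemma acommDr a b c : acomm c (a + b) = acomm c a + acomm c b.
Proof. by rewrite !(acomm_sym c) acommDl. Qed.
Lemma acommNr a b : acomm b (- a) = - acomm b a.
Proof. by rewrite !(acomm_sym b) acommNl. Qed.

Lemma comm_mull a b c : comm (a * b) c = a * comm b c + comm a c * b.
Proof. by rewrite /comm mulrBr mulrBl !mulrA addrA subrK. Qed.
Lemma comm_mull_acomm a b c : comm (a * b) c = a * acomm b c - acomm a c * b.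
Proof. by rewrite /comm /acomm mulrDr mulrDl !mulrA opprD addrA addrK. Qed.

Lemma comm_acomm a b c :
  comm a (acomm b c) = acomm (comm a b) c + acomm b (comm a c).
Proof.
have h x y : comm a (x * y) = comm a x * y + x * comm a y.
  by rewrite !(comm_antisym a) comm_mull mulrN mulNr opprD addrC.
by rewrite {1}/acomm commDr !h /acomm [LHS](AC (2*2) ((1*4)*(2*3))).
Qed.

(** The Jacobi identity for three odd elements, solved for one of its terms:
    the bracket of [acomm a b] with [c] is governed by the anticommutators of [c]. *)
Lemma acomm_jacobi a b c :
  comm (acomm a b) c = - comm (acomm b c) a - comm (acomm c a) b.
Proof.
have -> : comm (acomm a b) c =
    a * acomm b c + b * acomm a c - (acomm a c * b + acomm b c * a).
  by rewrite {1}/acomm commDl !comm_mull_acomm opprD addrACA.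
rewrite (acomm_sym c a) /comm !opprB opprD.
by rewrite [LHS](AC (2*2) ((1*4)*(2*3))).
Qed.

Lemma sbracket_comm p q a b : p && q = false -> sbracket p q a b = comm a b.
Proof. by rewrite /sbracket => ->; rewrite expr0 mul1r. Qed.
Lemma sbracket_acomm a b : sbracket true true a b = acomm a b.
Proof. by rewrite /sbracket /= expr1 mulN1r opprK. Qed.

End Brackets.

Section PresBrackets.
Variables (k : comNzRingType) (X : Type) (rel : term k X -> term k X -> Prop).
Implicit Types u v w : pres rel.

Lemma commZl x u v : comm (x *: u) v = x *: comm u v.
Proof. by rewrite /comm -pres_scalerAl -pres_scalerAr scalerBr. Qed.
Lemma commZr x u v : comm u (x *: v) = x *: comm u v.
Proof. by rewrite comm_antisym commZl -scalerN -comm_antisym. Qed.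
Lemma acommZl x u v : acomm (x *: u) v = x *: acomm u v.
Proof. by rewrite /acomm -pres_scalerAl -pres_scalerAr scalerDr. Qed.
Lemma acommZr x u v : acomm u (x *: v) = x *: acomm u v.
Proof. by rewrite acomm_sym acommZl acomm_sym. Qed.
Lemma signZ (b : bool) u : (-1) ^+ b * u = (-1) ^+ b *: u.
Proof. by case: b; [rewrite mulN1r scaleN1r | rewrite mul1r scale1r]. Qed.
End PresBrackets.

(** * The Lie superalgebra gl(2|1) *)

Section GL21Matrices.
Variable R : realType.
Local Notation C := R[i].
Local Notation gl21 := 'M[C]_3.
Local Notation par := gl21_par.

Lemma homogM p q (X Y : gl21) :
  gl21_homog p X -> gl21_homog q Y -> gl21_homog (p (+) q) (X * Y).
Proof.
move=> hX hY i j hij; rewrite mxE big1 // => k _.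
have [hik|hik] := boolP (par i (+) par k != p); first by rewrite hX // mul0r.
rewrite hY ?mulr0 //; apply: contraNneq hij => hq.
move: hik hq; rewrite negbK => /eqP <- <-.
by case: (par i); case: (par j); case: (par k).
Qed.

Lemma homog_lin p a (X Y : gl21) :
  gl21_homog p X -> gl21_homog p Y -> gl21_homog p (a *: X + Y).
Proof. by move=> hX hY i j hij; rewrite !mxE hX // hY // mulr0 addr0. Qed.

Lemma homog0 p : gl21_homog p (0 : gl21).
Proof. by move=> i j _; rewrite mxE. Qed.

Lemma homog1 : gl21_homog false (1 : gl21).
Proof. by move=> i j; rewrite mxE; case: (i =P j) => [->|//]; rewrite addbb. Qed.

Lemma homog_delta p i j :
  par i (+) par j = p -> gl21_homog p (delta_mx i j : gl21).
Proof.
move=> <- a b; rewrite mxE; case: (a =P i) => [->|//]; case: (b =P j) => [->|//].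
by rewrite eqxx.
Qed.

Lemma sbracket_mxE p q (X Y : gl21) :
  sbracket p q X Y = (- (-1) ^+ (p && q)) *: (Y * X) + X * Y.
Proof.
rewrite /sbracket addrC; case: (p && q).
  by rewrite expr1 mulN1r !opprK scale1r.
by rewrite mul1r scaleN1r.
Qed.

Lemma homog_sbracket p q (X Y : gl21) : gl21_homog p X -> gl21_homog q Y ->
  gl21_homog (p (+) q) (sbracket p q X Y).
Proof.
move=> hX hY; rewrite sbracket_mxE.
by apply: homog_lin; [rewrite addbC|]; apply: homogM.
Qed.

Lemma str_lin a (X Y : gl21) : gl21_str (a *: X + Y) = a * gl21_str X + gl21_str Y.
Proof.
rewrite /gl21_str mulr_sumr -big_split /=; apply: eq_bigr => i _.
by rewrite !mxE mulrDr mulrCA.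
Qed.

Lemma str0 : gl21_str (0 : gl21) = 0.
Proof. by rewrite /gl21_str big1 // => i _; rewrite mxE mulr0. Qed.

Lemma str1 : gl21_str (1 : gl21) = 1.
Proof. by rewrite /gl21_str !big_ord_recl big_ord0 !mxE /= /gl21_par /=; ring. Qed.

(** Only the products [X i k * Y k i] whose two factors have the right
    parities survive, and on them the sign [(-1) ^+ par i] differs from
    [(-1) ^+ par k] exactly by the sign of the superbracket. *)
Lemma str_sbracket p q (X Y : gl21) : gl21_homog p X -> gl21_homog q Y ->
  gl21_str (sbracket p q X Y) = 0.
Proof.
move=> hX hY; rewrite sbracket_mxE.
rewrite str_lin /gl21_str.
under [X in _ * X]eq_bigr => i _ do rewrite mxE mulr_sumr.
under [X in _ + X]eq_bigr => i _ do rewrite mxE mulr_sumr.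
rewrite exchange_big /= mulr_sumr -big_split /= big1 // => i _.
rewrite mulr_sumr -big_split /= big1 // => k _.
have [hik|hik] := boolP (par i (+) par k != p).
  by rewrite (hX i k) //; ring.
have [hki|hki] := boolP (par k (+) par i != q).
  by rewrite (hY k i) //; ring.
move: hik hki; rewrite !negbK => /eqP <- /eqP <-.
by case: (par i); case: (par k) => /=; ring.
Qed.

Lemma str_odd (X : gl21) : gl21_homog true X -> gl21_str X = 0.
Proof. by move=> hX; rewrite /gl21_str big1 // => i _; rewrite hX ?mulr0 ?addbb. Qed.

End GL21Matrices.

Section Realisation.
Variables (R : realType) (X : Type).
Local Notation C := R[i].
Local Notation gl21 := 'M[C]_3.
Local Notation par := gl21_par.
Variable rel : term C X -> term C X -> Prop.
Variable W : 'I_3 -> 'I_3 -> pres rel.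
Local Notation o := (ord_max : 'I_3).

Hypothesis W_AA : forall i k, ~~ par i -> ~~ par k -> acomm (W i o) (W k o) = 0.
Hypothesis W_BB : forall i k, ~~ par i -> ~~ par k -> acomm (W o i) (W o k) = 0.
Hypothesis W_AB : forall i j, ~~ par i -> ~~ par j ->
  acomm (W i o) (W o j) = W i j + (i == j)%:R *: W o o.
Hypothesis W_OA : forall i, ~~ par i -> comm (W o o) (W i o) = - W i o.
Hypothesis W_OB : forall i, ~~ par i -> comm (W o o) (W o i) = W o i.
Hypothesis W_EA : forall i j k, ~~ par i -> ~~ par j -> ~~ par k ->
  comm (W i j) (W k o) = (j == k)%:R *: W i o.
Hypothesis W_EB : forall i j k, ~~ par i -> ~~ par j -> ~~ par k ->
  comm (W i j) (W o k) = - ((i == k)%:R *: W o j).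

Let par_o : par o = true. Proof. by []. Qed.
Let par_case i : i = o \/ ~~ par i.
Proof.
have [h|h] := boolP (par i); [left | by right].
by apply: val_inj; apply/eqP.
Qed.
Let neq_o i : ~~ par i -> (i == o) = false.
Proof. by move=> hi; apply: contraNF hi => /eqP ->. Qed.
Let o_neq i : ~~ par i -> (o == i) = false.
Proof. by rewrite eq_sym; apply: neq_o. Qed.

Let W_OE i j : ~~ par i -> ~~ par j -> comm (W o o) (W i j) = 0.
Proof.
move=> hi hj; have -> : W i j = acomm (W i o) (W o j) - (i == j)%:R *: W o o.
  by rewrite W_AB // addrK.
rewrite commBr commZr commxx scaler0 subr0 comm_acomm W_OA // W_OB //.
by rewrite acommNl addNr.
Qed.

Let W_EE i j k l : ~~ par i -> ~~ par j -> ~~ par k -> ~~ par l ->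
  comm (W i j) (W k l) = (j == k)%:R *: W i l - (i == l)%:R *: W k j.
Proof.
move=> hi hj hk hl; have -> : W k l = acomm (W k o) (W o l) - (k == l)%:R *: W o o.
  by rewrite W_AB // addrK.
rewrite commBr commZr [comm _ (W o o)]comm_antisym W_OE // oppr0 scaler0 subr0.
rewrite comm_acomm W_EA // W_EB // acommZl acommNr acommZr !W_AB //.
rewrite !scalerDr opprD addrACA !scalerA -!natrM !mulnb -scalerBl.
suff -> : (j == k) && (i == l) = (i == l) && (k == j) by rewrite subrr scale0r addr0.
by rewrite andbC [j == k]eq_sym.
Qed.

(** By the Jacobi identity the brackets of the even units are those of the
    anticommutators of odd ones; the other cases are hypotheses, up to
    antisymmetry. *)
Lemma W_bracket i j k l :
  let p := par i (+) par j in let q := par k (+) par l in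
  sbracket p q (W i j) (W k l) =
  (j == k)%:R *: W i l - (-1) ^+ (p && q) *: ((i == l)%:R *: W k j).
Proof.
rewrite /=; case: (par_case i) => [->|hi]; case: (par_case j) => [->|hj];
  case: (par_case k) => [->|hk]; case: (par_case l) => [->|hl];
  rewrite ?par_o ?(negPf hi) ?(negPf hj) ?(negPf hk) ?(negPf hl) /=
    ?sbracket_acomm ?sbracket_comm // ?eqxx ?neq_o ?o_neq // ?expr1 ?scaleN1r
    ?opprK ?expr0 ?scale1r ?scale0r ?scaler0 ?oppr0 ?subr0 ?sub0r ?add0r ?addr0.
- by rewrite commxx subrr.
- exact: W_OB.
- exact: W_OA.
- exact: W_OE.
- by rewrite comm_antisym W_OB.
- exact: W_BB.
- by rewrite acomm_sym W_AB // addrC [k == j]eq_sym.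
- by rewrite comm_antisym W_EB // opprK [k == j]eq_sym.
- by rewrite comm_antisym W_OA // opprK.
- exact: W_AB.
- exact: W_AA.
- by rewrite comm_antisym W_EA // [l == i]eq_sym.
- by rewrite comm_antisym W_OE // oppr0.
- exact: W_EB.
- exact: W_EA.
- exact: W_EE.
Qed.
End Realisation.

(** * Realisations by matrix units *)

Local Notation i0 := (ord0 : 'I_3).
Local Notation i1 := (@Ordinal 3 1 isT).
Local Notation i2 := (ord_max : 'I_3).

Lemma sum_ord3 (V : nmodType) (F : 'I_3 -> V) : \sum_i F i = F i0 + F i1 + F i2.
Proof.
rewrite !big_ord_recl big_ord0 addr0 addrA.
by congr (F _ + F _ + F _); apply: val_inj.
Qed.

Section Phi.
Variables (R : realType) (X : Type).
Local Notation C := R[i].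
Local Notation gl21 := 'M[C]_3.
Local Notation par := gl21_par.
Variable rel : term C X -> term C X -> Prop.
Variable W : 'I_3 -> 'I_3 -> pres rel.
Local Notation o := (ord_max : 'I_3).
Implicit Types M N : gl21.

Definition mx_eval M : pres rel := \sum_(u : 'I_3 * 'I_3) M u.1 u.2 *: W u.1 u.2.

Fact mx_eval_linear : linear mx_eval.
Proof.
move=> a M N; rewrite /mx_eval scaler_sumr -big_split /=; apply: eq_bigr => u _.
by rewrite !mxE scalerDl scalerA.
Qed.

HB.instance Definition _ :=
  GRing.isLinear.Build C gl21 (pres rel) *:%R mx_eval mx_eval_linear.

Lemma mx_eval_delta i j : mx_eval (delta_mx i j) = W i j.
Proof.
rewrite /mx_eval (bigD1 (i, j)) //= big1 => [|[a b] /=].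
  by rewrite mxE !eqxx scale1r addr0.
by rewrite xpair_eqE mxE => /negPf ->; rewrite scale0r.
Qed.

Hypothesis W_br : forall i j k l,
  let p := par i (+) par j in let q := par k (+) par l in
  sbracket p q (W i j) (W k l) =
  (j == k)%:R *: W i l - (-1) ^+ (p && q) *: ((i == l)%:R *: W k j).

Let mx_eval_mul M N : mx_eval (M * N) =
  \sum_(u : 'I_3 * 'I_3) \sum_(v : 'I_3 * 'I_3)
    (M u.1 u.2 * N v.1 v.2) *: ((u.2 == v.1)%:R *: W u.1 v.2).
Proof.
rewrite /mx_eval -(pair_bigA _ (fun i l => (M * N) i l *: W i l)) /=.
rewrite -(pair_bigA _ (fun i j => \sum_(v : 'I_3 * 'I_3)
    (M i j * N v.1 v.2) *: ((j == v.1)%:R *: W i v.2))) /=.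
apply: eq_bigr => i _; under eq_bigr => l _ do rewrite mxE scaler_suml.
rewrite exchange_big /=; apply: eq_bigr => j _.
rewrite -(pair_bigA _ (fun k l => (M i j * N k l) *: ((j == k)%:R *: W i l))) /=.
rewrite [RHS](bigD1 j) //= [X in _ + X]big1 ?addr0 => [|k kj].
  by apply: eq_bigr => l _; rewrite eqxx scale1r.
by rewrite big1 // => l _; rewrite eq_sym (negPf kj) scale0r scaler0.
Qed.

Let mul_mx_eval M N : mx_eval M * mx_eval N =
  \sum_(u : 'I_3 * 'I_3) \sum_(v : 'I_3 * 'I_3)
    (M u.1 u.2 * N v.1 v.2) *: (W u.1 u.2 * W v.1 v.2).
Proof.
rewrite /mx_eval mulr_suml; apply: eq_bigr => u _; rewrite mulr_sumr.
by apply: eq_bigr => v _; rewrite -pres_scalerAl -pres_scalerAr scalerA.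
Qed.

(** Both sides are bilinear, and the parities of the matrix units that occur in
    homogeneous matrices are those of the matrices. *)
Lemma mx_eval_sbracket p q M N : gl21_homog p M -> gl21_homog q N ->
  mx_eval (sbracket p q M N) = sbracket p q (mx_eval M) (mx_eval N).
Proof.
move=> hM hN; rewrite sbracket_mxE linearP /= !mx_eval_mul exchange_big /=.
rewrite /sbracket signZ !mul_mx_eval [X in _ = _ - _ *: X]exchange_big /= addrC.
rewrite -scaleNr !scaler_sumr -!big_split; apply: eq_bigr => u _ /=.
rewrite !scaler_sumr -!big_split; apply: eq_bigr => v _ /=.
have [hu|hu] := boolP (par u.1 (+) par u.2 != p).
  by rewrite hM // !(mul0r, mulr0, scale0r, scaler0, addr0).
have [hv|hv] := boolP (par v.1 (+) par v.2 != q).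
  by rewrite hN // !(mul0r, mulr0, scale0r, scaler0, addr0).
move: hu hv; rewrite !negbK => /eqP hu /eqP hv.
have := W_br u.1 u.2 v.1 v.2; rewrite /= hu hv /sbracket signZ => h.
rewrite [N _ _ * _]mulrC; set m := M _ _ * N _ _; set s := (-1) ^+ _.
have E (w : pres rel) : - s *: (m *: w) = m *: - (s *: w).
  by rewrite scalerA scalerN -scaleNr scalerA mulrC mulrN mulNr.
by rewrite !E -!scalerDr h [v.2 == _]eq_sym.
Qed.

Lemma mx_eval_odd M : gl21_homog true M ->
  mx_eval M = M i0 i2 *: W i0 i2 + M i1 i2 *: W i1 i2
          + (M i2 i0 *: W i2 i0 + M i2 i1 *: W i2 i1).
Proof.
move=> hM; rewrite /mx_eval -(pair_bigA _ (fun i j => M i j *: W i j)) /=.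
rewrite !sum_ord3 /= (hM i0 i0) // (hM i0 i1) // (hM i1 i0) // (hM i1 i1) //.
by rewrite (hM i2 i2) // !scale0r !add0r addr0.
Qed.

Lemma mx_eval_even M : gl21_homog false M ->
  mx_eval M = M i0 i0 *: W i0 i0 + M i0 i1 *: W i0 i1
          + (M i1 i0 *: W i1 i0 + M i1 i1 *: W i1 i1) + M i2 i2 *: W i2 i2.
Proof.
move=> hM; rewrite /mx_eval -(pair_bigA _ (fun i j => M i j *: W i j)) /=.
rewrite !sum_ord3 /= (hM i0 i2) // (hM i1 i2) // (hM i2 i0) // (hM i2 i1) //.
by rewrite !scale0r !add0r !addr0.
Qed.

Lemma mx_eval1 : mx_eval 1 = W i0 i0 + W i1 i1 + W i2 i2.
Proof.
by rewrite mx_eval_even; [rewrite !mxE /= !scale1r !scale0r addr0 add0r | apply: homog1].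
Qed.

(** [W k k] multiplies [W i j] by [(k == i)%:R - (k == j)%:R], and these weights
    add up to 0. *)
Lemma mx_eval_comm1 M : comm (mx_eval 1) (mx_eval M) = 0.
Proof.
rewrite {2}/mx_eval comm_sumr big1 // => -[i j] _ /=; rewrite commZr mx_eval1 !commDl.
have hW k : comm (W k k) (W i j) =
    (k == i)%:R *: W k j - (k == j)%:R *: W i k.
  by have := W_br k k i j; rewrite /= addbb sbracket_comm //= scale1r.
rewrite !hW.
have hS (F : 'I_3 -> pres rel) l : \sum_k (k == l)%:R *: F k = F l.
  rewrite (bigD1 l) //= eqxx scale1r big1 ?addr0 // => k /negPf ->.
  exact: scale0r.
have -> : (i0 == i)%:R *: W i0 j - (i0 == j)%:R *: W i i0 +
    ((i1 == i)%:R *: W i1 j - (i1 == j)%:R *: W i i1) +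
    ((i2 == i)%:R *: W i2 j - (i2 == j)%:R *: W i i2) =
    \sum_k (k == i)%:R *: W k j - \sum_k (k == j)%:R *: W i k.
  by rewrite -sumrB sum_ord3.
by rewrite !hS subrr scaler0.
Qed.

(** The supercommutators of the odd elements [W i i2] and [W i2 j] give
    [W i j + (i == j)%:R *: W i2 i2], and these span the even part of sl(2|1). *)
Section Generation.
Variable gens : bool -> pres rel -> Prop.
Hypothesis gens_A : forall i, ~~ par i -> lie_gen gens true (W i i2).
Hypothesis gens_B : forall i, ~~ par i -> lie_gen gens true (W i2 i).

Let gensD p a b u v : lie_gen gens p u -> lie_gen gens p v ->
  lie_gen gens p (a *: u + b *: v).
Proof.
move=> hu hv; apply: lie_genD => //; rewrite -[_ *: v]addr0.
by apply: lie_genD => //; apply: lie_gen0.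
Qed.

Lemma mx_eval_sl_sub_lie_gen p M : gl21_homog p M -> gl21_str M = 0 ->
  lie_gen gens p (mx_eval M).
Proof.
case: p => hM.
  move=> _; rewrite mx_eval_odd // -[X in lie_gen _ _ X]addr0 -[X in X + _]scale1r.
  apply: lie_genD; last exact: lie_gen0.
  rewrite -[X in X + _]scale1r; apply: lie_genD.
    by apply: gensD; apply: gens_A.
  by apply: gensD; apply: gens_B.
rewrite /gl21_str sum_ord3 /= /gl21_par /= !expr0 expr1 !mul1r mulN1r => /eqP.
rewrite subr_eq0 => /eqP h2.
have hN i j : ~~ par i -> ~~ par j ->
    lie_gen gens false (W i j + (i == j)%:R *: W i2 i2).
  move=> hi hj; have := lie_gen_br (gens_A hi) (gens_B hj).
  have := W_br i i2 i2 j; rewrite /= (negPf hi) (negPf hj) /= scale1r.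
  by rewrite expr1 scaleN1r opprK => <-.
have -> : mx_eval M = 1 *: (M i0 i0 *: (W i0 i0 + (i0 == i0)%:R *: W i2 i2)
    + M i1 i1 *: (W i1 i1 + (i1 == i1)%:R *: W i2 i2))
    + 1 *: (M i0 i1 *: (W i0 i1 + (i0 == i1)%:R *: W i2 i2)
    + M i1 i0 *: (W i1 i0 + (i1 == i0)%:R *: W i2 i2)).
  rewrite mx_eval_even // -h2  !scale1r !scale0r !addr0 !scalerDr scalerDl.
  by rewrite [LHS](AC ((2*2)*2) (((1*5)*(4*6))*(2*3))).
by apply: gensD; apply: gensD; apply: hN.
Qed.

Lemma lie_gen_sl :
  (forall p v, gens p v ->
     exists M, [/\ gl21_homog p M, gl21_str M = 0 & mx_eval M = v]) ->
  forall p u, lie_gen gens p u <->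
    exists M, [/\ gl21_homog p M, gl21_str M = 0 & mx_eval M = u].
Proof.
move=> hg p u; split=> [|[M [hM sM <-]]]; last exact: mx_eval_sl_sub_lie_gen.
elim=> {p u} [p u /hg //|p|p a u v _ [M [hM sM <-]] _ [N [hN sN <-]]|
              p q u v _ [M [hM sM <-]] _ [N [hN sN <-]]].
- by exists 0; split; [apply: homog0|apply: str0|rewrite linear0].
- exists (a *: M + N); split; first exact: homog_lin.
    by rewrite str_lin sM sN mulr0 addr0.
  by rewrite linearP.
- exists (sbracket p q M N); split; first exact: homog_sbracket.
    exact: str_sbracket hM hN.
  exact: mx_eval_sbracket.
Qed.

(** A matrix is the sum of a multiple of the identity, whose supertrace is 1, and
    of a matrix of supertrace 0. *)
Lemma lie_gen_gl : lie_gen gens false (mx_eval 1) ->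
  (forall p v, gens p v -> exists2 M, gl21_homog p M & mx_eval M = v) ->
  forall p u, lie_gen gens p u <-> exists2 M, gl21_homog p M & mx_eval M = u.
Proof.
move=> h1 hg p u; split.
  elim=> {p u} [p u /hg //|p|p a u v _ [M hM <-] _ [N hN <-]|
                p q u v _ [M hM <-] _ [N hN <-]].
  - by exists 0; [apply: homog0|rewrite linear0].
  - by exists (a *: M + N); [apply: homog_lin|rewrite linearP].
  - by exists (sbracket p q M N); [apply: homog_sbracket|apply: mx_eval_sbracket].
move=> [M hM <-]; case: p hM => hM.
  by apply: mx_eval_sl_sub_lie_gen => //; apply: str_odd.
have -> : mx_eval M = gl21_str M *: mx_eval 1 + mx_eval (- gl21_str M *: 1 + M).
  by rewrite linearP /= scaleNr addrA subrr add0r.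
apply: lie_genD => //; apply: mx_eval_sl_sub_lie_gen.
  by apply: homog_lin => //; apply: homog1.
by rewrite str_lin str1 mulr1 addNr.
Qed.
End Generation.

Section Injectivity.
Hypothesis W02 : W i0 i2 != 0.
Hypothesis W1 : mx_eval 1 != 0.

(** An entry moves along its row or its column under brackets with the
    other off-diagonal [W k l], so that one of them vanishes only if all do. *)
Let W_neq0 i j : i != j -> W i j != 0.
Proof.
have row a b l : a != l -> W a b = 0 -> W a l = 0.
  move=> al h; have := W_br a b b l; rewrite /= h eqxx (negPf al) scale1r.
  by rewrite scale0r scaler0 subr0 /sbracket mul0r !mulr0 subrr.
have col a b l : l != b -> W a b = 0 -> W l b = 0.
  move=> lb h; have := W_br l a a b; rewrite /= h eqxx (negPf lb) scale1r.
  by rewrite scale0r scaler0 subr0 /sbracket mul0r !mulr0 subrr.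
move=> ij; apply: contraNneq W02 => h; apply/eqP.
have [i0j|] := boolP (i != i2); first by apply: (col i) => //; apply: row h.
rewrite negbK => /eqP ei; rewrite ei in ij h.
have [jn|] := boolP (j != i0).
  by apply: (row _ j) => //; apply: (col i2) => //; rewrite eq_sym.
rewrite negbK => /eqP ej; rewrite ej in h.
by apply: (col i1) => //; apply: (row _ i0) => //; apply: (col i2) => //.
Qed.

Let W_diag k i j : comm (W k k) (W i j) = ((k == i)%:R - (k == j)%:R) *: W i j.
Proof.
have := W_br k k i j; rewrite /= addbb sbracket_comm //= scale1r => ->.
rewrite scalerBl; congr (_ - _).
  by case: (k =P i) => [->//|_]; rewrite !scale0r.
by case: (k =P j) => [->//|_]; rewrite !scale0r.
Qed.

Let ad k M : gl21 := \matrix_(a, b) (((k == a)%:R - (k == b)%:R) * M a b).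

Let mx_eval_ad k M : mx_eval M = 0 -> mx_eval (ad k M) = 0.
Proof.
move=> hM; have <- : comm (W k k) (mx_eval M) = 0 by rewrite hM comm0r.
rewrite {2}/mx_eval comm_sumr.
by apply: eq_bigr => u _; rewrite mxE commZr W_diag scalerA mulrC.
Qed.

(** Bracketing with [W i i] and then with [W k k] leaves the entries [(i, k)]
    and [(k, i)]; a further bracket with [W i i] changes the sign of one of
    the two only. *)
Let mx_eval_offdiag i k M : i != k -> mx_eval M = 0 -> M i k = 0.
Proof.
move=> ik hM; have h2 := mx_eval_ad k (mx_eval_ad i hM).
have e : ad k (ad i M) + ad i (ad k (ad i M)) = (- 2 * M i k) *: delta_mx i k.
  have ki : (k == i) = false by rewrite eq_sym (negPf ik).
  apply/matrixP => a b; rewrite !mxE ![k == _]eq_sym ![i == _]eq_sym.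
  have [->|/negPf ai] := eqVneq a i; have [->|/negPf bk] := eqVneq b k;
    rewrite ?eqxx ?(negPf ik) ?ki ?ai ?bk /=; try by ring.
  by have [->|/negPf bi] := eqVneq b i; rewrite /=; ring.
have := congr2 +%R h2 (mx_eval_ad i h2).
rewrite -linearD /= e linearZ /= mx_eval_delta addr0 => /eqP.
rewrite scaler_eq0 (negPf (W_neq0 ik)) orbF mulf_eq0 oppr_eq0 pnatr_eq0 /=.
by move/eqP.
Qed.

(** By the preceding lemma the kernel consists of diagonal matrices; such a matrix
    has equal entries, because it commutes with the [W a b], hence is scalar. *)
Lemma mx_eval_inj : injective mx_eval.
Proof.
move=> M N eMN; apply/eqP; rewrite -subr_eq0; apply/eqP.
have: mx_eval (M - N) = 0 by rewrite linearB /= eMN subrr.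
move: (M - N) => {eMN N} {}M hM.
have hd a b : a != b -> M a a = M b b.
  move=> ab; have : comm (mx_eval M) (W a b) = 0 by rewrite hM comm0l.
  rewrite /mx_eval -(pair_bigA _ (fun i j => M i j *: W i j)) /=.
  rewrite comm_suml (eq_bigr (fun i => (M i i * ((i == a)%:R - (i == b)%:R)) *: W a b)).
    rewrite -scaler_suml => /eqP; rewrite scaler_eq0 (negPf (W_neq0 ab)) orbF.
    under eq_bigr => i _ do rewrite mulrBr.
    have hS l : \sum_i M i i * (i == l)%:R = M l l.
      rewrite (bigD1 l) //= eqxx mulr1 big1 ?addr0 // => i /negPf ->.
      exact: mulr0.
    by rewrite sumrB !hS subr_eq0 => /eqP.
  move=> i _; rewrite (bigD1 i) //= big1 ?addr0 => [|j ji].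
    by rewrite commZl W_diag scalerA.
  by rewrite mx_eval_offdiag ?scale0r // eq_sym.
have eM : M = M i0 i0 *: 1.
  apply/matrixP => a b; rewrite !mxE; have [<-|ab] := eqVneq a b.
    by rewrite mulr1; have [->//|a0] := eqVneq a i0; apply: hd.
  by rewrite mulr0 mx_eval_offdiag.
have /eqP := hM; rewrite {1}eM linearZ /= scaler_eq0 (negPf W1) orbF => /eqP h.
by rewrite eM h scale0r.
Qed.

End Injectivity.
End Phi.

(** * Realisations from four odd generators *)

Section Scale.
Variable R : realType.
(** Any complex number of squared modulus 2 would serve. *)
Definition pscale : R[i] := 1 + 'i.

Lemma pscaleM : pscale * pscale^* = 2.
Proof.
rewrite /pscale rmorphD rmorph1 /= conjCi; have h := sqrCi R[i].
by ring: h.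
Qed.
Lemma pscale_neq0 : pscale != 0.
Proof.
apply/eqP => h; have /eqP := pscaleM; rewrite h mul0r eq_sym.
by rewrite pnatr_eq0.
Qed.

Lemma scale_half_double (V : lmodType R[i]) (u : V) : 2^-1 *: (u + u) = u.
Proof.
rewrite -{1 2}[u]scale1r -scalerDl scalerA mulVf ?scale1r //.
by rewrite (pnatr_eq0 _ 2).
Qed.
End Scale.

Section OddGenerators.
Variables (R : realType) (X : Type).
Local Notation C := R[i].
Variable rel : term C X -> term C X -> Prop.
Local Notation A := (pres rel).

(** What has to be computed in a given algebra; all other relations are
    consequences. *)
Record odd_relations (Fp Fm Gp Gm Ep Em H Z1 Z2 : A) : Prop := OddRelations {
  oFpFp : acomm Fp Fp = 0; oFmFm : acomm Fm Fm = 0;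
  oGpGp : acomm Gp Gp = 0; oGmGm : acomm Gm Gm = 0;
  oFpFm : acomm Fp Fm = 0; oGpGm : acomm Gp Gm = 0;
  oFpGp : acomm Fp Gp = 2 *: Ep; oFmGm : acomm Fm Gm = - 2 *: Em;
  oFpGm : acomm Fp Gm = H - (2 *: Z2 - Z1); oFmGp : acomm Fm Gp = H + (2 *: Z2 - Z1);
  oHFp : comm H Fp = Fp; oHFm : comm H Fm = - Fm;
  oHGp : comm H Gp = Gp; oHGm : comm H Gm = - Gm;
  oZ2Fp : comm Z2 Fp = Fp; oZ2Fm : comm Z2 Fm = Fm;
  oZ2Gp : comm Z2 Gp = - Gp; oZ2Gm : comm Z2 Gm = - Gm }.

Variables Fp Fm Gp Gm Ep Em H Z1 Z2 : A.
Local Notation Z := (2 *: Z2 - Z1).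
Hypothesis odd : odd_relations Fp Fm Gp Gm Ep Em H Z1 Z2.

Let half (u v : A) : 2 *: u = 2 *: v -> u = v.
Proof. by apply: scalerI; rewrite pnatr_eq0. Qed.

(** The Jacobi identity for [a], [b] and [a]. *)
Lemma acomm_sq0 (a b : A) : acomm a a = 0 -> comm (acomm a b) a = 0.
Proof.
move=> ha; apply: half; rewrite scaler0 scaler_nat mulr2n.
rewrite {1}acomm_jacobi ha comm0l subr0 [acomm b a]acomm_sym.
by rewrite addNr.
Qed.

(** [H - Z] and [H + Z] are anticommutators, so they commute with their odd
    factors; this gives the brackets with [Z]. *)
Lemma comm_HmZ_Fp : comm (H - Z) Fp = 0.
Proof. by rewrite -(oFpGm odd) acomm_sq0 // (oFpFp odd). Qed.
Lemma comm_HmZ_Gm : comm (H - Z) Gm = 0.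
Proof. by rewrite -(oFpGm odd) acomm_sym acomm_sq0 // (oGmGm odd). Qed.
Lemma comm_HpZ_Fm : comm (H + Z) Fm = 0.
Proof. by rewrite -(oFmGp odd) acomm_sq0 // (oFmFm odd). Qed.
Lemma comm_HpZ_Gp : comm (H + Z) Gp = 0.
Proof. by rewrite -(oFmGp odd) acomm_sym acomm_sq0 // (oGpGp odd). Qed.

Lemma comm_Z_Fp : comm Z Fp = Fp.
Proof. by have /eqP := comm_HmZ_Fp; rewrite commBl (oHFp odd) subr_eq0 => /eqP. Qed.
Lemma comm_Z_Gm : comm Z Gm = - Gm.
Proof. by have /eqP := comm_HmZ_Gm; rewrite commBl (oHGm odd) subr_eq0 => /eqP. Qed.
Lemma comm_Z_Fm : comm Z Fm = Fm.
Proof.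
by have /eqP := comm_HpZ_Fm; rewrite commDl (oHFm odd) addrC subr_eq0 => /eqP.
Qed.
Lemma comm_Z_Gp : comm Z Gp = - Gp.
Proof.
by have /eqP := comm_HpZ_Gp; rewrite commDl (oHGp odd) addrC addr_eq0 => /eqP.
Qed.

Lemma comm_Ep_Fp : comm Ep Fp = 0.
Proof. by apply: half; rewrite -commZl -(oFpGp odd) acomm_sq0 ?scaler0 // (oFpFp odd). Qed.
Lemma comm_Ep_Gp : comm Ep Gp = 0.
Proof.
by apply: half; rewrite -commZl -(oFpGp odd) acomm_sym acomm_sq0 ?scaler0 // (oGpGp odd).
Qed.
Lemma comm_Em_Fm : comm Em Fm = 0.
Proof.
apply: half; apply: oppr_inj; rewrite -!scaleNr -commZl -(oFmGm odd).
by rewrite acomm_sq0 ?scaler0 // (oFmFm odd).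
Qed.
Lemma comm_Em_Gm : comm Em Gm = 0.
Proof.
apply: half; apply: oppr_inj; rewrite -!scaleNr -commZl -(oFmGm odd).
by rewrite acomm_sym acomm_sq0 ?scaler0 // (oGmGm odd).
Qed.
Lemma comm_Ep_Fm : comm Ep Fm = - Fp.
Proof.
apply: half; rewrite -commZl -(oFpGp odd) acomm_jacobi.
rewrite [acomm Gp Fm]acomm_sym (oFmGp odd) [acomm Fm Fp]acomm_sym (oFpFm odd).
by rewrite comm0l subr0 commDl (oHFp odd) comm_Z_Fp scaler_nat mulr2n opprD.
Qed.
Lemma comm_Ep_Gm : comm Ep Gm = - Gp.
Proof.
apply: half; rewrite -commZl -(oFpGp odd) acomm_sym acomm_jacobi (oFpGm odd).
rewrite [acomm Gm Gp]acomm_sym (oGpGm odd) comm0l subr0 commBl (oHGp odd).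
by rewrite comm_Z_Gp opprK scaler_nat mulr2n opprD.
Qed.
Lemma comm_Em_Fp : comm Em Fp = - Fm.
Proof.
apply: half; apply: oppr_inj; rewrite -!scaleNr -commZl -(oFmGm odd).
rewrite acomm_jacobi [acomm Gm Fp]acomm_sym (oFpGm odd) (oFpFm odd) comm0l subr0.
by rewrite commBl (oHFm odd) comm_Z_Fm scalerN scaleNr opprK opprD !opprK scaler_nat mulr2n.
Qed.
Lemma comm_Em_Gp : comm Em Gp = - Gm.
Proof.
apply: half; apply: oppr_inj; rewrite -!scaleNr -commZl -(oFmGm odd) acomm_sym.
rewrite acomm_jacobi (oFmGp odd) (oGpGm odd) comm0l subr0.
by rewrite commDl (oHGm odd) comm_Z_Gm scalerN scaleNr opprK opprD !opprK scaler_nat mulr2n.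
Qed.

Lemma comm_H_Ep : comm H Ep = 2 *: Ep.
Proof.
apply: half; rewrite -commZr -(oFpGp odd) comm_acomm (oHFp odd) (oHGp odd).
by rewrite scaler_nat mulr2n.
Qed.
Lemma comm_H_Em : comm H Em = - 2 *: Em.
Proof.
apply: half; apply: oppr_inj; rewrite -!scaleNr -commZr -(oFmGm odd).
rewrite comm_acomm (oHFm odd) (oHGm odd) acommNl acommNr scaleNr.
by rewrite scaler_nat mulr2n -opprD.
Qed.
Lemma comm_Ep_Em : comm Ep Em = H.
Proof.
apply: half; apply: oppr_inj; rewrite -!scaleNr -commZr -(oFmGm odd).
rewrite comm_acomm comm_Ep_Fm comm_Ep_Gm acommNl acommNr (oFpGm odd) (oFmGp odd).
by rewrite -opprD addrACA addNr addr0 scaleNr scaler_nat mulr2n.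
Qed.
Lemma comm_Z_H : comm Z H = 0.
Proof.
have -> : comm Z H = comm Z (H - Z) by rewrite commBr commxx subr0.
rewrite -(oFpGm odd) comm_acomm comm_Z_Fp comm_Z_Gm acommNr.
exact: subrr.
Qed.
Lemma comm_Z_Ep : comm Z Ep = 0.
Proof.
apply: half; rewrite -commZr -(oFpGp odd) comm_acomm comm_Z_Fp comm_Z_Gp acommNr.
by rewrite subrr scaler0.
Qed.
Lemma comm_Z_Em : comm Z Em = 0.
Proof.
apply: half; apply: oppr_inj; rewrite -!scaleNr -commZr -(oFmGm odd).
by rewrite comm_acomm comm_Z_Fm comm_Z_Gm acommNr subrr scaler0.
Qed.

Let comm_Z1 u v : comm Z2 u = v -> comm Z u = v -> comm Z1 u = v.
Proof.
move=> h2 h; have : comm Z u = v + v - comm Z1 u.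
  by rewrite commBl commZl h2 scaler_nat mulr2n.
by rewrite h => /eqP; rewrite eq_sym subr_eq (inj_eq (addrI v)) => /eqP.
Qed.

Lemma comm_Z1_Fp : comm Z1 Fp = Fp.
Proof. by apply: comm_Z1; [apply: oZ2Fp odd | apply: comm_Z_Fp]. Qed.
Lemma comm_Z1_Fm : comm Z1 Fm = Fm.
Proof. by apply: comm_Z1; [apply: oZ2Fm odd | apply: comm_Z_Fm]. Qed.
Lemma comm_Z1_Gp : comm Z1 Gp = - Gp.
Proof. by apply: comm_Z1; [apply: oZ2Gp odd | apply: comm_Z_Gp]. Qed.
Lemma comm_Z1_Gm : comm Z1 Gm = - Gm.
Proof. by apply: comm_Z1; [apply: oZ2Gm odd | apply: comm_Z_Gm]. Qed.

(** The matrix units: [pscale] and its conjugate have product 2, as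
    [acomm Fp Gp = 2 *: Ep] requires, and as they are conjugate the map [mx_eval]
    commutes with the star operations. *)
Definition unit21 (i j : 'I_3) : A :=
  match val i, val j with
  | 0%N, 0%N => 2^-1 *: (H + Z1)          | 0%N, 1%N => Ep
  | 1%N, 0%N => Em                        | 1%N, 1%N => 2^-1 *: (Z1 - H)
  | 0%N, _ => (pscale R)^-1 *: Fp         | 1%N, _ => - (pscale R)^-1 *: Fm
  | _, 0%N => ((pscale R)^*)^-1 *: Gm     | _, 1%N => ((pscale R)^*)^-1 *: Gp
  | _, _ => - Z2
  end.

Let evenP (i : 'I_3) : ~~ gl21_par i -> i = i0 \/ i = i1.
Proof. by case: i => [[|[|[|m]]] hm] //= _; [left|right]; apply: val_inj. Qed.

Let pV : (pscale R)^-1 * ((pscale R)^*)^-1 = 2^-1.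
Proof. by rewrite -invfM pscaleM. Qed.
Let halfK (u : A) : 2^-1 *: (2 *: u) = u.
Proof. by rewrite scalerA mulVf ?scale1r // pnatr_eq0. Qed.
Local Notation W := unit21.

Lemma unit21_AA : forall i k, ~~ gl21_par i -> ~~ gl21_par k ->
  acomm (W i i2) (W k i2) = 0.
Proof.
move=> i k /evenP[->|->] /evenP[->|->]; rewrite /W /= acommZl acommZr.
- by rewrite (oFpFp odd) !scaler0.
- by rewrite (oFpFm odd) !scaler0.
- by rewrite acomm_sym (oFpFm odd) !scaler0.
- by rewrite (oFmFm odd) !scaler0.
Qed.

Lemma unit21_BB : forall i k, ~~ gl21_par i -> ~~ gl21_par k ->
  acomm (W i2 i) (W i2 k) = 0.
Proof.
move=> i k /evenP[->|->] /evenP[->|->]; rewrite /W /= acommZl acommZr.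
- by rewrite (oGmGm odd) !scaler0.
- by rewrite acomm_sym (oGpGm odd) !scaler0.
- by rewrite (oGpGm odd) !scaler0.
- by rewrite (oGpGp odd) !scaler0.
Qed.

Lemma unit21_AB : forall i j, ~~ gl21_par i -> ~~ gl21_par j ->
  acomm (W i i2) (W i2 j) = W i j + (i == j)%:R *: W i2 i2.
Proof.
move=> i j /evenP[->|->] /evenP[->|->];
  rewrite /W /= acommZl acommZr scalerA ?mulNr pV ?scaleNr ?scale1r ?scale0r ?addr0.
- rewrite (oFpGm odd) opprB addrA scalerBr halfK.
  by [].
- by rewrite (oFpGp odd) halfK.
- by rewrite (oFmGm odd) scaleNr scalerN opprK halfK.
- rewrite (oFmGp odd) addrCA scalerDr halfK opprD -scalerN opprB.
  exact: addrC.
Qed.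

Lemma unit21_OA : forall i, ~~ gl21_par i -> comm (W i2 i2) (W i i2) = - W i i2.
Proof.
move=> i /evenP[->|->]; rewrite /W /= commNl commZr.
  by rewrite (oZ2Fp odd).
by rewrite (oZ2Fm odd).
Qed.

Lemma unit21_OB : forall i, ~~ gl21_par i -> comm (W i2 i2) (W i2 i) = W i2 i.
Proof.
move=> i /evenP[->|->]; rewrite /W /= commNl commZr.
  by rewrite (oZ2Gm odd) scalerN opprK.
by rewrite (oZ2Gp odd) scalerN opprK.
Qed.

Lemma unit21_EA : forall i j k,
  ~~ gl21_par i -> ~~ gl21_par j -> ~~ gl21_par k ->
  comm (W i j) (W k i2) = (j == k)%:R *: W i i2.
Proof.
move=> i j k /evenP[->|->] /evenP[->|->] /evenP[->|->];
  rewrite /W /= commZr ?scale1r ?scale0r.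
- by rewrite commZl commDl (oHFp odd) comm_Z1_Fp scale_half_double.
- by rewrite commZl commDl (oHFm odd) comm_Z1_Fm addNr !scaler0.
- by rewrite comm_Ep_Fp scaler0.
- by rewrite comm_Ep_Fm scaleNr scalerN opprK.
- by rewrite comm_Em_Fp scaleNr scalerN.
- by rewrite comm_Em_Fm scaler0.
- by rewrite commZl commBl (oHFp odd) comm_Z1_Fp subrr !scaler0.
- by rewrite commZl commBl (oHFm odd) comm_Z1_Fm opprK scale_half_double.
Qed.

Lemma unit21_EB : forall i j k,
  ~~ gl21_par i -> ~~ gl21_par j -> ~~ gl21_par k ->
  comm (W i j) (W i2 k) = - ((i == k)%:R *: W i2 j).
Proof.
move=> i j k /evenP[->|->] /evenP[->|->] /evenP[->|->];
  rewrite /W /= commZr ?scale1r ?scale0r ?oppr0.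
- by rewrite commZl commDl (oHGm odd) comm_Z1_Gm scale_half_double scalerN.
- by rewrite commZl commDl (oHGp odd) comm_Z1_Gp subrr !scaler0.
- by rewrite comm_Ep_Gm scalerN.
- by rewrite comm_Ep_Gp scaler0.
- by rewrite comm_Em_Gm scaler0.
- by rewrite comm_Em_Gp scalerN.
- by rewrite commZl commBl (oHGm odd) comm_Z1_Gm subrr !scaler0.
- by rewrite commZl commBl (oHGp odd) comm_Z1_Gp -opprD scalerN scale_half_double scalerN.
Qed.

Lemma unit21_bracket i j k l :
  let p := gl21_par i (+) gl21_par j in let q := gl21_par k (+) gl21_par l in
  sbracket p q (W i j) (W k l) =
  (j == k)%:R *: W i l - (-1) ^+ (p && q) *: ((i == l)%:R *: W k j).
Proof.
by apply: W_bracket; [exact: unit21_AA|exact: unit21_BB|exact: unit21_AB|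
  exact: unit21_OA|exact: unit21_OB|exact: unit21_EA|exact: unit21_EB].
Qed.

Lemma mx_eval1_unit21 : mx_eval W 1 = Z1 - Z2.
Proof.
rewrite mx_eval1 /W /=; congr (_ - _).
rewrite -scalerDr -[RHS]scale_half_double; congr (_ *: _).
by rewrite [H + Z1]addrC addrACA subrr addr0.
Qed.

Lemma mx_eval_unit21_odd X' : gl21_homog true X' -> mx_eval W X' =
  (X' i0 i2 / pscale R) *: Fp + (X' i2 i1 / (pscale R)^*) *: Gp
  + (- X' i1 i2 / pscale R) *: Fm + (X' i2 i0 / (pscale R)^*) *: Gm.
Proof.
move=> hX; rewrite mx_eval_odd // /unit21 /= !scalerA mulrN mulNr.
by rewrite [RHS](AC ((2*1)*1) ((1*3)*(4*2))).
Qed.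

Lemma mx_eval_unit21_even X' : gl21_homog false X' -> mx_eval W X' =
  X' i0 i1 *: Ep + X' i1 i0 *: Em + ((X' i0 i0 - X' i1 i1) / 2) *: H
  + ((X' i0 i0 + X' i1 i1) / 2) *: Z1 + (- X' i2 i2) *: Z2.
Proof.
move=> hX; rewrite mx_eval_even // /unit21 /= scalerN -scaleNr; congr (_ + _).
rewrite !scalerBr !scalerDr !scalerA !mulrDl !scalerDl mulNr !scaleNr.
by rewrite [LHS](AC ((2*1)*(1*2)) ((3*4)*(1*6)*(2*5))).
Qed.

Let W_delta i j (a : C) M : mx_eval W (a *: delta_mx i j + M) = a *: W i j + mx_eval W M.
Proof. by rewrite linearP /= mx_eval_delta. Qed.

Let p_neq0 := pscale_neq0 R.
Let q_neq0 : (pscale R)^* != 0. Proof. by rewrite fmorph_eq0. Qed.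

Lemma odd_image u : (exists2 M, gl21_homog true M & mx_eval W M = u) <->
  exists a b c d, u = a *: Fp + b *: Gp + c *: Fm + d *: Gm.
Proof.
split=> [[M hM <-]|[a [b [c [d ->]]]]].
  by rewrite mx_eval_unit21_odd //; do 4 eexists.
exists ((a * pscale R) *: delta_mx i0 i2 + ((b * (pscale R)^*) *: delta_mx i2 i1
  + ((- c * pscale R) *: delta_mx i1 i2 + ((d * (pscale R)^*) *: delta_mx i2 i0 + 0)))).
  by do 4!(apply: homog_lin; [exact: homog_delta|]); apply: homog0.
rewrite !W_delta linear0 addr0 /unit21 /= !scalerA mulNr mulrNN !mulfK //.
by rewrite !addrA.
Qed.

Lemma even_image u : (exists2 M, gl21_homog false M & mx_eval W M = u) <->
  exists a b c d e, u = a *: Ep + b *: Em + c *: H + d *: Z1 + e *: Z2.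
Proof.
split=> [[M hM <-]|[a [b [c [d [e ->]]]]]].
  by rewrite mx_eval_unit21_even //; do 5 eexists.
exists (a *: delta_mx i0 i1 + (b *: delta_mx i1 i0 + ((d + c) *: delta_mx i0 i0
  + ((d - c) *: delta_mx i1 i1 + (- e *: delta_mx i2 i2 + 0))))).
  by do 5!(apply: homog_lin; [exact: homog_delta|]); apply: homog0.
rewrite mx_eval_unit21_even; last first.
  by do 5!(apply: homog_lin; [exact: homog_delta|]); apply: homog0.
rewrite !mxE /= !(mulr1, mulr0, addr0, add0r, opprK).
have -> : d + c - (d - c) = c * 2 by ring.
have -> : d + c + (d - c) = d * 2 by ring.
by rewrite !mulfK ?pnatr_eq0.
Qed.

Lemma comm_center_mx_eval M : comm (Z1 - Z2) (mx_eval W M) = 0.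
Proof. by rewrite -mx_eval1_unit21; apply: mx_eval_comm1; apply: unit21_bracket. Qed.

Let gens_odd gens (hF : forall v, [\/ v = Fp, v = Gp, v = Fm | v = Gm] -> gens true v) :
  (forall i, ~~ gl21_par i -> lie_gen gens true (W i i2)) /\
  (forall i, ~~ gl21_par i -> lie_gen gens true (W i2 i)).
Proof.
have g a v : [\/ v = Fp, v = Gp, v = Fm | v = Gm] -> lie_gen gens true (a *: v).
  move=> hv; rewrite -[a *: v]addr0; apply: lie_genD; last exact: lie_gen0.
  by apply: lie_gen_in; apply: hF.
split=> i /evenP[->|->]; rewrite /unit21 /=; apply: g.
- by constructor 1.
- by constructor 3.
- by constructor 4.
- by constructor 2.
Qed.

Let gens_sub v : [\/ v = Fp, v = Gp, v = Fm | v = Gm] ->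
  exists M, [/\ gl21_homog true M, gl21_str M = 0 & mx_eval W M = v].
Proof.
move=> hv; have [|M hM eM] := (odd_image v).2; last by exists M; split=> //; apply: str_odd.
case: hv => ->.
- by exists 1, 0, 0, 0; rewrite scale1r !scale0r !addr0.
- by exists 0, 1, 0, 0; rewrite scale1r !scale0r !addr0 add0r.
- by exists 0, 0, 1, 0; rewrite scale1r !scale0r addr0 !add0r.
- by exists 0, 0, 0, 1; rewrite scale1r !scale0r !add0r.
Qed.

Lemma odd_generate_sl p u :
  lie_gen (fun q v => q = true /\ [\/ v = Fp, v = Gp, v = Fm | v = Gm]) p u <->
  exists M, [/\ gl21_homog p M, gl21_str M = 0 & mx_eval W M = u].
Proof.
have [gA gB] := gens_odd (gens := fun q v => q = true /\
  [\/ v = Fp, v = Gp, v = Fm | v = Gm]) (fun v hv => conj erefl hv).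
by apply: (lie_gen_sl unit21_bracket gA gB) => q v [-> /gens_sub].
Qed.

Lemma odd_center_generate_gl p u :
  lie_gen (fun q v => (q = true /\ [\/ v = Fp, v = Gp, v = Fm | v = Gm]) \/
    (q = false /\ v = Z1 - Z2)) p u <->
  exists2 M, gl21_homog p M & mx_eval W M = u.
Proof.
have [gA gB] := gens_odd (gens := fun q v => (q = true /\
  [\/ v = Fp, v = Gp, v = Fm | v = Gm]) \/ (q = false /\ v = Z1 - Z2))
  (fun v hv => or_introl (conj erefl hv)).
apply: (lie_gen_gl unit21_bracket gA gB).
  by apply: lie_gen_in; right; rewrite mx_eval1_unit21.
move=> q v [[-> /gens_sub[M [hM _ eM]]]|[-> ->]]; first by exists M.
by exists 1; [apply: homog1|apply: mx_eval1_unit21].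
Qed.

End OddGenerators.

(** * Tensor products of presented algebras *)

Section TensorLinear.
Variables (k : comNzRingType) (X Y : Type).
Variables (relX : term k X -> term k X -> Prop).
Variables (relY : term k Y -> term k Y -> Prop).
Local Notation AA := (pres relX).
Local Notation BB := (pres relY).
Local Notation TT := (tens relX relY).
Implicit Types (a : AA) (b : BB).

Lemma tensorDl a a' b : (a + a') ⊗ b = a ⊗ b + a' ⊗ b :> TT.
Proof. by have := tensor_linl 1 a a' b; rewrite !scale1r. Qed.
Lemma tensorDr a b b' : a ⊗ (b + b') = a ⊗ b + a ⊗ b' :> TT.
Proof. by have := tensor_linr 1 a b b'; rewrite !scale1r. Qed.
Lemma tensor0l b : (0 : AA) ⊗ b = 0 :> TT.
Proof. by apply: (addrI ((0 : AA) ⊗ b)); rewrite -tensorDl !addr0. Qed.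
Lemma tensor0r a : a ⊗ (0 : BB) = 0 :> TT.
Proof. by apply: (addrI (a ⊗ (0 : BB))); rewrite -tensorDr !addr0. Qed.
Lemma tensorZl x a b : (x *: a) ⊗ b = x *: (a ⊗ b) :> TT.
Proof. by have := tensor_linl x a 0 b; rewrite tensor0l !addr0. Qed.
Lemma tensorZr x a b : a ⊗ (x *: b) = x *: (a ⊗ b) :> TT.
Proof. by have := tensor_linr x a b 0; rewrite tensor0r !addr0. Qed.
Lemma tensorNl a b : (- a) ⊗ b = - (a ⊗ b) :> TT.
Proof. by rewrite -scaleN1r tensorZl scaleN1r. Qed.
Lemma tensorNr a b : a ⊗ (- b) = - (a ⊗ b) :> TT.
Proof. by rewrite -scaleN1r tensorZr scaleN1r. Qed.
Lemma tensorBl a a' b : (a - a') ⊗ b = a ⊗ b - a' ⊗ b :> TT.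
Proof. by rewrite tensorDl tensorNl. Qed.
Lemma tensorBr a b b' : a ⊗ (b - b') = a ⊗ b - a ⊗ b' :> TT.
Proof. by rewrite tensorDr tensorNr. Qed.
Lemma tensor_suml (I : finType) (P : pred I) (F : I -> AA) b :
  (\sum_(i | P i) F i) ⊗ b = \sum_(i | P i) F i ⊗ b :> TT.
Proof.
by apply: (big_morph (fun a => a ⊗ b : TT)) => [a a'|];
  rewrite ?tensorDl ?tensor0l.
Qed.
Lemma tensor_sumr (I : finType) (P : pred I) (F : I -> BB) a :
  a ⊗ (\sum_(i | P i) F i) = \sum_(i | P i) a ⊗ F i :> TT.
Proof.
by apply: (big_morph (fun b => a ⊗ b : TT)) => [b b'|];
  rewrite ?tensorDr ?tensor0r.
Qed.

Lemma acomm_tensor (a a' : AA) (b b' : BB) :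
  acomm (a ⊗ b : TT) (a' ⊗ b') =
  (a * a') ⊗ acomm b b' + comm a' a ⊗ (b' * b).
Proof. by rewrite /acomm /comm !tensorM tensorDr tensorBl addrACA subrr addr0. Qed.

Lemma comm_tensor1r a a' b : comm (a ⊗ (1 : BB) : TT) (a' ⊗ b) = comm a a' ⊗ b.
Proof. by rewrite /comm !tensorM mul1r mulr1 tensorBl. Qed.
Lemma comm_tensor1l a b b' : comm ((1 : AA) ⊗ b : TT) (a ⊗ b') = a ⊗ comm b b'.
Proof. by rewrite /comm !tensorM mul1r mulr1 tensorBr. Qed.

Lemma acomm_sum_tensor n (a a' : 'I_n -> AA) (b b' : 'I_n -> BB) :
  acomm (\sum_j a j ⊗ b j : TT) (\sum_k a' k ⊗ b' k) =
  \sum_j \sum_k ((a j * a' k) ⊗ acomm (b j) (b' k)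
                 + comm (a' k) (a j) ⊗ (b' k * b j)).
Proof.
have suml (u : 'I_n -> TT) v : acomm (\sum_j u j) v = \sum_j acomm (u j) v.
  by rewrite /acomm mulr_suml mulr_sumr -big_split.
rewrite suml; apply: eq_bigr => j _; rewrite acomm_sym suml.
by apply: eq_bigr => l _; rewrite acomm_sym acomm_tensor.
Qed.

(** With commutators of the shape of the defining relation of the rational
    Cherednik algebra and anticommutators of Clifford shape, the reflection
    part collects into products of two linear Clifford elements. *)
Lemma acomm_sum_reflections n (I : finType) (P : pred I) (g : I -> AA)
    (kp : I -> k) (r r' : I -> 'I_n -> k) (e e' : k)
    (a a' : 'I_n -> AA) (b b' : 'I_n -> BB) :
  (forall j l, comm (a' l) (a j) = (e * (j == l)%:R) *: (1 : AA)
     - \sum_(s | P s) (kp s * (r s j * r' s l)) *: g s) ->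
  (forall j l, acomm (b j) (b' l) = (e' * (j == l)%:R) *: (1 : BB)) ->
  acomm (\sum_j a j ⊗ b j : TT) (\sum_j a' j ⊗ b' j) =
  e' *: (\sum_j a j * a' j) ⊗ (1 : BB) + e *: ((1 : AA) ⊗ (\sum_j b' j * b j))
  - \sum_(s | P s) g s ⊗
      (kp s *: ((\sum_j r' s j *: b' j) * (\sum_j r s j *: b j))).
Proof.
move=> ha hb; rewrite acomm_sum_tensor.
under eq_bigr => j _ do under eq_bigr => l _ do
  rewrite ha hb tensorBl addrA !tensorZr tensorZl tensor_suml -!scalerA.
have hdelta (F : 'I_n -> TT) j : \sum_l (j == l)%:R *: F l = F j.
  rewrite (bigD1 j) //= eqxx scale1r big1 ?addr0 // => l lj.
  by rewrite eq_sym (negPf lj) scale0r.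
under eq_bigr => j _ do rewrite sumrB big_split /= -!scaler_sumr !hdelta.
rewrite sumrB big_split /= -!scaler_sumr -tensor_suml -tensor_sumr.
congr (_ + _ - _).
under eq_bigr => j _ do rewrite exchange_big /=.
rewrite exchange_big /=; apply: eq_bigr => s _.
rewrite tensorZr mulr_suml tensor_sumr scaler_sumr exchange_big /=.
apply: eq_bigr => l _; rewrite mulr_sumr tensor_sumr scaler_sumr.
apply: eq_bigr => j _.
rewrite -pres_scalerAl -pres_scalerAr !tensorZr tensorZl !scalerA.
by congr (_ *: _); ring.
Qed.
End TensorLinear.

(** * Commutators in the rational Cherednik algebra *)

Section Cherednik.
Import Defs.
Variables (R : realType) (n : nat) (E : vectType R) (gT : finGroupType).
Variables (K : comAlgType R[i]) (D : setting n E gT K).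
Local Notation C := R[i].
Local Notation S := (reflections (rho D)).
Local Notation B := (form D).
Local Notation al := (alpha D).
Local Notation "r %:c" := (real_complex R r) (at level 2, format "r %:c").

Definition crefl (s : gT) : Hc D := iK D (c D s) * iG D s.
Definition kappa (s : gT) : C := (B (al s) (al s))^-1%:c.

Lemma iX0 : iX D 0 = 0.
Proof. by have := iX_lin D (-1) 0 0; rewrite scaler0 addr0 rmorphN1 scaleN1r addNr. Qed.
Lemma iE0 : iE D 0 = 0.
Proof. by have := iE_lin D (-1) 0 0; rewrite scaler0 addr0 rmorphN1 scaleN1r addNr. Qed.
Lemma iXZ a x : iX D (a *: x) = a%:c *: iX D x.
Proof. by rewrite -[a *: x]addr0 iX_lin iX0 addr0. Qed.
Lemma iEZ a v : iE D (a *: v) = a%:c *: iE D v.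
Proof. by rewrite -[a *: v]addr0 iE_lin iE0 addr0. Qed.
Lemma iXD x y : iX D (x + y) = iX D x + iX D y.
Proof. by rewrite -[x]scale1r iX_lin rmorph1 !scale1r. Qed.
Lemma iED v w : iE D (v + w) = iE D v + iE D w.
Proof. by rewrite -[v]scale1r iE_lin rmorph1 !scale1r. Qed.
Lemma iXBZ x a y : iX D (x - a *: y) = iX D x - a%:c *: iX D y.
Proof. by rewrite iXD -scaleNr iXZ rmorphN scaleNr. Qed.
Lemma iEBZ v a w : iE D (v - a *: w) = iE D v - a%:c *: iE D w.
Proof. by rewrite iED -scaleNr iEZ rmorphN scaleNr. Qed.
Lemma iX_sum (I : finType) (F : I -> dual E) : iX D (\sum_i F i) = \sum_i iX D (F i).
Proof. by apply: (big_morph (iX D)) => [x y|]; rewrite ?iXD ?iX0. Qed.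
Lemma iE_sum (I : finType) (F : I -> E) : iE D (\sum_i F i) = \sum_i iE D (F i).
Proof. by apply: (big_morph (iE D)) => [x y|]; rewrite ?iED ?iE0. Qed.

Lemma xx_form j v : pair (xx D j) v = B v (xi D j).
Proof.
have -> : xx D j = flat D (xi D j); last by rewrite pair_flat form_sym.
by apply: (dual_eq (D := D)) => k;
  rewrite pair_flat ?form_xi ?form_xi_eta ?xx_xi ?xx_eta.
Qed.
Lemma yy_form j v : pair (yy D j) v = B v (eta D j).
Proof.
have -> : yy D j = flat D (eta D j); last by rewrite pair_flat form_sym.
apply: (dual_eq (D := D)) => k.
  by rewrite pair_flat form_sym form_xi_eta yy_xi.
by rewrite pair_flat form_eta yy_eta.
Qed.

Lemma iE_expand v : iE D v = \sum_j
  ((pair (xx D j) v)%:c *: iE D (xi D j) + (pair (yy D j) v)%:c *: iE D (eta D j)).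
Proof.
rewrite {1}(basis_expand D v) iE_sum; apply: eq_bigr => j _.
by rewrite iED !iEZ xx_form yy_form.
Qed.

Lemma iX_expand x : iX D x = \sum_j
  ((pair x (xi D j))%:c *: iX D (xx D j) + (pair x (eta D j))%:c *: iX D (yy D j)).
Proof.
rewrite -{1}(flat_sharp D x) /flat iX_sum; apply: eq_bigr => j _.
by rewrite iXD !iXZ !form_sharp.
Qed.

Lemma form_expand v : B v v = \sum_j (pair (xx D j) v ^+ 2 + pair (yy D j) v ^+ 2).
Proof.
rewrite {2}(basis_expand D v) form_sym form_suml; apply: eq_bigr => j _.
by rewrite formDl !formZl !(form_sym D _ v) xx_form yy_form !expr2.
Qed.

(** In this form the coefficient does not depend on the choice of [alpha], and its
    invariance under conjugation is apparent. *)
Lemma cherednik_coef_sub x v s : s \in S ->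
  cherednik_coef D x v s = (pair x v - pair x (rho D s v))%:c.
Proof.
move=> sS; rewrite /cherednik_coef pair_alphav // rho_reflection //; congr _%:c.
have -> t : pair x (v - t *: al s) = pair x v - t * pair x (al s).
  by rewrite addrC -scaleNr pair_linr mulNr addrC.
by rewrite opprB addrC subrK mulrC.
Qed.

Lemma dual_act_reflection x s : s \in S ->
  dual_act (rho D) s x = x - pair x (al s) *: alphav D s.
Proof.
move=> sS; apply: dualP => v; rewrite pair_dual_act (reflectionV sS) rho_reflection //.
have -> t : pair x (v - t *: al s) = pair x v - t * pair x (al s).
  by rewrite addrC -scaleNr pair_linr mulNr addrC.
have -> : pair (x - pair x (al s) *: alphav D s) v =
    pair x v - pair x (al s) * pair (alphav D s) v.
  by rewrite addrC -scaleNr pair_lin mulNr addrC.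
by rewrite pair_alphav // mulrC.
Qed.

Lemma rho_reflection_alphav v s : s \in S ->
  rho D s v = v - pair (alphav D s) v *: al s.
Proof. by move=> sS; rewrite rho_reflection // pair_alphav. Qed.

Definition euler : Hc D :=
  \sum_j (iX D (xx D j) * iE D (xi D j) + iX D (yy D j) * iE D (eta D j)).

Lemma comm_crefl_iX s x : s \in S -> comm (crefl s) (iX D x) =
  - ((pair x (al s))%:c *: (iX D (alphav D s) * crefl s)).
Proof.
move=> sS; have hK u : comm (iK D (c D s)) u = 0 by rewrite /comm iK_central subrr.
rewrite comm_mull hK mul0r addr0 [comm (iG D s) _]/comm iGX dual_act_reflection //.
rewrite iXBZ -mulrBl addrAC subrr sub0r mulNr mulrN mulrA -pres_scalerAr.
by rewrite iK_central -pres_scalerAl -mulrA.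
Qed.

Lemma comm_crefl_iE s v : s \in S -> comm (crefl s) (iE D v) =
  - ((pair (alphav D s) v)%:c *: (iE D (al s) * crefl s)).
Proof.
move=> sS; have hK u : comm (iK D (c D s)) u = 0 by rewrite /comm iK_central subrr.
rewrite comm_mull hK mul0r addr0 [comm (iG D s) _]/comm iGE rho_reflection_alphav //.
rewrite iEBZ -mulrBl addrAC subrr sub0r mulNr mulrN mulrA -pres_scalerAr.
by rewrite iK_central -pres_scalerAl -mulrA.
Qed.

Lemma iEXE v x : comm (iE D v) (iX D x) = (pair x v)%:c *: (1 : Hc D) -
  \sum_(s in S) (pair x (al s) * pair (alphav D s) v)%:c *: crefl s.
Proof. exact: iEX. Qed.

Lemma comm_euler_iX x : comm euler (iX D x) =
  iX D x - \sum_(s in S) (pair x (al s))%:c *: (iX D (alphav D s) * crefl s).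
Proof.
have hX y z u : comm (iX D y * u) (iX D z) = iX D y * comm u (iX D z).
  by rewrite comm_mull iXX mul0r addr0.
rewrite /euler comm_suml.
under eq_bigr => j _ do rewrite commDl !hX !iEXE !mulrBr !mulr_sumr addrACA
  -opprD -big_split /= -!pres_scalerAr !mulr1.
rewrite sumrB -iX_expand; congr (_ - _).
rewrite exchange_big /=; apply: eq_bigr => s _.
rewrite (iX_expand (alphav D s)) mulr_suml scaler_sumr; apply: eq_bigr => j _.
by rewrite mulrDl scalerDr -!pres_scalerAl -!pres_scalerAr !scalerA -!rmorphM.
Qed.

Lemma comm_euler_iE v : comm euler (iE D v) =
  - iE D v + \sum_(s in S) (pair (alphav D s) v)%:c *: (crefl s * iE D (al s)).
Proof.
have hX y z u : comm (u * iE D y) (iE D z) = comm u (iE D z) * iE D y.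
  by rewrite comm_mull iEE mulr0 add0r.
rewrite /euler comm_suml.
under eq_bigr => j _ do rewrite commDl !hX !(comm_antisym (iX D _)) !iEXE
  !opprB !mulrBl !mulr_suml addrACA -opprD -big_split /= -!pres_scalerAl !mul1r.
rewrite sumrB -iE_expand addrC; congr (_ + _).
rewrite exchange_big /=; apply: eq_bigr => s _.
rewrite (iE_expand (al s)) mulr_sumr scaler_sumr; apply: eq_bigr => j _.
rewrite mulrDr scalerDr -!pres_scalerAl -!pres_scalerAr !scalerA -!rmorphM.
by rewrite ![pair (alphav D s) _ * _]mulrC.
Qed.

Lemma euler_complex : \sum_j (zv D j * zeta D j + zbar D j * zetabar D j) = euler.
Proof.
apply: eq_bigr => j _; rewrite /zv /zeta /zbar /zetabar.
set x := iX D _; set y := iX D _; set v := iE D _; set w := iE D _.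
have e eps : eps * eps = -1 ->
    (x + eps *: y) * (v - eps *: w) = x * v + y * w + eps *: (y * v - x * w).
  move=> h; rewrite mulrDl !mulrBr -!pres_scalerAl -!pres_scalerAr scalerA h.
  by rewrite scaleN1r opprK scalerBr [LHS](AC (2*2) ((1*4)*(3*2))).
have hi : 'i * 'i = -1 :> C by rewrite -expr2 sqrCi.
rewrite -!pres_scalerAr -scalerDr e // -scaleNr -[v + _]/(v + 'i *: w).
rewrite -[in v + 'i *: w](opprK 'i) [- - 'i *: w]scaleNr e ?mulrNN //.
by rewrite scaleNr addrACA subrr addr0 scale_half_double.
Qed.

Lemma hHE : hH D = euler + n%:R - \sum_(s in S) crefl s.
Proof. by rewrite /hH euler_complex. Qed.

Let comm_nat u : comm (n%:R : Hc D) u = 0.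
Proof. by rewrite /comm mulr_natl mulr_natr subrr. Qed.

(** The reflection terms of the commutators of the Euler element are cancelled by
    those of the commutators of the [crefl s]. *)
Lemma comm_hH_iX x : comm (hH D) (iX D x) = iX D x.
Proof.
rewrite hHE commBl commDl comm_nat addr0 comm_euler_iX comm_suml.
rewrite [X in _ - X](eq_bigr _ (fun s sS => comm_crefl_iX x sS)).
by rewrite sumrN opprK subrK.
Qed.

Lemma comm_hH_iE v : comm (hH D) (iE D v) = - iE D v.
Proof.
rewrite hHE commBl commDl comm_nat addr0 comm_euler_iE comm_suml.
rewrite -addrA -sumrB big1 ?addr0 // => s sS.
(* [s] changes the sign of [al s]. *)
have e : crefl s * iE D (al s) = - (iE D (al s) * crefl s).
  have := comm_crefl_iE (al s) sS; rewrite pair_alphav // mulfK ?form_alpha_neq0 //.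
  rewrite rmorph_nat scaler_nat mulr2n /comm => /eqP.
  by rewrite subr_eq opprD subrK => /eqP.
by rewrite e comm_crefl_iE // scalerN opprK addNr.
Qed.

End Cherednik.

(** * Fermionic Clifford generators *)

Section Clifford.
Import Defs.
Variables (R : realType) (n : nat).
Local Notation C := R[i].
Local Notation f := (@clF R n).
Local Notation fd := (@clFd R n).

Lemma clE_acomm j k :
  acomm (clE R j) (clE R k : Cl R n) = (2 * (j == k)%:R) *: (1 : Cl R n).
Proof. by have := prelP (@cliff_anti R n j k); rewrite !pclassE. Qed.

Let acomm_pair eps eps' (j k : 'I_n) :
  acomm (2^-1 *: (clE R (lshift n j) + eps *: clE R (rshift n j)))
        (2^-1 *: (clE R (lshift n k) + eps' *: clE R (rshift n k)) : Cl R n) =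
  (2^-1 * (1 + eps * eps') * (j == k)%:R) *: (1 : Cl R n).
Proof.
rewrite acommZl acommZr !(acommDl, acommDr, acommZl, acommZr) !clE_acomm.
rewrite !eq_lshift !eq_rshift eq_lrshift eq_rlshift mulr0 !scale0r !scaler0.
rewrite addr0 add0r !scalerA -!scalerDl scalerA; by congr (_ *: _); field.
Qed.

Let ii : 'i * 'i = -1 :> C. Proof. by rewrite -expr2 sqrCi. Qed.
Let clFE j : f j = 2^-1 *: (clE R (lshift n j) + (- 'i) *: clE R (rshift n j)).
Proof. by rewrite scaleNr. Qed.

Lemma acomm_fd_f j k : acomm (fd j) (f k) = (1 * (j == k)%:R) *: (1 : Cl R n).
Proof.
by rewrite clFE acomm_pair mulrN ii opprK mulVf ?(pnatr_eq0 _ 2).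
Qed.
Lemma acomm_f_fd j k : acomm (f j) (fd k) = (1 * (j == k)%:R) *: (1 : Cl R n).
Proof. by rewrite acomm_sym acomm_fd_f eq_sym. Qed.
Lemma acomm_f_f j k : acomm (f j) (f k) = (0 * (j == k)%:R) *: (1 : Cl R n).
Proof. by rewrite !clFE acomm_pair mulrNN ii subrr mulr0. Qed.
Lemma acomm_fd_fd j k : acomm (fd j) (fd k) = (0 * (j == k)%:R) *: (1 : Cl R n).
Proof. by rewrite acomm_pair ii subrr mulr0. Qed.

Lemma acomm_lin (a b : 'I_n -> C) (u v : 'I_n -> Cl R n) (e : C) :
  (forall j k, acomm (u j) (v k) = (e * (j == k)%:R) *: (1 : Cl R n)) ->
  acomm (\sum_j a j *: u j) (\sum_k b k *: v k) = (e * \sum_j a j * b j) *: (1 : Cl R n).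
Proof.
move=> h; rewrite mulr_sumr scaler_suml /acomm mulr_suml mulr_sumr -big_split /=.
apply: eq_bigr => j _; rewrite mulr_sumr mulr_suml -big_split /=.
under eq_bigr => k _ do rewrite -/(acomm _ _) acommZl acommZr h !scalerA.
rewrite (bigD1 j) //= eqxx big1 ?addr0 => [|k kj]; last first.
  by rewrite eq_sym (negPf kj) !mulr0 scale0r.
by rewrite [e * _]mulr1; congr (_ *: _); ring.
Qed.

Lemma sq_lin (a : 'I_n -> C) (u : 'I_n -> Cl R n) :
  (forall j k, acomm (u j) (u k) = (0 * (j == k)%:R) *: (1 : Cl R n)) ->
  (\sum_j a j *: u j) * (\sum_j a j *: u j) = 0.
Proof.
move=> h; have := acomm_lin a a h; rewrite mul0r scale0r /acomm => h0.
by rewrite -[LHS]scale_half_double h0 scaler0.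
Qed.

Lemma comm_fd_f j : comm (fd j) (f j) = 2 *: (fd j * f j) - 1.
Proof.
have := acomm_fd_f j j; rewrite eqxx mul1r scale1r /acomm /comm => <-.
by rewrite scaler_nat mulr2n opprD addrACA subrr add0r.
Qed.

Lemma half_sum_comm_fd_f : 2^-1 *: (\sum_j comm (fd j) (f j)) =
  \sum_j fd j * f j - (n%:R / 2) *: (1 : Cl R n).
Proof.
under eq_bigr => j _ do rewrite comm_fd_f.
rewrite sumrB -scaler_sumr scalerBr scalerA mulVf ?pnatr_eq0 // scale1r.
by rewrite sumr_const card_ord [n%:R / 2]mulrC -scalerA scaler_nat.
Qed.

Lemma comm_scalar (a : C) (u : Cl R n) : comm (a *: (1 : Cl R n)) u = 0.
Proof. by rewrite commZl /comm mul1r mulr1 subrr scaler0. Qed.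

Lemma comm_number_fd j : comm (2^-1 *: (\sum_k comm (fd k) (f k))) (fd j) = fd j.
Proof.
rewrite half_sum_comm_fd_f commBl comm_scalar subr0 comm_suml (bigD1 j) //=.
rewrite big1 ?addr0 => [|k kj]; rewrite comm_mull_acomm acomm_f_fd acomm_fd_fd.
  by rewrite eqxx mul1r mul0r scale1r scale0r mul0r subr0 mulr1.
by rewrite (negPf kj) !mulr0 !scale0r mulr0 mul0r subrr.
Qed.

Lemma comm_number_f j : comm (2^-1 *: (\sum_k comm (fd k) (f k))) (f j) = - f j.
Proof.
rewrite half_sum_comm_fd_f commBl comm_scalar subr0 comm_suml (bigD1 j) //=.
rewrite big1 ?addr0 => [|k kj]; rewrite comm_mull_acomm acomm_f_f acomm_fd_f.
  by rewrite eqxx mul1r mul0r scale1r scale0r mulr0 mul1r sub0r.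
by rewrite (negPf kj) !mulr0 !scale0r mulr0 mul0r subrr.
Qed.
End Clifford.

(** * The relations of the odd generators *)

Section OddRelations.
Import Defs.
Variables (R : realType) (n : nat) (E : vectType R) (gT : finGroupType).
Variables (K : comAlgType R[i]) (D : setting n E gT K).
Local Notation C := R[i].
Local Notation S := (reflections (rho D)).
Local Notation B := (form D).
Local Notation al := (alpha D).
Local Notation f := (@clF R n).
Local Notation fd := (@clFd R n).
Local Notation "r %:c" := (real_complex R r) (at level 2, format "r %:c").
Local Notation crefl := (crefl D).
Local Notation kappa := (kappa D).
Local Notation pz j s := (pair_z D j (al s)).
Local Notation pzb j s := (pair_zbar D j (al s)).

Let ii : 'i * 'i = -1 :> C. Proof. by rewrite -expr2 sqrCi. Qed.

Definition chrel (a : C) (b : gT -> C) : Hc D :=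
  a *: (1 : Hc D) - \sum_(s in S) b s *: crefl s.

Let chrel_lin x a a' b b' :
  chrel a b + x *: chrel a' b' = chrel (a + x * a') (fun s => b s + x * b' s).
Proof.
rewrite /chrel scalerBr scalerA addrACA -scalerDl -opprD scaler_sumr -big_split.
congr (_ - _); apply: eq_bigr => s _.
by rewrite /= scalerDl scalerA.
Qed.

(** One computation for four commutators: [eps] and [eps'] are ['i] or its opposite,
    and the constant term survives exactly when they are opposite. *)
Let comm_zeta_z eps eps' j k :
  comm (2^-1 *: (iE D (xi D k) + eps *: iE D (eta D k)))
       (iX D (xx D j) + eps' *: iX D (yy D j)) =
  (2^-1 * (1 + eps * eps') * (j == k)%:R) *: (1 : Hc D)
  - \sum_(s in S) (kappa s * (((pair (xx D j) (al s))%:c + eps' * (pair (yy D j) (al s))%:c)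
       * ((pair (xx D k) (al s))%:c + eps * (pair (yy D k) (al s))%:c))) *: crefl s.
Proof.
rewrite commZl commDl !commDr !commZr !commZl addrA [eps' *: (_ *: _)]scalerA !iEXE.
rewrite xx_xi xx_eta yy_xi yy_eta -!/(chrel _ _) !chrel_lin.
rewrite /chrel scalerBr scalerA scaler_sumr; congr (_ *: _ - _).
  by rewrite !rmorph0 rmorph_nat; field => //.
apply: eq_bigr => s sS; rewrite scalerA; congr (_ *: _).
rewrite !pair_alphav // -!xx_form -!yy_form /kappa.
rewrite !(rmorphM, rmorphV) ?unitfE ?form_alpha_neq0 //=.
rewrite rmorph_nat.
have : (B (al s) (al s))%:c != 0 by rewrite fmorph_eq0 form_alpha_neq0.
by move=> h; field; rewrite ?h.
Qed.

Lemma comm_zetabar_zbar j k : comm (zetabar D k) (zbar D j) =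
  (1 * (j == k)%:R) *: (1 : Hc D) -
  \sum_(s in S) (kappa s * (pzb j s * pz k s)) *: crefl s.
Proof.
have := comm_zeta_z 'i (- 'i) j k; rewrite scaleNr mulrN ii opprK.
rewrite mulVf ?(pnatr_eq0 _ 2) // => ->; congr (_ - _).
by apply: eq_bigr => s _; rewrite mulNr.
Qed.

Lemma comm_zeta_zv j k : comm (zeta D k) (zv D j) =
  (1 * (j == k)%:R) *: (1 : Hc D) -
  \sum_(s in S) (kappa s * (pz j s * pzb k s)) *: crefl s.
Proof.
have := comm_zeta_z (- 'i) 'i j k; rewrite scaleNr mulNr ii opprK.
rewrite mulVf ?(pnatr_eq0 _ 2) // => ->; congr (_ - _).
by apply: eq_bigr => s _; rewrite mulNr.
Qed.

Lemma comm_zeta_zbar j k : comm (zeta D k) (zbar D j) =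
  (0 * (j == k)%:R) *: (1 : Hc D) -
  \sum_(s in S) (kappa s * (pzb j s * pzb k s)) *: crefl s.
Proof.
have := comm_zeta_z (- 'i) (- 'i) j k; rewrite !scaleNr mulrNN ii subrr mulr0.
by move=> ->; congr (_ - _); apply: eq_bigr => s _; rewrite !mulNr.
Qed.

Lemma comm_zetabar_zv j k : comm (zetabar D k) (zv D j) =
  (0 * (j == k)%:R) *: (1 : Hc D) -
  \sum_(s in S) (kappa s * (pz j s * pz k s)) *: crefl s.
Proof. by have := comm_zeta_z 'i 'i j k; rewrite ii subrr mulr0. Qed.

Let no_refl (j k : 'I_n) : (0 : Hc D) = (0 * (j == k)%:R) *: (1 : Hc D)
  - \sum_(s in S) (kappa s * (0 * 0)) *: crefl s.
Proof.
rewrite mul0r scale0r big1 ?subrr // => s _.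
by rewrite !mulr0 scale0r.
Qed.

Let commXX a b (x y x' y' : dual E) :
  comm (iX D x + a *: iX D y) (iX D x' + b *: iX D y') = 0.
Proof. by rewrite commDl !commDr !commZl !commZr !iXX !scaler0 !addr0. Qed.
Let commEE a b (v w v' w' : E) :
  comm (2^-1 *: (iE D v + a *: iE D w)) (2^-1 *: (iE D v' + b *: iE D w')) = 0.
Proof.
rewrite commZl commZr commDl !commDr !commZl !commZr !iEE.
by rewrite !scaler0 !addr0 !scaler0.
Qed.

Lemma comm_z_z j k : comm (zv D j) (zv D k) = 0.
Proof. exact: commXX. Qed.
Lemma comm_z_zbar j k : comm (zv D j) (zbar D k) = 0.
Proof. by rewrite /zbar -scaleNr; apply: commXX. Qed.
Lemma comm_zbar_zbar j k : comm (zbar D j) (zbar D k) = 0.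
Proof. by rewrite /zbar -!scaleNr; apply: commXX. Qed.
Lemma comm_zeta_zeta j k : comm (zeta D j) (zeta D k) = 0.
Proof. by rewrite /zeta -!scaleNr; apply: commEE. Qed.
Lemma comm_zeta_zetabar j k : comm (zeta D j) (zetabar D k) = 0.
Proof. by rewrite /zeta -!scaleNr; apply: commEE. Qed.
Lemma comm_zetabar_zetabar j k : comm (zetabar D j) (zetabar D k) = 0.
Proof. exact: commEE. Qed.

(** The anticommutator of [alphad] and [alphad_v] is the squared length of
    [alpha], normalised to 2. *)
Lemma acomm_alphad s : s \in S -> acomm (alphad D s) (alphad_v D s) = 2 *: (1 : Cl R n).
Proof.
move=> sS; rewrite /alphad_v acommZr (acomm_lin _ _ (@acomm_fd_f R n)) scalerA.
congr (_ *: _); rewrite mul1r.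
have -> : \sum_j pzb j s * pz j s = (B (al s) (al s))%:c.
  rewrite form_expand rmorph_sum; apply: eq_bigr => j _.
  rewrite /pair_z /pair_zbar rmorphD !rmorphXn /=; have h := sqrCi C.
  by ring: h.
by rewrite -rmorphM divfK ?form_alpha_neq0 // rmorph_nat.
Qed.

Lemma alphad_alphad_v s : alphad D s * alphad_v D s = 1 - tau D s.
Proof. by rewrite /tau opprB addrC subrK. Qed.
Lemma alphad_v_alphad s : s \in S -> alphad_v D s * alphad D s = 1 + tau D s.
Proof.
move=> sS; have /eqP := acomm_alphad sS; rewrite /acomm addrC eq_sym -subr_eq => /eqP <-.
by rewrite alphad_alphad_v opprB scaler_nat mulr2n addrA addrAC addrK.
Qed.

Lemma alphad_vE s : alphad_v D s = (2 * kappa s) *: \sum_k pz k s *: f k.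
Proof. by rewrite /alphad_v /kappa rmorphM rmorph_nat. Qed.

Local Notation W a b := (\sum_j a j ⊗ b j : HC D).

Let Ep' : 2 *: Ep D = (\sum_j zbar D j * zv D j) ⊗ (1 : Cl R n).
Proof.
rewrite /Ep /hEp tensorZl scalerA mulfV ?pnatr_eq0 // scale1r.
congr (_ ⊗ _); apply: eq_bigr => j _.
by have /eqP := comm_z_zbar j j; rewrite subr_eq0 => /eqP.
Qed.

Let Em' : - 2 *: Em D = 2 *: (2 *: (\sum_j zeta D j * zetabar D j) ⊗ (1 : Cl R n)).
Proof. by rewrite /Em /hEm tensorZl !scalerA mulrNN. Qed.

Let killed (F : 'I_n -> Hc D) (r : gT -> 'I_n -> C) (u : 'I_n -> Cl R n) :
  (forall j k, acomm (u j) (u k) = (0 * (j == k)%:R) *: (1 : Cl R n)) ->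
  0 *: (\sum_j F j) ⊗ (1 : Cl R n) + 0 *: ((1 : Hc D) ⊗ (\sum_j u j * u j))
  - \sum_(s in S) crefl s ⊗
      (kappa s *: ((\sum_j r s j *: u j) * (\sum_j r s j *: u j))) = 0.
Proof.
move=> hu; rewrite !scale0r addr0 sub0r big1 ?oppr0 // => s _.
by rewrite sq_lin // scaler0 tensor0r.
Qed.

Let F0 : gT -> 'I_n -> C := fun _ _ => 0.

Let acomm_killed (a a' : 'I_n -> Hc D) (u : 'I_n -> Cl R n) (r : gT -> 'I_n -> C) :
  (forall j k, comm (a' k) (a j) = (0 * (j == k)%:R) *: (1 : Hc D)
     - \sum_(s in S) (kappa s * (r s j * r s k)) *: crefl s) ->
  (forall j k, acomm (u j) (u k) = (0 * (j == k)%:R) *: (1 : Cl R n)) ->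
  acomm (W a u) (W a' u) = 0.
Proof. by move=> ha hu; rewrite (acomm_sum_reflections ha hu); apply: killed. Qed.

Let commuting (a a' : 'I_n -> Hc D) : (forall j k, comm (a' k) (a j) = 0) ->
  forall j k, comm (a' k) (a j) = (0 * (j == k)%:R) *: (1 : Hc D)
     - \sum_(s in S) (kappa s * (F0 s j * F0 s k)) *: crefl s.
Proof. by move=> h j k; rewrite h; apply: no_refl. Qed.

Let acomm_commuting (a a' : 'I_n -> Hc D) (u u' : 'I_n -> Cl R n) :
  (forall j k, comm (a' k) (a j) = 0) ->
  (forall j k, acomm (u j) (u' k) = (1 * (j == k)%:R) *: (1 : Cl R n)) ->
  acomm (W a u) (W a' u') = (\sum_j a j * a' j) ⊗ (1 : Cl R n).
Proof.
move=> ha hu; rewrite (acomm_sum_reflections (commuting ha) hu) scale1r scale0r addr0.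
rewrite [X in _ - X]big1 ?subr0 // => s _.
rewrite big1 => [|j _]; last by rewrite scale0r.
by rewrite mul0r scaler0 tensor0r.
Qed.

Let hH_complex : (\sum_j (zv D j * zeta D j + zbar D j * zetabar D j)) ⊗ (1 : Cl R n)
  = Hh D - n%:R *: (1 : HC D) + \sum_(s in S) crefl s ⊗ (1 : Cl R n).
Proof.
rewrite /Hh /hH; set e := \sum_j _.
have eS : (\sum_(s in S) iK D (c D s) * iG D s) ⊗ (1 : Cl R n) =
    \sum_(s in S) crefl s ⊗ (1 : Cl R n) by exact: tensor_suml.
rewrite tensorBl eS tensorDl; set q := \sum_(s in S) _.
rewrite -[RHS]addrA [- _ + q]addrC addrA subrK.
have -> : (n%:R : Hc D) ⊗ (1 : Cl R n) = n%:R *: (1 : HC D).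
  by rewrite -tensor1 -tensorZl scaler_nat.
by rewrite addrK.
Qed.

Let sum_comm : (1 : Hc D) ⊗ (\sum_j comm (fd j) (f j)) = 2 *: Z2 D.
Proof. by rewrite /Z2 tensorZr scalerA mulfV ?pnatr_eq0 // scale1r. Qed.

Let sum_one : (1 : Hc D) ⊗ (\sum_(j < n) (1 : Cl R n)) = n%:R *: (1 : HC D).
Proof. by rewrite sumr_const card_ord -tensor1 -tensorZr scaler_nat. Qed.

Let Omega_tau : \sum_(s in S) crefl s ⊗ tau D s = hZ0 D ⊗ (1 : Cl R n) - Z1 D.
Proof. by rewrite /Z1 opprB addrC subrK. Qed.

(** The reflections contribute [alphad_v s * alphad s = 1 + tau s]: the part 1
    belongs to [hH] and the part [tau s] to [Omega]. *)
Let Fp_Gm : acomm (Fp D) (Fbm D) = Hh D - (2 *: Z2 D - Z1 D).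
Proof.
rewrite /Fbm acommZr (acomm_sum_reflections comm_zetabar_zbar (@acomm_fd_f R n)).
rewrite !scale1r scalerBr scalerDr -tensorZl -tensorZr [X in _ - X]scaler_sumr.
have -> : 2 *: (\sum_j zbar D j * zetabar D j) =
    \sum_j (zv D j * zeta D j + zbar D j * zetabar D j) + hZ0 D.
  rewrite /hZ0 scaler_sumr -big_split; apply: eq_bigr => j _ /=.
  by rewrite addrC addrA subrK scaler_nat mulr2n.
have -> : 2 *: (\sum_j f j * fd j) = \sum_(j < n) (1 : Cl R n) - \sum_j comm (fd j) (f j).
  rewrite scaler_sumr -sumrB; apply: eq_bigr => j _.
  have := acomm_fd_f R j j; rewrite eqxx mul1r scale1r /acomm /comm => <-.
  by rewrite opprB [fd j * f j + _]addrC addrACA subrr addr0 scaler_nat mulr2n.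
rewrite (eq_bigr (fun s => crefl s ⊗ (1 : Cl R n) + crefl s ⊗ tau D s)); last first.
  move=> s sS; rewrite -tensorDr -alphad_v_alphad // -tensorZr scalerA.
  by rewrite pres_scalerAl -alphad_vE.
rewrite [X in _ - X]big_split /= tensorDl tensorBr hH_complex sum_comm sum_one Omega_tau.
rewrite !(opprB, opprD) [LHS](AC ((((2*1)*1)*2)*(1*2))
  ((1*(8*6))*((2*5)*((3*7)*(4*9))))) /=.
by rewrite !addNr !subrr !addr0.
Qed.

(** Here the reflections contribute [alphad s * alphad_v s = 1 - tau s]. *)
Let Fm_Gp : acomm (Fm D) (Fbp D) = Hh D + (2 *: Z2 D - Z1 D).
Proof.
rewrite acomm_sym /Fm acommZr (acomm_sum_reflections comm_zeta_zv (@acomm_f_fd R n)).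
rewrite !scale1r scalerBr scalerDr -tensorZl -tensorZr [X in _ - X]scaler_sumr.
have -> : 2 *: (\sum_j zv D j * zeta D j) =
    \sum_j (zv D j * zeta D j + zbar D j * zetabar D j) - hZ0 D.
  rewrite /hZ0 scaler_sumr -sumrB; apply: eq_bigr => j _ /=.
  by rewrite opprB addrACA subrr addr0 scaler_nat mulr2n.
have -> : 2 *: (\sum_j fd j * f j) = \sum_(j < n) (1 : Cl R n) + \sum_j comm (fd j) (f j).
  rewrite scaler_sumr -big_split; apply: eq_bigr => j _.
  by rewrite /= comm_fd_f addrC subrK.
rewrite (eq_bigr (fun s => crefl s ⊗ (1 : Cl R n) - crefl s ⊗ tau D s)); last first.
  move=> s sS; rewrite -tensorBr -alphad_alphad_v -tensorZr scalerA.
  by rewrite pres_scalerAr -alphad_vE.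
rewrite [X in _ - X]sumrB tensorBl tensorDr hH_complex sum_comm sum_one Omega_tau.
rewrite !(opprB, opprD) [LHS](AC ((((2*1)*1)*2)*((2*1)))
  ((1*(6*8))*((2*5)*((3*9)*(4*7))))) /=.
by rewrite !addNr !subrr !addr0.
Qed.

Let Z2_lin (a : 'I_n -> Hc D) (u : 'I_n -> Cl R n) :
  comm (Z2 D) (W a u) = \sum_j a j ⊗ comm (2^-1 *: \sum_j comm (fd j) (f j)) (u j).
Proof. by rewrite comm_sumr; apply: eq_bigr => j _; rewrite /Z2 comm_tensor1l. Qed.

Let H_lin (a : 'I_n -> Hc D) (u : 'I_n -> Cl R n) :
  comm (Hh D) (W a u) = \sum_j comm (hH D) (a j) ⊗ u j.
Proof. by rewrite comm_sumr; apply: eq_bigr => j _; rewrite /Hh comm_tensor1r. Qed.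

Theorem odd_relations_cherednik : odd_relations (Fp D) (Fm D) (Fbp D) (Fbm D)
  (Ep D) (Em D) (Hh D) (Z1 D) (Z2 D).
Proof.
split.
- apply: (acomm_killed (commuting _)); last exact: acomm_fd_fd.
  by move=> j k; apply: comm_zbar_zbar.
- rewrite /Fm acommZl acommZr (acomm_killed (commuting _)) ?scaler0 //.
    by move=> j k; apply: comm_zeta_zeta.
  exact: acomm_fd_fd.
- apply: (acomm_killed (commuting _)); last exact: acomm_f_f.
  by move=> j k; apply: comm_z_z.
- rewrite /Fbm acommZl acommZr (acomm_killed (commuting _)) ?scaler0 //.
    by move=> j k; apply: comm_zetabar_zetabar.
  exact: acomm_f_f.
- rewrite /Fm acommZr (acomm_killed comm_zeta_zbar) ?scaler0 //.
  exact: acomm_fd_fd.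
- rewrite /Fbm acommZr (acomm_killed comm_zetabar_zv) ?scaler0 //.
  exact: acomm_f_f.
- rewrite Ep' (acomm_commuting _ (@acomm_fd_f R n)) // => j k.
  exact: comm_z_zbar.
- rewrite Em' /Fm /Fbm acommZl acommZr (acomm_commuting _ (@acomm_fd_f R n)) //.
  by move=> j k; rewrite comm_antisym comm_zeta_zetabar oppr0.
- exact: Fp_Gm.
- exact: Fm_Gp.
- rewrite H_lin; apply: eq_bigr => j _.
  by rewrite /zbar commBr commZr !comm_hH_iX.
- rewrite /Fm commZr -scalerN H_lin -sumrN; congr (_ *: _); apply: eq_bigr => j _.
  by rewrite /zeta commZr commBr commZr !comm_hH_iE -tensorNl scalerN -opprD scalerN.
- rewrite H_lin; apply: eq_bigr => j _.
  by rewrite /zv commDr commZr !comm_hH_iX.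
- rewrite /Fbm commZr -scalerN H_lin -sumrN; congr (_ *: _); apply: eq_bigr => j _.
  by rewrite /zetabar commZr commDr commZr !comm_hH_iE -tensorNl scalerN -opprD scalerN.
- by rewrite Z2_lin; apply: eq_bigr => j _; rewrite comm_number_fd.
- by rewrite /Fm commZr Z2_lin; congr (_ *: _); apply: eq_bigr => j _;
    rewrite comm_number_fd.
- by rewrite Z2_lin -sumrN; apply: eq_bigr => j _; rewrite comm_number_f tensorNr.
- rewrite /Fbm commZr Z2_lin -scalerN -sumrN; congr (_ *: _); apply: eq_bigr => j _.
  by rewrite comm_number_f tensorNr.
Qed.

End OddRelations.

(** * Parity *)

Section Homogeneity.
Import Defs.
Variables (R : realType) (n : nat) (E : vectType R) (gT : finGroupType).
Variables (K : comAlgType R[i]) (D : setting n E gT K).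
Local Notation C := R[i].
Local Notation S := (reflections (rho D)).
Local Notation f := (@clF R n).
Local Notation fd := (@clFd R n).

Lemma cl_homogZ p (a : C) (u : Cl R n) : cl_homog p u -> cl_homog p (a *: u).
Proof. by move=> hu; rewrite -[a *: u]addr0; apply: cl_homogD => //; apply: cl_homog0. Qed.
Lemma cl_homog_add p (u v : Cl R n) : cl_homog p u -> cl_homog p v -> cl_homog p (u + v).
Proof. by move=> hu hv; rewrite -[u]scale1r; apply: cl_homogD. Qed.
Lemma cl_homog_sum p (I : finType) (F : I -> Cl R n) :
  (forall i, cl_homog p (F i)) -> cl_homog p (\sum_i F i).
Proof.
by move=> h; elim/big_rec: _ => [|i x _ hx]; [apply: cl_homog0|apply: cl_homog_add].
Qed.

Let cl_homog_pair p (eps : C) (a b : 'I_(n + n)) (u : Cl R n) : cl_homog p u ->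
  cl_homog (~~ p) ((2^-1 *: (clE R a + eps *: clE R b)) * u).
Proof.
move=> hu; rewrite -pres_scalerAl mulrDl -pres_scalerAl; apply: cl_homogZ.
by rewrite addrC; apply: cl_homogD; apply: cl_homogE.
Qed.

Lemma cl_homog_f_mul p j u : cl_homog p u -> cl_homog (~~ p) (f j * u).
Proof. by rewrite /clF -scaleNr; apply: cl_homog_pair. Qed.
Lemma cl_homog_fd_mul p j u : cl_homog p u -> cl_homog (~~ p) (fd j * u).
Proof. exact: cl_homog_pair. Qed.
Lemma cl_homog_f j : cl_homog true (f j).
Proof. by rewrite -[f j]mulr1; apply: (@cl_homog_f_mul false); apply: cl_homog1. Qed.
Lemma cl_homog_fd j : cl_homog true (fd j).
Proof. by rewrite -[fd j]mulr1; apply: (@cl_homog_fd_mul false); apply: cl_homog1. Qed.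

Lemma cl_homog_tau s : cl_homog false (tau D s).
Proof.
rewrite /tau addrC -scaleN1r; apply: cl_homogD; last exact: cl_homog1.
rewrite /alphad mulr_suml; apply: cl_homog_sum => j; rewrite -pres_scalerAl.
apply: cl_homogZ; apply: (@cl_homog_fd_mul true); apply: cl_homogZ.
by apply: cl_homog_sum => k; apply: cl_homogZ; apply: cl_homog_f.
Qed.

Lemma cl_homog_comm_fd_f j : cl_homog false (comm (fd j) (f j)).
Proof.
rewrite /comm addrC -scaleN1r; apply: cl_homogD.
  by apply: (@cl_homog_f_mul true); apply: cl_homog_fd.
by apply: (@cl_homog_fd_mul true); apply: cl_homog_f.
Qed.

Lemma hc_homogZ p (a : C) (u : HC D) : hc_homog p u -> hc_homog p (a *: u).
Proof.
elim=> [|a' b hb|v w _ hv _ hw].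
- by rewrite scaler0; apply: hc_homog0.
- by rewrite -tensorZl; apply: hc_homog_tens.
- by rewrite scalerDr; apply: hc_homogD.
Qed.
Lemma hc_homog_sum p (I : finType) (P : pred I) (F : I -> HC D) :
  (forall i, P i -> hc_homog p (F i)) -> hc_homog p (\sum_(i | P i) F i).
Proof.
move=> h; elim/big_rec: _ => [|i x Pi hx]; first exact: hc_homog0.
by apply: hc_homogD => //; apply: h.
Qed.

Lemma hc_homog_Fp : hc_homog true (Fp D).
Proof. by apply: hc_homog_sum => j _; apply: hc_homog_tens; apply: cl_homog_fd. Qed.
Lemma hc_homog_Fbp : hc_homog true (Fbp D).
Proof. by apply: hc_homog_sum => j _; apply: hc_homog_tens; apply: cl_homog_f. Qed.
Lemma hc_homog_Fm : hc_homog true (Fm D).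
Proof.
by apply: hc_homogZ; apply: hc_homog_sum => j _; apply: hc_homog_tens; apply: cl_homog_fd.
Qed.
Lemma hc_homog_Fbm : hc_homog true (Fbm D).
Proof.
by apply: hc_homogZ; apply: hc_homog_sum => j _; apply: hc_homog_tens; apply: cl_homog_f.
Qed.
Lemma hc_homog_even1 (a : Hc D) : hc_homog false (a ⊗ (1 : Cl R n) : HC D).
Proof. by apply: hc_homog_tens; apply: cl_homog1. Qed.
Lemma hc_homog_Z1 : hc_homog false (Z1 D).
Proof.
apply: hc_homogD; first exact: hc_homog_even1.
rewrite -scaleN1r; apply: hc_homogZ; apply: hc_homog_sum => s _.
by apply: hc_homog_tens; apply: cl_homog_tau.
Qed.
Lemma hc_homog_Z2 : hc_homog false (Z2 D).
Proof.
apply: hc_homog_tens; apply: cl_homogZ; apply: cl_homog_sum => j.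
exact: cl_homog_comm_fd_f.
Qed.
Lemma hc_homogB p (u v : HC D) : hc_homog p u -> hc_homog p v -> hc_homog p (u - v).
Proof. by move=> hu hv; apply: hc_homogD => //; rewrite -scaleN1r; apply: hc_homogZ. Qed.

Lemma hc_homog_unit21 i j : hc_homog (gl21_par i (+) gl21_par j)
  (unit21 (Fp D) (Fm D) (Fbp D) (Fbm D) (Ep D) (Em D) (Hh D) (Z1 D) (Z2 D) i j).
Proof.
case: i => [[|[|[|i]]] hi] //=; case: j => [[|[|[|j]]] hj] //=;
  rewrite /gl21_par /unit21 /=.
- by apply: hc_homogZ; apply: hc_homogD; [apply: hc_homog_even1|apply: hc_homog_Z1].
- exact: hc_homog_even1.
- by apply: hc_homogZ; apply: hc_homog_Fp.
- exact: hc_homog_even1.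
- by apply: hc_homogZ; apply: hc_homogB; [apply: hc_homog_Z1|apply: hc_homog_even1].
- by apply: hc_homogZ; apply: hc_homog_Fm.
- by apply: hc_homogZ; apply: hc_homog_Fbm.
- by apply: hc_homogZ; apply: hc_homog_Fbp.
- by rewrite -scaleN1r; apply: hc_homogZ; apply: hc_homog_Z2.
Qed.
End Homogeneity.

(** * The star operation *)

Section Star.
Import Defs.
Variables (R : realType) (n : nat) (E : vectType R) (gT : finGroupType).
Variables (K : comAlgType R[i]) (D : setting n E gT K).
Local Notation C := R[i].
Local Notation f := (@clF R n).
Local Notation fd := (@clFd R n).
Variables (stH : Hc D -> Hc D) (stC : Cl R n -> Cl R n) (st : HC D -> HC D).
Hypothesis hst : is_star stH stC st.

Lemma stD u v : st (u + v) = st u + st v.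
Proof. by have := star_lin hst 1 u v; rewrite !scale1r rmorph1 scale1r. Qed.
Lemma st0 : st 0 = 0.
Proof. by apply: (addrI (st 0)); rewrite -stD !addr0. Qed.
Lemma stZ (a : C) u : st (a *: u) = a^* *: st u.
Proof. by have := star_lin hst a u 0; rewrite st0 !addr0. Qed.
Lemma stN u : st (- u) = - st u.
Proof. by rewrite -scaleN1r stZ rmorphN1 scaleN1r. Qed.
Lemma stB u v : st (u - v) = st u - st v.
Proof. by rewrite stD stN. Qed.
Lemma st_sum (I : finType) (P : pred I) (F : I -> HC D) :
  st (\sum_(i | P i) F i) = \sum_(i | P i) st (F i).
Proof. by apply: (big_morph st) => [u v|]; rewrite ?stD ?st0. Qed.
Lemma st1 : st 1 = 1.
Proof. by rewrite -[LHS]mulr1 -[X in _ * X](starK hst) -(starM hst) mulr1 (starK hst). Qed.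
Lemma st_acomm u v : st (acomm u v) = acomm (st u) (st v).
Proof. by rewrite /acomm stD !(starM hst) addrC. Qed.

Let conj2 : (2 : C)^* = 2. Proof. exact: rmorph_nat. Qed.

Lemma st_Fp : st (Fp D) = Fbm D.
Proof.
rewrite /Fp /Fbm st_sum scaler_sumr; apply: eq_bigr => j _.
rewrite /zbar tensorBl tensorZl stB stZ conjCi !(star_tens hst).
rewrite (star_x hst) (star_y hst) (star_fd hst) scaleNr opprK.
by rewrite /zetabar tensorZl scalerA mulfV ?pnatr_eq0 // scale1r tensorDl tensorZl.
Qed.
Lemma st_Fbp : st (Fbp D) = Fm D.
Proof.
rewrite /Fbp /Fm st_sum scaler_sumr; apply: eq_bigr => j _.
rewrite /zv tensorDl tensorZl stD stZ conjCi !(star_tens hst).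
rewrite (star_x hst) (star_y hst) (star_f hst) scaleNr.
by rewrite /zeta tensorZl scalerA mulfV ?pnatr_eq0 // scale1r tensorBl tensorZl.
Qed.
Lemma st_Fm : st (Fm D) = Fbp D.
Proof. by rewrite -st_Fbp (starK hst). Qed.
Lemma st_Fbm : st (Fbm D) = Fp D.
Proof. by rewrite -st_Fp (starK hst). Qed.

Let rel := odd_relations_cherednik D.

Let halfI (u v : HC D) : 2 *: u = 2 *: v -> u = v.
Proof. by apply: scalerI; rewrite pnatr_eq0. Qed.

Lemma st_Ep : st (Ep D) = - Em D.
Proof.
apply: halfI; rewrite -{1}conj2 -stZ -(oFpGp rel) st_acomm st_Fp st_Fbp.
by rewrite acomm_sym (oFmGm rel) scalerN scaleNr.
Qed.
Lemma st_Em : st (Em D) = - Ep D.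
Proof. by rewrite -[Em D]opprK -st_Ep stN (starK hst). Qed.

(** The star exchanges the two factors of each of these anticommutators. *)
Let st_HmZ : st (Hh D - (2 *: Z2 D - Z1 D)) = Hh D - (2 *: Z2 D - Z1 D).
Proof. by rewrite -(oFpGm rel) st_acomm st_Fp st_Fbm acomm_sym. Qed.
Let st_HpZ : st (Hh D + (2 *: Z2 D - Z1 D)) = Hh D + (2 *: Z2 D - Z1 D).
Proof. by rewrite -(oFmGp rel) st_acomm st_Fm st_Fbp acomm_sym. Qed.

Let add_sub (u v : HC D) : (u + v) + (u - v) = 2 *: u.
Proof. by rewrite addrACA subrr addr0 scaler_nat mulr2n. Qed.
Let sub_sub (u v : HC D) : (u + v) - (u - v) = 2 *: v.
Proof. by rewrite opprB addrC addrA subrK scaler_nat mulr2n. Qed.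

Lemma st_H : st (Hh D) = Hh D.
Proof.
apply: halfI; rewrite -{1}conj2 -stZ -(add_sub _ (2 *: Z2 D - Z1 D)).
by rewrite stD st_HmZ st_HpZ.
Qed.
Let st_Z : st (2 *: Z2 D - Z1 D) = 2 *: Z2 D - Z1 D.
Proof.
apply: halfI; rewrite -{1}conj2 -stZ -(sub_sub (Hh D) (2 *: Z2 D - Z1 D)).
by rewrite stB st_HmZ st_HpZ.
Qed.

(** [stH 1] need not be 1 a priori, but applying the star to
    [acomm (fd j) (f j) = 1] shows that its square acts as 1. *)
Let st_number j : st ((1 : Hc D) ⊗ (fd j * f j)) = 1 ⊗ (fd j * f j).
Proof.
have st_mul u v : st ((1 : Hc D) ⊗ (u * v)) = (stH 1 * stH 1) ⊗ (stC v * stC u).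
  by rewrite -[1 in LHS]mulr1 -tensorM (starM hst) !(star_tens hst) tensorM.
have h : (stH 1 * stH 1) ⊗ (1 : Cl R n) = 1 :> HC D.
  rewrite -[RHS]st1 -tensor1.
  have -> : (1 : Cl R n) = fd j * f j + f j * fd j.
    by have := acomm_fd_f R j j; rewrite eqxx mul1r scale1r /acomm => ->.
  by rewrite !tensorDr stD !st_mul (star_f hst) (star_fd hst).
rewrite st_mul (star_f hst) (star_fd hst).
have -> : (stH 1 * stH 1) ⊗ (fd j * f j) =
   ((stH 1 * stH 1) ⊗ (1 : Cl R n)) * ((1 : Hc D) ⊗ (fd j * f j)) :> HC D.
  by rewrite tensorM mulr1 mul1r.
by rewrite h mul1r.
Qed.

Lemma Z2_number : Z2 D =
  (1 : Hc D) ⊗ (\sum_j fd j * f j - (n%:R / 2) *: (1 : Cl R n)).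
Proof. by rewrite /Z2 half_sum_comm_fd_f. Qed.

Lemma st_Z2 : st (Z2 D) = Z2 D.
Proof.
rewrite Z2_number tensorBr tensorZr tensor1 stB stZ st1 rmorphM fmorphV.
rewrite !rmorph_nat tensor_sumr st_sum; congr (_ - _).
by apply: eq_bigr => j _; apply: st_number.
Qed.
Lemma st_Z1 : st (Z1 D) = Z1 D.
Proof.
have e : Z1 D = 2 *: Z2 D - (2 *: Z2 D - Z1 D) by rewrite opprB addrC subrK.
by rewrite {1}e stB stZ st_Z2 st_Z conj2 -e.
Qed.

Local Notation W :=
  (unit21 (Fp D) (Fm D) (Fbp D) (Fbm D) (Ep D) (Em D) (Hh D) (Z1 D) (Z2 D)).
Let d (i : 'I_3) : C := (-1) ^+ (i == 1%N :> nat).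

Lemma st_unit21 i j : st (W i j) = (d i * d j) *: W j i.
Proof.
have c2 : (2^-1 : C)^* = 2^-1 by rewrite fmorphV rmorph_nat.
have cp : ((pscale R)^-1)^* = ((pscale R)^*)^-1 by rewrite fmorphV.
have cp' : (((pscale R)^*)^-1)^* = (pscale R)^-1 by rewrite fmorphV /= conjCK.
case: i => [[|[|[|i]]] hi] //=; case: j => [[|[|[|j]]] hj] //=;
  rewrite /unit21 /d /= ?expr0 ?expr1 ?mul1r ?mulr1 ?mulrNN ?mulr1 ?scale1r.
- by rewrite stZ c2 stD st_H st_Z1.
- by rewrite st_Ep scaleN1r.
- by rewrite stZ cp st_Fp.
- by rewrite st_Em scaleN1r.
- by rewrite stZ c2 stB st_H st_Z1.
- by rewrite stZ rmorphN /= cp st_Fm scaleN1r scaleNr.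
- by rewrite stZ cp' st_Fbm.
- by rewrite stZ cp' st_Fbp scaleN1r scaleNr opprK.
- by rewrite stN st_Z2.
Qed.

Lemma st_mx_eval X : mx_eval W (u21_star X) = st (mx_eval W X).
Proof.
rewrite /mx_eval st_sum.
rewrite (reindex_inj (h := fun u : 'I_3 * 'I_3 => (u.2, u.1))) /=; last first.
  by move=> [a b] [a' b'] /= [-> ->].
apply: eq_bigr => -[a b] _ /=; rewrite mxE stZ st_unit21 scalerA -/(d a) -/(d b).
by congr (_ *: _); rewrite [RHS]mulrC mulrAC [d a * _]mulrC.
Qed.
End Star.

(** * Representations of presented algebras *)

Section Action.
Variables (k : comNzRingType) (X : Type) (rel : term k X -> term k X -> Prop).
Variables (V : lmodType k) (f : X -> V -> V).

Fixpoint act_term (t : term k X) (v : V) : V :=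
  match t with
  | Gen x => f x v
  | Zero => 0
  | One => v
  | Add s t => act_term s v + act_term t v
  | Mul s t => act_term s (act_term t v)
  | Scale a t => a *: act_term t v
  end.

(** An algebra given by generators and relations acts on [V] as soon as its
    generators act by linear maps that satisfy the relations. *)
Definition pres_act (u : pres rel) : V -> V := act_term (generic_quotient.repr u).

Hypothesis f_lin : forall x, linear (f x).
Hypothesis f_rel : forall s t, rel s t -> act_term s =1 act_term t.

Let act_term_lin t : linear (act_term t).
Proof.
elim: t => [x|||s hs t ht|s hs t ht|b t ht] a u v /=.
- exact: f_lin.
- by rewrite scaler0 addr0.
- by [].
- by rewrite hs ht scalerDr addrACA.
- by rewrite ht hs.
- by rewrite ht scalerDr !scalerA mulrC.
Qed.

Let act_cong s t : cong rel s t -> act_term s =1 act_term t.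
Proof.
have lin0 t' : act_term t' 0 = 0.
  apply: (addrI (act_term t' 0)); rewrite addr0.
  by have := act_term_lin t' 1 0 0; rewrite !scale1r addr0.
have linD t' u v : act_term t' (u + v) = act_term t' u + act_term t' v.
  by have := act_term_lin t' 1 u v; rewrite !scale1r.
have linZ t' a u : act_term t' (a *: u) = a *: act_term t' u.
  by have := act_term_lin t' a u 0; rewrite lin0 !addr0.
elim=> {s t}.
- exact: f_rel.
- by [].
- by move=> s t _ h v; rewrite h.
- by move=> s t u _ h1 _ h2 v; rewrite h1 h2.
- by move=> s s' t t' _ h1 _ h2 v /=; rewrite h1 h2.
- by move=> s s' t t' _ h1 _ h2 v /=; rewrite h2 h1.
- by move=> a t t' _ h v /=; rewrite h.
- by move=> s t u v /=; rewrite addrA.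
- by move=> s t v /=; rewrite addrC.
- by move=> t v /=; rewrite add0r.
- by move=> t v /=; rewrite scaleN1r addNr.
- by [].
- by [].
- by [].
- by [].
- by move=> s t u v /=; rewrite linD.
- by move=> a b t v /=; rewrite scalerA.
- by move=> t v /=; rewrite scale1r.
- by move=> a s t v /=; rewrite scalerDr.
- by move=> a b t v /=; rewrite scalerDl.
- by [].
- by move=> a s t v /=; rewrite linZ.
Qed.

Let actE t : pres_act (pclass rel t) =1 act_term t.
Proof. by apply: act_cong; apply: cong_repr. Qed.

Lemma pres_act_gen x : pres_act (pgen rel x) =1 f x.
Proof. exact: actE. Qed.
Lemma pres_act_lin u : linear (pres_act u).
Proof. exact: act_term_lin. Qed.
Lemma pres_act1 v : pres_act 1 v = v.
Proof. by rewrite -(pclass1E rel) actE. Qed.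
Lemma pres_actM u w v : pres_act (u * w) v = pres_act u (pres_act w v).
Proof. by elim/pclass_ind: u => s; elim/pclass_ind: w => t; rewrite -pclassME !actE. Qed.
Lemma pres_actD u w v : pres_act (u + w) v = pres_act u v + pres_act w v.
Proof. by elim/pclass_ind: u => s; elim/pclass_ind: w => t; rewrite -pclassDE !actE. Qed.
Lemma pres_actZ a u v : pres_act (a *: u) v = a *: pres_act u v.
Proof. by elim/pclass_ind: u => s; rewrite -pclassZE !actE. Qed.
Lemma pres_act0 v : pres_act 0 v = 0.
Proof. by rewrite -(pclass0E rel) actE. Qed.
Lemma pres_actN u v : pres_act (- u) v = - pres_act u v.
Proof. by rewrite -scaleN1r pres_actZ scaleN1r. Qed.
Lemma pres_actB u w v : pres_act (u - w) v = pres_act u v - pres_act w v.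
Proof. by rewrite pres_actD pres_actN. Qed.
Lemma pres_act_sum (I : finType) (P : pred I) (F : I -> pres rel) v :
  pres_act (\sum_(i | P i) F i) v = \sum_(i | P i) pres_act (F i) v.
Proof. by apply: (big_morph (pres_act^~ v)) => [u w|]; rewrite ?pres_actD ?pres_act0. Qed.
Lemma pres_act_v0 u : pres_act u 0 = 0.
Proof.
apply: (addrI (pres_act u 0)); rewrite addr0.
by have := pres_act_lin u 1 0 0; rewrite !scale1r addr0.
Qed.

End Action.

(** * Polynomials on E with coefficients in K *)

Section Poly.
Variables (R : realType) (E : vectType R) (K : comAlgType R[i]).
Local Notation C := R[i].
Local Notation "r %:c" := (real_complex R r) (at level 2, format "r %:c").

(** Polynomials are given by generators and relations in their turn, without
    coordinates: operators on them are then obtained from [pres_act]. *)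
Inductive polgen := PK of K | PX of dual E.

Inductive pol_rel : term C polgen -> term C polgen -> Prop :=
  | pol_K_lin a k l :
      pol_rel (Gen (PK (a *: k + l))) (a *: Gen (PK k) + Gen (PK l))%W
  | pol_K_mul k l : pol_rel (Gen (PK (k * l))) (Gen (PK k) * Gen (PK l))%W
  | pol_K_one : pol_rel (Gen (PK 1)) 1%W
  | pol_X_lin (a : R) x y :
      pol_rel (Gen (PX (a *: x + y))) (a%:c *: Gen (PX x) + Gen (PX y))%W
  | pol_comm g h : pol_rel (Gen g * Gen h)%W (Gen h * Gen g)%W.

Definition Pol : Type := pres pol_rel.
HB.instance Definition _ := GRing.PzRing.on Pol.
HB.instance Definition _ := GRing.Lmodule.on Pol.

Definition pK (a : K) : Pol := pgen pol_rel (PK a).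
Definition pX (x : dual E) : Pol := pgen pol_rel (PX x).

Lemma pol_mulC (p q : Pol) : p * q = q * p.
Proof.
have gen g (r : Pol) : pgen pol_rel g * r = r * pgen pol_rel g.
  elim/pclass_ind: r; elim=> [h|||s hs t ht|s hs t ht|a t ht].
  - by have := prelP (pol_comm g h); rewrite !pclassE.
  - by rewrite pclass0E mulr0 mul0r.
  - by rewrite pclass1E mulr1 mul1r.
  - by rewrite pclassDE mulrDr mulrDl hs ht.
  - by rewrite pclassME mulrA hs -mulrA ht mulrA.
  - by rewrite pclassZE -pres_scalerAr ht pres_scalerAl.
elim/pclass_ind: p; elim=> [h|||s hs t ht|s hs t ht|a t ht].
- exact: gen.
- by rewrite pclass0E mulr0 mul0r.
- by rewrite pclass1E mulr1 mul1r.
- by rewrite pclassDE mulrDr mulrDl hs ht.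
- by rewrite pclassME -mulrA ht mulrA hs mulrA.
- by rewrite pclassZE -pres_scalerAl ht pres_scalerAr.
Qed.

Lemma pol_mulCA (p q r : Pol) : p * (q * r) = q * (p * r).
Proof. by rewrite mulrA [p * q]pol_mulC mulrA. Qed.

Lemma pK_lin a k l : pK (a *: k + l) = a *: pK k + pK l.
Proof. by have := prelP (pol_K_lin a k l); rewrite !pclassE. Qed.
Lemma pKM k l : pK (k * l) = pK k * pK l.
Proof. by have := prelP (pol_K_mul k l); rewrite !pclassE. Qed.
Lemma pK1 : pK 1 = 1.
Proof. by have := prelP pol_K_one; rewrite !pclassE. Qed.
Lemma pX_lin (a : R) x y : pX (a *: x + y) = a%:c *: pX x + pX y.
Proof. by have := prelP (pol_X_lin a x y); rewrite !pclassE. Qed.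

(** Polynomials are spanned by the products of generators. *)
Lemma pol_ind (P : Pol -> Prop) :
  P 1 -> (forall a p q, P p -> P q -> P (a *: p + q)) ->
  (forall k p, P p -> P (pK k * p)) -> (forall x p, P p -> P (pX x * p)) ->
  forall p, P p.
Proof.
move=> h1 hlin hK hX; have h0 : P 0 by have := hlin (-1) _ _ h1 h1; rewrite scaleN1r addNr.
suff h (p : Pol) : forall q, P q -> P (p * q) by move=> p; rewrite -[p]mulr1; apply: h.
elim/pclass_ind: p; elim=> [[k|x]|||s hs t ht|s hs t ht|a t ht] q hq.
- exact: hK.
- exact: hX.
- by rewrite pclass0E mul0r.
- by rewrite pclass1E mul1r.
- by rewrite pclassDE mulrDl -[_ * q]scale1r; apply: hlin; [apply: hs|apply: ht].
- by rewrite pclassME -mulrA; apply: hs; apply: ht.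
- rewrite pclassZE -pres_scalerAl -[_ *: _]addr0; apply: hlin => //.
  exact: ht.
Qed.
End Poly.

(** * Dunkl operators *)

Section DunklRepresentation.
Import Defs.
Variables (R : realType) (n : nat) (E : vectType R) (gT : finGroupType).
Variables (K : comAlgType R[i]) (D : setting n E gT K).
Local Notation C := R[i].
Local Notation S := (reflections (rho D)).
Local Notation B := (form D).
Local Notation al := (alpha D).
Local Notation "r %:c" := (real_complex R r) (at level 2, format "r %:c").
Local Notation Pol := (Pol E K).
Local Notation pX := (pX K).
Local Notation pK := (pK E).
Local Notation "g .* x" := (dual_act (rho D) g x) (at level 40).
Local Notation coef := (cherednik_coef D).

Lemma dual_act1 x : 1%g .* x = x.
Proof. by apply: dualP => v; rewrite pair_dual_act invg1 rho1 id_lfunE. Qed.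
Lemma dual_actM g h x : (g * h)%g .* x = g .* (h .* x).
Proof. by apply: dualP => v; rewrite !pair_dual_act invMg rhoM comp_lfunE. Qed.
Lemma dual_act_lin g (a : R) x y : g .* (a *: x + y) = a *: (g .* x) + g .* y.
Proof. by apply: dualP => v; rewrite pair_lin !pair_dual_act pair_lin. Qed.

Definition pol_act_gen g (h : polgen E K) (p : Pol) : Pol :=
  match h with PK k => pK k * p | PX x => pX (g .* x) * p end.
(** The algebra map that substitutes [g .* x] for [x], as the orbit map of 1. *)
Definition pol_act g (p : Pol) : Pol := pres_act (pol_act_gen g) p 1.

Let mul_lin (u : Pol) : linear (fun p : Pol => u * p).
Proof. by move=> a p q; rewrite mulrDr -pres_scalerAr. Qed.

Let pol_act_gen_lin g h : linear (pol_act_gen g h).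
Proof. by case: h => [k|x]; apply: mul_lin. Qed.

Let pol_act_gen_rel g s t : pol_rel s t ->
  act_term (pol_act_gen g) s =1 act_term (pol_act_gen g) t.
Proof.
case=> {s t} [a k l|k l||a x y|h1 h2] p /=.
- by rewrite pK_lin mulrDl -pres_scalerAl.
- by rewrite pKM mulrA.
- by rewrite pK1 mul1r.
- by rewrite dual_act_lin pX_lin mulrDl -pres_scalerAl.
- by case: h1 => ?; case: h2 => ? /=; apply: pol_mulCA.
Qed.

Let aM g := pres_actM (pol_act_gen_lin g) (pol_act_gen_rel g).
Let aD g := pres_actD (pol_act_gen_lin g) (pol_act_gen_rel g).
Let aZ g := pres_actZ (pol_act_gen_lin g) (pol_act_gen_rel g).
Let agen g := pres_act_gen (pol_act_gen_lin g) (pol_act_gen_rel g).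

Lemma pol_actK g k p : pol_act g (pK k * p) = pK k * pol_act g p.
Proof. by rewrite /pol_act aM agen. Qed.
Lemma pol_actX g x p : pol_act g (pX x * p) = pX (g .* x) * pol_act g p.
Proof. by rewrite /pol_act aM agen. Qed.
Lemma pol_act_1 g : pol_act g 1 = 1.
Proof. exact: (pres_act1 (pol_act_gen_lin g) (pol_act_gen_rel g)). Qed.
Lemma pol_act_lin g : linear (pol_act g).
Proof.
by move=> a p q; rewrite /pol_act aD aZ.
Qed.
Lemma pol_act1 p : pol_act 1%g p = p.
Proof.
elim/pol_ind: p => [|a p q hp hq|k p hp|x p hp].
- exact: pol_act_1.
- by rewrite pol_act_lin hp hq.
- by rewrite pol_actK hp.
- by rewrite pol_actX hp dual_act1.
Qed.
Lemma pol_actM g h p : pol_act (g * h)%g p = pol_act g (pol_act h p).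
Proof.
elim/pol_ind: p => [|a p q hp hq|k p hp|x p hp].
- by rewrite !pol_act_1.
- by rewrite !pol_act_lin hp hq.
- by rewrite !pol_actK hp.
- by rewrite !pol_actX hp dual_actM.
Qed.

(** The failure of the Dunkl operator of [v] to commute with the
    multiplication by [x], as a function of the images [w] of the argument
    under the group. *)
Definition dunkl_corr v x (w : {ffun gT -> Pol}) : Pol :=
  (pair x v)%:c *: w 1%g - \sum_(s in S) coef x v s *: (pK (c D s) * w s).

(** The operator of [v] obeys a Leibniz rule twisted by the group, so that it
    is a matrix coefficient of an action of the polynomials on pairs; the second
    component keeps track of the images under the group. *)
Definition dunkl_gen v (h : polgen E K) (u : Pol * {ffun gT -> Pol}) :
    Pol * {ffun gT -> Pol} :=
  match h with
  | PK k => (pK k * u.1, [ffun g => pK k * u.2 g])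
  | PX x => (pX x * u.1 + dunkl_corr v x u.2, [ffun g => pX (g .* x) * u.2 g])
  end.
Definition dunkl v (p : Pol) : Pol := (pres_act (dunkl_gen v) p (0, [ffun=> 1])).1.

Let dunkl_corr_lin v x : linear (dunkl_corr v x).
Proof.
move=> a w w'; rewrite /dunkl_corr !ffunE.
under eq_bigr => s _ do rewrite !ffunE mul_lin scalerDr scalerA mulrC -scalerA.
rewrite big_split /= -scaler_sumr scalerDr scalerA mulrC -scalerA.
by rewrite opprD addrACA -scalerBr.
Qed.

Let dunkl_corr_linx v w (a : R) x y :
  dunkl_corr v (a *: x + y) w = a%:c *: dunkl_corr v x w + dunkl_corr v y w.
Proof.
rewrite /dunkl_corr pair_lin rmorphD rmorphM scalerDl -scalerA scalerBr addrACA.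
congr (_ + _); rewrite scaler_sumr -opprD -big_split /=; congr (- _).
apply: eq_bigr => s _; rewrite scalerA -scalerDl; congr (_ *: _).
by rewrite /cherednik_coef pair_lin -!rmorphM -rmorphD; congr _%:c; ring.
Qed.

Let dunkl_corrM v x p (w : {ffun gT -> Pol}) :
  dunkl_corr v x [ffun g => p * w g] = p * dunkl_corr v x w.
Proof.
rewrite /dunkl_corr ffunE mulrBr -pres_scalerAr mulr_sumr; congr (_ - _).
by apply: eq_bigr => s _; rewrite ffunE pol_mulCA -pres_scalerAr.
Qed.

Let dunkl_gen_lin v h : linear (dunkl_gen v h).
Proof.
case: h => [k|x] a [u w] [u' w'] /=.
  congr (_, _); first exact: mul_lin.
  by apply/ffunP => g; rewrite !ffunE mul_lin.
congr (_, _); last by apply/ffunP => g; rewrite !ffunE mul_lin.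
by rewrite mul_lin dunkl_corr_lin addrACA -scalerDr.
Qed.

(** [s .* y] differs from [y] by a multiple of [alphav D s], and the coefficients
    of [pX (alphav D s)] that result are symmetric in [x] and [y]. *)
Let coef_sym x y v s : s \in S ->
  coef y v s *: pX x + coef x v s *: pX (s .* y) =
  coef x v s *: pX y + coef y v s *: pX (s .* x).
Proof.
move=> sS; rewrite !dual_act_reflection //.
have pXB z (a : R) : pX (z - a *: alphav D s) = pX z - a%:c *: pX (alphav D s).
  by rewrite addrC -scaleNr pX_lin rmorphN addrC scaleNr.
rewrite !pXB !scalerBr !scalerA /cherednik_coef -!rmorphM [LHS]addrCA.
by congr (_ + (_ - _%:c *: _)); ring.
Qed.

Let dunkl_corr_sym v x y (w : {ffun gT -> Pol}) :
  pX x * dunkl_corr v y w + dunkl_corr v x [ffun g => pX (g .* y) * w g] =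
  pX y * dunkl_corr v x w + dunkl_corr v y [ffun g => pX (g .* x) * w g].
Proof.
rewrite /dunkl_corr !ffunE !mulrBr -!pres_scalerAr !dual_act1.
rewrite addrACA [RHS]addrACA; congr (_ + _); first exact: addrC.
rewrite -!opprD; congr (- _); rewrite !mulr_sumr -!big_split /=.
apply: eq_bigr => s sS; rewrite !ffunE -!pres_scalerAr.
rewrite ![pK _ * (pX _ * _)]pol_mulCA !pres_scalerAl -!mulrDl.
by rewrite coef_sym.
Qed.

Let dunkl_gen_rel v s t : pol_rel s t ->
  act_term (dunkl_gen v) s =1 act_term (dunkl_gen v) t.
Proof.
case=> {s t} [a k l|k l||a x y|h1 h2] [u w] /=.
- congr (_, _); first by rewrite pK_lin mulrDl -pres_scalerAl.
  by apply/ffunP => g; rewrite !ffunE pK_lin mulrDl -pres_scalerAl.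
- congr (_, _); first by rewrite pKM mulrA.
  by apply/ffunP => g; rewrite !ffunE pKM mulrA.
- congr (_, _); first by rewrite pK1 mul1r.
  by apply/ffunP => g; rewrite !ffunE pK1 mul1r.
- congr (_, _); last first.
    by apply/ffunP => g; rewrite !ffunE dual_act_lin pX_lin mulrDl -pres_scalerAl.
  by rewrite pX_lin mulrDl -pres_scalerAl dunkl_corr_linx addrACA -scalerDr.
- case: h1 => [k|x]; case: h2 => [l|y] /=; (congr (_, _); last first;
    [by apply/ffunP => g; rewrite !ffunE; apply: pol_mulCA|]).
  + exact: pol_mulCA.
  + by rewrite dunkl_corrM [X in _ = X + _]pol_mulCA -mulrDr.
  + by rewrite dunkl_corrM [X in X + _ = _]pol_mulCA -mulrDr.
  + rewrite (mulrDr (pX x) (pX y * u)) (mulrDr (pX y) (pX x * u)) -!addrA.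
    by rewrite dunkl_corr_sym [pX x * (pX y * u)]pol_mulCA.
Qed.

Let dM v := pres_actM (dunkl_gen_lin v) (@dunkl_gen_rel v).
Let dD v := pres_actD (dunkl_gen_lin v) (@dunkl_gen_rel v).
Let dZ v := pres_actZ (dunkl_gen_lin v) (@dunkl_gen_rel v).
Let d1 v := pres_act1 (dunkl_gen_lin v) (@dunkl_gen_rel v).
Let dgen v := pres_act_gen (dunkl_gen_lin v) (@dunkl_gen_rel v).

Let dunkl_pol_act v p g : (pres_act (dunkl_gen v) p (0, [ffun=> 1])).2 g = pol_act g p.
Proof.
elim/pol_ind: p => [|a p q hp hq|k p hp|x p hp].
- by rewrite d1 pol_act_1 /= ffunE.
- by rewrite dD dZ pol_act_lin -hp -hq /= !ffunE.
- by rewrite dM dgen pol_actK -hp /= ffunE.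
- by rewrite dM dgen pol_actX -hp /= ffunE.
Qed.

Lemma dunkl1 v : dunkl v 1 = 0.
Proof. by rewrite /dunkl d1. Qed.
Lemma dunkl_lin v : linear (dunkl v).
Proof. by move=> a p q; rewrite /dunkl dD dZ. Qed.
Lemma dunklK v k p : dunkl v (pK k * p) = pK k * dunkl v p.
Proof. by rewrite /dunkl dM dgen. Qed.
Lemma dunklX v x p : dunkl v (pX x * p) = pX x * dunkl v p +
  ((pair x v)%:c *: p - \sum_(s in S) coef x v s *: (pK (c D s) * pol_act s p)).
Proof.
rewrite /dunkl dM dgen /= /dunkl_corr dunkl_pol_act pol_act1; congr (_ + (_ - _)).
by apply: eq_bigr => s _; rewrite dunkl_pol_act.
Qed.
End DunklRepresentation.

(** * The polynomial representation *)

Section PolynomialRepresentation.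
Import Defs.
Variables (R : realType) (n : nat) (E : vectType R) (gT : finGroupType).
Variables (K : comAlgType R[i]) (D : setting n E gT K).
Local Notation C := R[i].
Local Notation S := (reflections (rho D)).
Local Notation B := (form D).
Local Notation al := (alpha D).
Local Notation "r %:c" := (real_complex R r) (at level 2, format "r %:c").
Local Notation Pol := (Pol E K).
Local Notation pX := (pX K).
Local Notation pK := (pK E).
Local Notation "g .* x" := (dual_act (rho D) g x) (at level 40).
Local Notation coef := (cherednik_coef D).
Local Notation pol_act := (pol_act D).
Local Notation dunkl := (dunkl D).

HB.instance Definition _ g :=
  GRing.isLinear.Build C Pol Pol *:%R (pol_act g) (@pol_act_lin _ _ _ _ _ D g).
HB.instance Definition _ v :=
  GRing.isLinear.Build C Pol Pol *:%R (dunkl v) (@dunkl_lin _ _ _ _ _ D v).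

Lemma reflection_conj s g : (s ^ g \in S)%g = (s \in S).
Proof.
rewrite !inE; congr (_.+1 == _).
have <- : (rho D g @: fixedSpace (rho D (s ^ g)%g))%VS = fixedSpace (rho D s).
  apply/vspaceP => v; apply/memv_imgP/fixedSpaceP => [[u /fixedSpaceP hu ->]|hv].
    by rewrite -{2}hu -!comp_lfunE -!rhoM conjgE !mulgA mulgV mul1g.
  exists (rho D g^-1%g v); last by rewrite rhoVK.
  apply/fixedSpaceP; rewrite -comp_lfunE -rhoM conjgE -mulgA mulgK !rhoM.
  by rewrite comp_lfunE hv.
rewrite limg_dim_eq //; apply/eqP; rewrite (_ : lker _ = 0%VS) ?capv0 //.
by apply/eqP/lker0P; apply: can_inj (rhoK D g).
Qed.

Lemma coef_conj x v s g : s \in S ->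
  coef (g .* x) (rho D g v) (s ^ g^-1)%g = coef x v s.
Proof.
move=> sS; rewrite !cherednik_coef_sub ?reflection_conj // !pair_dual_act.
by rewrite -!comp_lfunE -!rhoM conjgE invgK !mulgA mulVg mul1g mulgKV rho1 id_lfunE.
Qed.

Lemma coef_linr x (a : R) v w s : coef x (a *: v + w) s = a%:c * coef x v s + coef x w s.
Proof. by rewrite /cherednik_coef pair_linr -rmorphM -rmorphD; congr _%:c; ring. Qed.

Lemma dunkl_linl (a : R) v w p : dunkl (a *: v + w) p = a%:c *: dunkl v p + dunkl w p.
Proof.
elim/(@pol_ind R E K): p => [|b p q hp hq|k p hp|x p hp].
- by rewrite !dunkl1 scaler0 addr0.
- by rewrite !linearP /= hp hq !scalerDr !scalerA mulrC addrACA.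
- by rewrite !dunklK hp mulrDr -pres_scalerAr.
- rewrite !dunklX hp mulrDr -pres_scalerAr scalerDr [RHS]addrACA; congr (_ + _).
  rewrite pair_linr rmorphD rmorphM scalerDl -scalerA scalerBr addrACA.
  congr (_ + _); rewrite scaler_sumr -opprD -big_split /=; congr (- _).
  by apply: eq_bigr => s _; rewrite scalerA -scalerDl coef_linr.
Qed.

(** Conjugation by [g] permutes the reflections, with the same parameters. *)
Lemma pol_act_dunkl g v p : pol_act g (dunkl v p) = dunkl (rho D g v) (pol_act g p).
Proof.
elim/(@pol_ind R E K): p => [|b p q hp hq|k p hp|x p hp].
- by rewrite !(dunkl1, pol_act_1) linear0.
- by rewrite !linearP /= hp hq.
- by rewrite !(dunklK, pol_actK) hp.
rewrite dunklX !pol_actX dunklX linearD linearB linearZ /= pol_actX hp.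
congr (_ + (_ *: _ - _)); first by rewrite pair_dual_act rhoK.
rewrite linear_sum [RHS](reindex_inj (conjg_inj g^-1%g)) /=.
rewrite [RHS](eq_bigl _ _ (fun s => reflection_conj s g^-1%g)); apply: eq_bigr => s sS.
rewrite linearZ /= pol_actK coef_conj // cJ //.
by rewrite -!pol_actM; congr (_ *: (_ * pol_act _ _)); rewrite conjgE invgK !mulgA mulgKV.
Qed.

(** The commutator of two Dunkl operators kills 1; it commutes with the
    multiplication by [x], because moving a Dunkl operator past a reflection
    [s] changes it by a multiple of the operator of [al s]. *)
Lemma dunkl_comm v w p : dunkl v (dunkl w p) = dunkl w (dunkl v p).
Proof.
elim/(@pol_ind R E K): p => [|b p q hp hq|k p hp|x p hp].
- by rewrite !dunkl1 !linear0.
- by rewrite !linearP /= hp hq.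
- by rewrite !dunklK hp.
have e v' w' : dunkl v' (dunkl w' (pX x * p)) = pX x * dunkl v' (dunkl w' p) +
    ((pair x v')%:c *: dunkl w' p + (pair x w')%:c *: dunkl v' p) -
    \sum_(s in S) (coef x v' s *: (pK (c D s) * pol_act s (dunkl w' p))
                   + coef x w' s *: (pK (c D s) * dunkl v' (pol_act s p))).
  rewrite dunklX linearD linearB linearZ /= dunklX.
  have -> : dunkl v' (\sum_(s in S) coef x w' s *: (pK (c D s) * pol_act s p)) =
      \sum_(s in S) coef x w' s *: (pK (c D s) * dunkl v' (pol_act s p)).
    by rewrite linear_sum; apply: eq_bigr => s _; rewrite linearZ /= dunklK.
  by rewrite big_split /= -[LHS]addrA [X in _ + X = _]addrACA -opprD addrA.
rewrite !e hp [X in _ + X - _]addrC; congr (_ - _).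
apply: eq_bigr => s sS; rewrite !pol_act_dunkl !rho_reflection_alphav //.
have hB (u : E) (a : R) q : dunkl (u - a *: al s) q = dunkl u q - a%:c *: dunkl (al s) q.
  by rewrite addrC -scaleNr dunkl_linl rmorphN scaleNr addrC.
rewrite !hB !mulrBr !scalerBr -!pres_scalerAr !scalerA.
rewrite /cherednik_coef -!rmorphM -!addrA addrCA [RHS]addrC -!addrA.
by rewrite mulrAC.
Qed.

Definition hgen_act (h : hgen E gT K) (p : Pol) : Pol :=
  match h with
  | HK k => pK k * p
  | HE v => dunkl v p
  | HX x => pX x * p
  | HG g => pol_act g p
  end.

Lemma hgen_act_lin h : linear (hgen_act h).
Proof.
case: h => [k|v|x|g] a p q /=; last exact: linearP.
- by rewrite mulrDr -pres_scalerAr.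
- exact: linearP.
- by rewrite mulrDr -pres_scalerAr.
Qed.

Lemma hgen_act_rel s t : cherednik_rel D s t -> act_term hgen_act s =1 act_term hgen_act t.
Proof.
case=> {s t} [a k l|k l||k [l|v|x|g]|a v w|a x y||g h|g v|g x|v w|x y|v x] p /=.
- by rewrite pK_lin mulrDl -pres_scalerAl.
- by rewrite pKM mulrA.
- by rewrite pK1 mul1r.
- exact: pol_mulCA.
- by rewrite dunklK.
- exact: pol_mulCA.
- by rewrite pol_actK.
- exact: dunkl_linl.
- by rewrite pX_lin mulrDl -pres_scalerAl.
- exact: pol_act1.
- exact: pol_actM.
- exact: pol_act_dunkl.
- exact: pol_actX.
- by rewrite dunkl_comm scaleN1r subrr.
- by rewrite [pX x * _]pol_mulCA scaleN1r subrr.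
- rewrite dunklX !scaleN1r addrAC subrr add0r; congr (_ - _).
  rewrite (big_morph (fun t => act_term hgen_act t p) (id1 := 0) (op1 := +%R)) //.
Qed.

Definition pol_rep : Hc D -> Pol -> Pol := pres_act hgen_act.

End PolynomialRepresentation.

(** * Spinors *)

Section Fock.
Import Defs.
Variables (R : realType) (n : nat).
Local Notation C := R[i].
Local Notation f := (@clF R n).
Local Notation fd := (@clFd R n).
Implicit Types (A : {set 'I_n}) (j l : 'I_n).

Definition flip j A : {set 'I_n} := [set i | (i \in A) (+) (i == j)].
Definition jw_sign j A : C := \prod_(i < n | (i < j)%N) (-1) ^+ (i \in A).

Lemma flipK j A : flip j (flip j A) = A.
Proof. by apply/setP => i; rewrite !inE -addbA addbb addbF. Qed.
Lemma flipC j l A : flip j (flip l A) = flip l (flip j A).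
Proof. by apply/setP => i; rewrite !inE addbAC. Qed.

(** Only the factor of index [l] changes. *)
Lemma jw_sign_flip j l A : jw_sign j (flip l A) = (-1) ^+ (l < j)%N * jw_sign j A.
Proof.
rewrite /jw_sign; under eq_bigr => i _ do rewrite inE signr_addb.
rewrite big_split /= mulrC; congr (_ * _); have [lj|lj] := boolP (l < j)%N.
  rewrite (bigD1 l) //= eqxx big1 ?mulr1 // => i /andP[_ /negPf ->].
  by rewrite expr0.
rewrite big1 // => i ij; case: eqP => [il|//].
by rewrite -il ij in lj.
Qed.

Lemma jw_sign_sq j A : jw_sign j A * jw_sign j A = 1.
Proof.
rewrite /jw_sign -big_split big1 //= => i _.
by rewrite -expr2 sqrr_sign.
Qed.

(** The coefficient of the Clifford generator attached to [xi_j], or, if [b],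
    to [eta_j]; the sign is that of the Jordan-Wigner transformation. *)
Definition jw_coef (b : bool) j A : C :=
  (if b then 'i * (-1) ^+ (j \in A) else 1) * jw_sign j A.

Variable M : lmodType C.
Local Notation V := {ffun {set 'I_n} -> M}.

Definition clifford_op b j (phi : V) : V :=
  [ffun A => jw_coef b j A *: phi (flip j A)].

Definition clifford_gen (k : 'I_(n + n)) : V -> V :=
  match split k with inl j => clifford_op false j | inr j => clifford_op true j end.

Let clifford_op_anti b b' j l phi :
  clifford_op b j (clifford_op b' l phi) + clifford_op b' l (clifford_op b j phi) =
  (2 * ((b == b') && (j == l))%:R) *: phi.
Proof.
apply/ffunP => A; rewrite !ffunE !scalerA flipC -scalerDl.
have ii : 'i * 'i = -1 :> C by rewrite -expr2 sqrCi.
have [<-|jl] := eqVneq j l.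
  rewrite flipK andbT; congr (_ *: _); rewrite /jw_coef !jw_sign_flip ltnn !inE eqxx addbT.
  rewrite expr0 mul1r signrN; have h := jw_sign_sq j A.
  have := sqrr_sign C (j \in A); set e := (-1) ^+ _ => he.
  move: (jw_sign j A) h he ii => s h he ii.
  by case: b; case: b' => /=; [ring: h he ii|ring|ring|ring: h].
rewrite andbF mulr0 scale0r.
suff -> : jw_coef b j A * jw_coef b' l (flip j A) +
    jw_coef b' l A * jw_coef b j (flip l A) = 0 by rewrite scale0r.
have e b0 j0 l0 : j0 != l0 ->
    jw_coef b0 l0 (flip j0 A) = (-1) ^+ (j0 < l0)%N * jw_coef b0 l0 A.
  by move=> h; rewrite /jw_coef jw_sign_flip inE [l0 == _]eq_sym (negPf h) addbF mulrCA.
rewrite !e // 1?eq_sym //; case: (ltngtP j l) => [h|h|h].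
- by rewrite expr1 expr0 mul1r mulN1r mulrN mulrC addNr.
- by rewrite expr1 expr0 mul1r mulN1r mulrN mulrC subrr.
- by case/negP: jl; apply/eqP/val_inj.
Qed.

Lemma clifford_gen_lin k : linear (clifford_gen k).
Proof.
rewrite /clifford_gen; case: split => j a phi psi; apply/ffunP => A;
  by rewrite !ffunE scalerDr !scalerA mulrC.
Qed.

Lemma clifford_gen_rel s t : cliff_rel s t ->
  act_term clifford_gen s =1 act_term clifford_gen t.
Proof.
case=> {s t} j k phi /=; rewrite /clifford_gen.
case: (split_ordP j) => j' ->; case: (split_ordP k) => k' ->;
  rewrite ?(unsplitK (inl _)) ?(unsplitK (inr _)) clifford_op_anti /=.
- by rewrite eq_lshift.
- by rewrite eq_lrshift.
- by rewrite eq_rlshift.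
- by rewrite eq_rshift.
Qed.

Definition fock : Cl R n -> V -> V := pres_act clifford_gen.

Let fZ := pres_actZ clifford_gen_lin clifford_gen_rel.
Let fD := pres_actD clifford_gen_lin clifford_gen_rel.
Let fgen := pres_act_gen clifford_gen_lin clifford_gen_rel.
Let ii : 'i * 'i = -1 :> C. Proof. by rewrite -expr2 sqrCi. Qed.

Let fock_pair (eps : C) j (phi : V) A :
  fock (2^-1 *: (clE R (lshift n j) + eps *: clE R (rshift n j))) phi A =
  (2^-1 * (1 + eps * 'i * (-1) ^+ (j \in A)) * jw_sign j A) *: phi (flip j A).
Proof.
rewrite /fock fZ fD fZ !fgen /clifford_gen (unsplitK (inl j)) (unsplitK (inr j)).
rewrite !ffunE /jw_coef !scalerA -scalerDl scalerA; congr (_ *: _).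
by ring.
Qed.

Lemma fock_f j (phi : V) A : fock (f j) phi A =
  (if j \in A then 0 else jw_sign j A) *: phi (flip j A).
Proof.
rewrite /clF -scaleNr fock_pair mulNr ii opprK; congr (_ *: _).
case: (j \in A); rewrite ?expr0 ?expr1; first by rewrite mul1r subrr mulr0 mul0r.
by rewrite mulr1 mulVf ?mul1r ?(pnatr_eq0 _ 2).
Qed.

Lemma fock_fd j (phi : V) A : fock (fd j) phi A =
  (if j \in A then jw_sign j A else 0) *: phi (flip j A).
Proof.
rewrite /clFd fock_pair ii; congr (_ *: _).
case: (j \in A); rewrite ?expr0 ?expr1; last by rewrite mulr1 subrr mulr0 mul0r.
by rewrite mulrNN mul1r mulVf ?mul1r ?(pnatr_eq0 _ 2).
Qed.

(** The state killed by all [f j], with coefficient [p]. *)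
Definition vacuum (p : M) : V := [ffun A => if A == set0 then p else 0].

Lemma fock_f_vacuum j p : fock (f j) (vacuum p) = 0.
Proof.
apply/ffunP => A; rewrite fock_f !ffunE; case: ifPn => jA; first by rewrite scale0r.
case: eqP => [h|_]; last by rewrite scaler0.
by have := in_set0 j; rewrite -h inE (negPf jA) eqxx.
Qed.

Lemma fock_pointwise (L : M -> M) b (phi : V) : linear L ->
  fock b [ffun A => L (phi A)] = [ffun A => L (fock b phi A)].
Proof.
move=> hL; have L0 : L 0 = 0.
  by apply: (addrI (L 0)); have := hL 1 0 0; rewrite !scale1r !addr0.
have LD u v : L (u + v) = L u + L v by have := hL 1 u v; rewrite !scale1r.
have LZ a u : L (a *: u) = a *: L u by have := hL a u 0; rewrite L0 !addr0.
rewrite /fock /pres_act.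
elim: (generic_quotient.repr b) phi => [k|||s hs t ht|s hs t ht|a t ht] phi /=.
- rewrite /clifford_gen; case: split => j; apply/ffunP => A;
  by rewrite !ffunE LZ.
- by apply/ffunP => A; rewrite !ffunE L0.
- by [].
- by rewrite hs ht; apply/ffunP => A; rewrite !ffunE LD.
- by rewrite ht hs.
- by rewrite ht; apply/ffunP => A; rewrite !ffunE LZ.
Qed.
End Fock.

(** * The vacuum and faithfulness *)

Section TensorRepresentation.
Import Defs.
Variables (R : realType) (n : nat) (E : vectType R) (gT : finGroupType).
Variables (K : comAlgType R[i]) (D : setting n E gT K).
Local Notation C := R[i].
Local Notation S := (reflections (rho D)).
Local Notation al := (alpha D).
Local Notation "r %:c" := (real_complex R r) (at level 2, format "r %:c").
Local Notation Pol := (Pol E K).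
Local Notation pX := (pX K).
Local Notation pK := (pK E).
Local Notation V := {ffun {set 'I_n} -> Pol}.
Local Notation f := (@clF R n).
Local Notation fd := (@clFd R n).
Local Notation pol_rep := (pol_rep (D := D)).
Local Notation B := (form D).
Local Notation vac := (@vacuum R n Pol).

Let hlin := @hgen_act_lin _ _ _ _ _ D.
Let hrel := @hgen_act_rel _ _ _ _ _ D.

Let hpol_lin a : linear (pol_rep a).
Proof. exact: (pres_act_lin hlin). Qed.

Let fgl := @clifford_gen_lin R n Pol.
Let fgr := @clifford_gen_rel R n Pol.

Definition tensor_gen (ab : Hc D * Cl R n) (phi : V) : V :=
  fock ab.2 [ffun A => pol_rep ab.1 (phi A)].

Lemma tensor_gen_lin ab : linear (tensor_gen ab).
Proof.
move=> a phi psi; rewrite /tensor_gen.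
have -> : [ffun A => pol_rep ab.1 ((a *: phi + psi) A)] =
    a *: [ffun A => pol_rep ab.1 (phi A)] + [ffun A => pol_rep ab.1 (psi A)].
  by apply/ffunP => A; rewrite !ffunE hpol_lin.
exact: (pres_act_lin fgl).
Qed.

Lemma tensor_gen_rel s t :
  tens_rel s t -> act_term tensor_gen s =1 act_term tensor_gen t.
Proof.
case=> {s t} [x a a' b|x a b b'|a a' b b'|] phi /=; rewrite /tensor_gen /=.
- rewrite -(pres_act_lin fgl); congr (fock b _); apply/ffunP => A; rewrite !ffunE.
  by rewrite /pol_rep (pres_actD hlin hrel) (pres_actZ hlin hrel).
- by rewrite /fock (pres_actD fgl fgr) (pres_actZ fgl fgr).
- rewrite /fock (pres_actM fgl fgr); congr (pres_act _ _ _).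
  rewrite -[pres_act _ b' _]/(fock b' _) -fock_pointwise //; congr (fock _ _).
  by apply/ffunP => A; rewrite !ffunE /pol_rep (pres_actM hlin hrel).
- rewrite /fock (pres_act1 fgl fgr); apply/ffunP => A.
  by rewrite ffunE /pol_rep (pres_act1 hlin hrel).
Qed.

Definition spinor : HC D -> V -> V := pres_act tensor_gen.
Let spB := pres_actB tensor_gen_lin tensor_gen_rel.
Let sp0 := pres_act0 tensor_gen_lin tensor_gen_rel.
Let sp_sum := pres_act_sum tensor_gen_lin tensor_gen_rel.

Lemma spinor_vacuum a b p : spinor (a ⊗ b) (vac p) = fock b (vac (pol_rep a p)).
Proof.
rewrite /spinor /tensor (pres_act_gen tensor_gen_lin tensor_gen_rel) /tensor_gen /=.
congr (fock b _); apply/ffunP => A; rewrite !ffunE; case: ifP => // _.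
exact: (pres_act_v0 hlin).
Qed.

Let hB := pres_actB hlin hrel.
Let hD := pres_actD hlin hrel.
Let hZ := pres_actZ hlin hrel.
Let hM := pres_actM hlin hrel.
Let h0 := pres_act0 hlin hrel.
Let h_sum := pres_act_sum hlin hrel.
Let hgenE := pres_act_gen hlin hrel.

Let fock_tau_vacuum s p : fock (tau D s) (vac p) = vac p.
Proof.
have e : fock (alphad_v D s) (vac p) = 0.
  rewrite /alphad_v /fock (pres_actZ fgl fgr) (pres_act_sum fgl fgr).
  rewrite big1 ?scaler0 // => j _.
  by rewrite (pres_actZ fgl fgr) -/(fock _ _) fock_f_vacuum scaler0.
rewrite /tau /fock (pres_actB fgl fgr) (pres_act1 fgl fgr) (pres_actM fgl fgr).
rewrite -!/(fock _ _).
by rewrite e /fock (pres_act_v0 fgl) subr0.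
Qed.

Let fock_number_vacuum p :
  fock (2^-1 *: \sum_j comm (fd j) (f j)) (vac p) = - (n%:R / 2) *: vac p.
Proof.
rewrite half_sum_comm_fd_f /fock (pres_actB fgl fgr) (pres_act_sum fgl fgr) big1 => [|j _].
  by rewrite sub0r (pres_actZ fgl fgr) (pres_act1 fgl fgr) scaleNr.
by rewrite (pres_actM fgl fgr) -/(fock (f j) _) fock_f_vacuum (pres_act_v0 fgl).
Qed.

(** On the vacuum [tau s] acts as 1 and the number operator as 0. *)
Definition vacuum_Z : Hc D :=
  hZ0 D - \sum_(s in S) crefl D s + (n%:R / 2) *: (1 : Hc D).

Lemma spinor_Z_vacuum p :
  spinor (Z1 D - Z2 D) (vac p) = vac (pol_rep vacuum_Z p).
Proof.
have vZ a q : vac (a *: q) = a *: vac q :> V.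
  by apply/ffunP => A; rewrite !ffunE; case: ifP => // _; rewrite scaler0.
have vD q r : vac (q + r) = vac q + vac r :> V.
  by apply/ffunP => A; rewrite !ffunE; case: ifP => // _; rewrite addr0.
have v0 : vac 0 = 0 :> V by apply/ffunP => A; rewrite !ffunE if_same.
have vB q r : vac (q - r) = vac q - vac r :> V.
  by rewrite vD -scaleN1r vZ scaleN1r.
rewrite /vacuum_Z /pol_rep hD hB h_sum hZ (pres_act1 hlin hrel) vD vB vZ.
rewrite (big_morph vac vD v0).
rewrite {1}/spinor spB /Z1 spB -!/(spinor _ _) /Z2 !spinor_vacuum.
rewrite {1}/fock (pres_act1 fgl fgr) fock_number_vacuum /pol_rep (pres_act1 hlin hrel).
rewrite scaleNr opprK; congr (_ - _ + _).
rewrite /Omega /spinor sp_sum; apply: eq_bigr => s _.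
by rewrite -/(spinor _ _) spinor_vacuum fock_tau_vacuum.
Qed.

Section Evaluation.
Variable j0 : 'I_n.

(** Evaluation of polynomials at the complex vector [zetabar j0], where [zbar j0]
    takes the value 1 and the other complex coordinates vanish. *)
Definition ev_coef (x : dual E) : C :=
  2^-1 * ((pair x (xi D j0))%:c + 'i * (pair x (eta D j0))%:c).

Definition ev_gen (h : polgen E K) (k : K) : K :=
  match h with PK l => l * k | PX x => ev_coef x *: k end.

Lemma ev_gen_lin h : linear (ev_gen h).
Proof.
case: h => [l|x] a k k' /=; first by rewrite mulrDr -scalerAr.
by rewrite scalerDr !scalerA mulrC.
Qed.

Lemma ev_coef_lin (a : R) x y : ev_coef (a *: x + y) = a%:c * ev_coef x + ev_coef y.
Proof. by rewrite /ev_coef !pair_lin !rmorphD !rmorphM; ring. Qed.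

Lemma ev_gen_rel s t : pol_rel s t -> act_term ev_gen s =1 act_term ev_gen t.
Proof.
case=> {s t} [a k l|k l||a x y|[k|x] [l|y]] m /=.
- by rewrite mulrDl -scalerAl.
- by rewrite mulrA.
- by rewrite mul1r.
- by rewrite ev_coef_lin scalerDl scalerA.
- by rewrite mulrCA.
- by rewrite scalerAr.
- by rewrite scalerAr.
- by rewrite !scalerA mulrC.
Qed.

Definition ev (u : Hc D) : K := pres_act ev_gen (pol_rep u 1) 1.

Let eD := pres_actD ev_gen_lin ev_gen_rel.
Let eZ := pres_actZ ev_gen_lin ev_gen_rel.

Lemma evD u v : ev (u + v) = ev u + ev v.
Proof. by rewrite /ev /pol_rep hD eD. Qed.
Lemma evZ (a : C) u : ev (a *: u) = a *: ev u.
Proof. by rewrite /ev /pol_rep hZ eZ. Qed.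
Lemma evN u : ev (- u) = - ev u.
Proof. by rewrite -scaleN1r evZ scaleN1r. Qed.
Lemma ev0 : ev 0 = 0.
Proof. by rewrite -(scale0r (0 : Hc D)) evZ scale0r. Qed.
Lemma evB u v : ev (u - v) = ev u - ev v.
Proof. by rewrite evD evN. Qed.
Lemma ev_sum (I : finType) (P : pred I) (F : I -> Hc D) :
  ev (\sum_(i | P i) F i) = \sum_(i | P i) ev (F i).
Proof. by apply: (big_morph ev) => [u v|]; rewrite ?evD ?ev0. Qed.
Lemma ev1 : ev 1 = 1.
Proof. by rewrite /ev /pol_rep (pres_act1 hlin hrel) (pres_act1 ev_gen_lin ev_gen_rel). Qed.
Lemma ev_iX x u : ev (iX D x * u) = ev_coef x *: ev u.
Proof.
rewrite /ev /pol_rep hM hgenE /= (pres_actM ev_gen_lin ev_gen_rel).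
by rewrite (pres_act_gen ev_gen_lin ev_gen_rel).
Qed.
Lemma ev_crefl s : ev (crefl D s) = c D s.
Proof.
rewrite /ev /pol_rep hM !hgenE /= pol_act_1 (pres_actM ev_gen_lin ev_gen_rel).
by rewrite (pres_act_gen ev_gen_lin ev_gen_rel) /= (pres_act1 ev_gen_lin ev_gen_rel) mulr1.
Qed.

Let ii : 'i * 'i = -1 :> C. Proof. by rewrite -expr2 sqrCi. Qed.

Let ev_xx j : ev_coef (xx D j) = 2^-1 * (j == j0)%:R.
Proof. by rewrite /ev_coef xx_xi xx_eta rmorph0 mulr0 addr0 rmorph_nat. Qed.
Let ev_yy j : ev_coef (yy D j) = 2^-1 * ('i * (j == j0)%:R).
Proof. by rewrite /ev_coef yy_xi yy_eta rmorph0 add0r rmorph_nat. Qed.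

Lemma ev_zv j u : ev (zv D j * u) = 0.
Proof.
rewrite /zv mulrDl -pres_scalerAl evD evZ !ev_iX ev_xx ev_yy scalerA -scalerDl.
rewrite (_ : _ + _ = 0) ?scale0r //; move: ((j == j0)%:R) => e.
by ring: ii.
Qed.

Lemma ev_zbar j u : ev (zbar D j * u) = (j == j0)%:R *: ev u.
Proof.
rewrite /zbar mulrBl -pres_scalerAl evB evZ !ev_iX ev_xx ev_yy scalerA -scalerBl.
by congr (_ *: _); move: ((j == j0)%:R) => e; field: ii.
Qed.

Let comm_crefl_zbar s : s \in S -> comm (crefl D s) (zbar D j0) =
  - (pair_zbar D j0 (al s) *: (iX D (alphav D s) * crefl D s)).
Proof.
move=> sS; rewrite /zbar commBr commZr !comm_crefl_iX // scalerN opprK.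
by rewrite /pair_zbar scalerBl opprB addrC scalerA.
Qed.

Let ev_alphav s : s \in S -> ev_coef (alphav D s) = kappa D s * pair_z D j0 (al s).
Proof.
move=> sS; rewrite /ev_coef !pair_alphav // -xx_form -yy_form /kappa /pair_z.
have h : (B (al s) (al s))%:c != 0 by rewrite fmorph_eq0 form_alpha_neq0.
rewrite !rmorphM !fmorphV rmorph_nat.
by field.
Qed.

(** The reflection terms of the commutators with [hZ0] and with the sum of
    the [crefl s] cancel. *)
Lemma ev_comm_vacuum_Z : ev (comm vacuum_Z (zbar D j0)) = 1.
Proof.
have hS u : comm ((n%:R / 2) *: (1 : Hc D)) u = 0.
  by rewrite commZl /comm mul1r mulr1 subrr scaler0.
rewrite /vacuum_Z commDl hS addr0 commBl evB !comm_suml !ev_sum.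
have e j : ev (comm (zbar D j * zetabar D j - zv D j * zeta D j) (zbar D j0)) =
    (j == j0)%:R *: ev (comm (zetabar D j) (zbar D j0)).
  rewrite commBl !comm_mull comm_zbar_zbar comm_z_zbar !mul0r !addr0 evB.
  by rewrite ev_zv subr0 ev_zbar.
rewrite (eq_bigr _ (fun j _ => e j)) (bigD1 j0) //= eqxx scale1r big1; last first.
  by move=> j /negPf ->; rewrite scale0r.
rewrite addr0 comm_zetabar_zbar eqxx mulr1 scale1r evB ev1 ev_sum -addrA -opprD.
rewrite -big_split big1 ?subr0 // => s sS /=.
rewrite evZ ev_crefl comm_crefl_zbar // evN evZ ev_iX ev_alphav // ev_crefl scalerA.
by rewrite mulrCA subrr.
Qed.

End Evaluation.

(** The image of the vacuum under [Fp] has component [zbar j0], up to sign, at the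
    singleton of [j0]. *)
Lemma Fp_neq0 : (0 < n)%N -> Fp D != 0.
Proof.
move=> n0; pose j0 := Ordinal n0; apply/eqP => h.
have : spinor (Fp D) (vac 1) [set j0] = jw_sign R j0 [set j0] *: pol_rep (zbar D j0) 1.
  rewrite /Fp /spinor sp_sum sum_ffunE (bigD1 j0) //= big1 => [|j jj0].
    rewrite -/(spinor _ _) spinor_vacuum fock_fd set11 ffunE addr0.
    suff -> : flip j0 [set j0] = set0 by rewrite eqxx.
    by apply/setP => i; rewrite !inE addbb.
  by rewrite -/(spinor _ _) spinor_vacuum fock_fd inE (negPf jj0) scale0r.
rewrite h /spinor sp0 ffunE => e; have /eqP := oner_neq0 K; case.
rewrite -(ev1 j0) -[ev j0 1]scale1r -[X in X *: _]/((true)%:R) -(eqxx j0) -ev_zbar mulr1.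
have e0 : pol_rep (zbar D j0) 1 = 0.
  by rewrite -[LHS]scale1r -(jw_sign_sq R j0 [set j0]) -scalerA -e scaler0.
by rewrite /ev e0 (pres_act0 (ev_gen_lin j0) (@ev_gen_rel j0)).
Qed.

Lemma Z1_neq_Z2 : (0 < n)%N -> Z1 D - Z2 D != 0.
Proof.
move=> n0; pose j0 := Ordinal n0; apply/eqP => h.
have z p : pol_rep vacuum_Z p = 0.
  have := spinor_Z_vacuum p; rewrite h /spinor sp0 => /ffunP/(_ set0).
  by rewrite !ffunE eqxx.
have /eqP := oner_neq0 K; case.
rewrite -(ev_comm_vacuum_Z j0) /ev /comm /pol_rep hB !hM -!/(pol_rep _ _) !z.
by rewrite /pol_rep (pres_act_v0 hlin) subrr (pres_act0 (ev_gen_lin j0) (@ev_gen_rel j0)).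
Qed.
End TensorRepresentation.

(** * The realisation of gl(2|1) *)

Section Image.
Import Defs.
Variables (R : realType) (n : nat) (E : vectType R) (gT : finGroupType).
Variables (K : comAlgType R[i]) (D : setting n E gT K).
Local Notation W :=
  (unit21 (Fp D) (Fm D) (Fbp D) (Fbm D) (Ep D) (Em D) (Hh D) (Z1 D) (Z2 D)).

Lemma hc_homog_mx_eval p X : gl21_homog p X -> hc_homog p (mx_eval W X : HC D).
Proof.
move=> hX; rewrite /mx_eval; apply: hc_homog_sum => -[i j] _ /=.
have [h|h] := eqVneq (gl21_par i (+) gl21_par j) p.
  by apply: hc_homogZ; rewrite -h; apply: hc_homog_unit21.
by rewrite hX // scale0r; apply: hc_homog0.
Qed.

Lemma mx_eval_unit21_inj : (0 < n)%N -> injective (mx_eval W).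
Proof.
move=> n0; apply: mx_eval_inj; first exact: (unit21_bracket (odd_relations_cherednik D)).
  rewrite /unit21 /= scaler_eq0 invr_eq0 (negPf (pscale_neq0 R)).
  exact: Fp_neq0.
by rewrite mx_eval1_unit21; apply: Z1_neq_Z2.
Qed.
End Image.

Theorem theorem5p4 (R : realType) (n : nat) (E : vectType R)
    (gT : finGroupType) (K : comAlgType R[i]) (D : setting n E gT K) :
  let Ep := Ep D in let Em := Em D in let H := Hh D in
  let Z1 := Z1 D in let Z2 := Z2 D in let Z := Zz D in
  let Fp := Fp D in let Fm := Fm D in
  let Fbp := Fbp D in let Fbm := Fbm D in
  (* the realisation of gl(2|1) *)
  (exists phi : {linear 'M[R[i]]_3 -> HC D},
    [/\ (* phi is a morphism of Lie superalgebras *)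
        (forall p X, gl21_homog p X -> hc_homog p (phi X)),
        (forall p q X Y, gl21_homog p X -> gl21_homog q Y ->
           phi (sbracket p q X Y) = sbracket p q (phi X) (phi Y)),
        (* and an embedding *)
        ((0 < n)%N -> injective phi) &
    [/\ (* odd part, even part, and centre of the image *)
        (forall u, (exists2 X, gl21_homog true X & phi X = u) <->
           exists a b c d, u = a *: Fp + b *: Fbp + c *: Fm + d *: Fbm),
        (forall u, (exists2 X, gl21_homog false X & phi X = u) <->
           exists a b c d e,
             u = a *: Ep + b *: Em + c *: H + d *: Z1 + e *: Z2),
        (forall X, comm (Z1 - Z2) (phi X) = 0),
        (* the odd elements generate the image of sl(2|1), and together with
           the central element Z1 - Z2 the whole image *)
        (forall p u,
           lie_gen (fun q v => q = true /\
                               [\/ v = Fp, v = Fbp, v = Fm | v = Fbm]) p u <->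
           exists X, [/\ gl21_homog p X, gl21_str X = 0 & phi X = u]) &
    [/\ (forall p u,
           lie_gen (fun q v => (q = true /\
                                [\/ v = Fp, v = Fbp, v = Fm | v = Fbm]) \/
                               (q = false /\ v = Z1 - Z2)) p u <->
           exists2 X, gl21_homog p X & phi X = u) &
        (* phi intertwines the *-operations, that of u(2|1) on the left *)
        (forall stH stC st, is_star stH stC st ->
           forall X, phi (u21_star X) = st (phi X))]]])
  /\ (* second expression of Z2 *)
     Z2 = (1 : Hc D) ⊗ (\sum_j clFd R j * clF R j - (n%:R / 2) *: (1 : Cl R n))
  /\ (* relations between even elements *)
     [/\ comm H Ep = 2 *: Ep, comm H Em = - 2 *: Em, comm Ep Em = H &
      [/\ comm Z H = 0, comm Z Ep = 0 & comm Z Em = 0]]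
  /\ (* relations between odd elements *)
     [/\ acomm Fp Fp = 0, acomm Fm Fm = 0,
         acomm Fbp Fbp = 0, acomm Fbm Fbm = 0 &
      [/\ acomm Fp Fbp = 2 *: Ep, acomm Fm Fbm = - 2 *: Em,
          acomm Fp Fm = 0, acomm Fbp Fbm = 0 &
      [/\ acomm Fp Fbm = H - Z & acomm Fm Fbp = H + Z]]]
  /\ (* relations between even and odd elements *)
     [/\ comm Ep Fm = - Fp, comm Em Fp = - Fm,
         comm Ep Fbm = - Fbp, comm Em Fbp = - Fbm &
      [/\ comm Ep Fp = 0, comm Em Fm = 0, comm Ep Fbp = 0 & comm Em Fbm = 0]]
  /\ [/\ comm H Fp = Fp, comm H Fm = - Fm, comm H Fbp = Fbp & comm H Fbm = - Fbm]
  /\ [/\ comm Z Fp = Fp, comm Z Fm = Fm, comm Z Fbp = - Fbp & comm Z Fbm = - Fbm]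
  /\ (* *-relations *)
     (forall stH stC st, is_star stH stC st ->
        [/\ st Fp = Fbm, st Fm = Fbp, st Fbp = Fm, st Fbm = Fp &
         [/\ st Ep = - Em, st Em = - Ep, st H = H, st Z1 = Z1 & st Z2 = Z2]]).

Proof.
have odd := odd_relations_cherednik D.
cbv zeta; split; last split; last split; last split; last split; last split; last split.
- exists (mx_eval (unit21 (Fp D) (Fm D) (Fbp D) (Fbm D) (Ep D) (Em D) (Hh D)
      (Z1 D) (Z2 D))); split; last split; last split.
  + exact: hc_homog_mx_eval.
  + by move=> p q X Y; apply: mx_eval_sbracket; apply: unit21_bracket.
  + exact: mx_eval_unit21_inj.
  + exact: odd_image.
  + exact: even_image.
  + exact: comm_center_mx_eval.
  + exact: odd_generate_sl.
  + exact: odd_center_generate_gl.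
  + by move=> stH stC st hst X; apply: st_mx_eval hst X.
- exact: Z2_number.
- split; last split.
  + exact: (comm_H_Ep odd).
  + exact: (comm_H_Em odd).
  + exact: (comm_Ep_Em odd).
  + exact: (comm_Z_H odd).
  + exact: (comm_Z_Ep odd).
  + exact: (comm_Z_Em odd).
- by case: odd => *; split; last split; last split.
- split; last split.
  + exact: (comm_Ep_Fm odd).
  + exact: (comm_Em_Fp odd).
  + exact: (comm_Ep_Gm odd).
  + exact: (comm_Em_Gp odd).
  + exact: (comm_Ep_Fp odd).
  + exact: (comm_Em_Fm odd).
  + exact: (comm_Ep_Gp odd).
  + exact: (comm_Em_Gm odd).
- by case: odd.
- split.
  + exact: (comm_Z_Fp odd).
  + exact: (comm_Z_Fm odd).
  + exact: (comm_Z_Gp odd).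
  + exact: (comm_Z_Gm odd).
- move=> stH stC st hst; split; last split.
  + exact: st_Fp hst.
  + exact: st_Fm hst.
  + exact: st_Fbp hst.
  + exact: st_Fbm hst.
  + exact: st_Ep hst.
  + exact: st_Em hst.
  + exact: st_H hst.
  + exact: st_Z1 hst.
  + exact: st_Z2 hst.
Qed.
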